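(* Let $G$ be a minimal simple group. The chromatic number $\chi(\Delta_S(G))$ of the induced solubility graph of $G$ satisfies the following bounds: (1) If $G=\mathrm{PSL}(2,2^p)$ where $p$ is a prime, then $2^{2p}-1\le\chi(\Delta_S(G))\le 3\cdot 2^p(2^p-1)-2$. (2) If $G=\mathrm{PSL}(2,3^p)$ where $p$ is an odd prime, then $\frac{3^p(3^p-1)}{2}\le\chi(\Delta_S(G))\le 3^p(3^p+1)-2$. (3) If $G=\mathrm{PSL}(2,p)$ where $p$ is a prime with $p\equiv 2$ or $3\pmod 5$, then $\frac{p(p-1)}{2}\le\chi(\Delta_S(G))\le (p-1)(2p+3)-2$. (4) If $G=\mathrm{Sz}(2^p)$ where $p$ is an odd prime, then $(2^{2p}+1)(2^p-1)\le\chi(\Delta_S(G))\le 2^{2p}(4\cdot 2^p-3)-2$. (5) If $G=\mathrm{PSL}(3,3)$, then $431\le\chi(\Delta_S(G))\le 2830$.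
   Context: A minimal simple group is a finite non-abelian simple group all of whose proper subgroups are soluble. (By Thompson, these are exactly, up to isomorphism: $\mathrm{PSL}(2,2^p)$, $p$ prime; $\mathrm{PSL}(2,3^p)$, $p$ odd prime; $\mathrm{PSL}(2,p)$, $p>3$ prime with $p\equiv 2$ or $3\pmod 5$; $\mathrm{PSL}(3,3)$; the Suzuki groups $\mathrm{Sz}(2^p)$, $p$ odd prime.) For a finite group $G$ with soluble radical $R(G)$ (largest soluble normal subgroup), the induced solubility graph $\Delta_S(G)$ is the simple graph with vertex set $G\setminus R(G)$ in which two distinct vertices $x,y$ are adjacent if and only if $\langle x,y\rangle$ is soluble; for a simple non-abelian group, $R(G)=1$. The chromatic number is the minimal number of colors in a proper vertex coloring. *)

(* Defs.v *)
From HB Require Import structures.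
From mathcomp Require Import all_boot all_order all_algebra.
From mathcomp Require Import all_fingroup all_solvable all_field.

Set Implicit Arguments.
Unset Strict Implicit.
Unset Printing Implicit Defensive.

Import GroupScope GRing.Theory.
Local Open Scope nat_scope.

Record sgraph := SGraph {
  vertex :> finType;
  edge : rel vertex;
  edge_sym : symmetric edge;
  edge_irrefl : irreflexive edge
}.

Definition proper_coloring (D : sgraph) (k : nat) (c : {ffun D -> 'I_k}) :=
  [forall x, forall y, edge x y ==> (c x != c y)].

Definition colorable (D : sgraph) (k : nat) :=
  [exists c : {ffun D -> 'I_k}, proper_coloring c].

Lemma colorable_card (D : sgraph) : colorable D #|D|.
Proof.
apply/existsP; exists [ffun x => enum_rank x].
apply/forallP=> x; apply/forallP=> y; apply/implyP=> exy; rewrite !ffunE.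
by apply: contraTneq exy => /enum_rank_inj->; rewrite edge_irrefl.
Qed.

Definition chromatic_number (D : sgraph) : nat :=
  ex_minn (ex_intro (colorable D) _ (colorable_card D)).

Section Solubility.

Variable gT : finGroupType.
Implicit Types G H : {group gT}.

Definition soluble_radical G : {group gT} :=
  (\prod_(H : {group gT} | (H <| G) && solvable H) H)%G.

Lemma soluble_radical_sol_normal G :
  (soluble_radical G <| G) && solvable (soluble_radical G).
Proof.
rewrite /soluble_radical.
elim/big_ind: _ => [|H K /andP[nHG sH] /andP[nKG sK]|//].
  by rewrite normal1 solvable1.
have nHK : H \subset 'N(K) := subset_trans (normal_sub nHG) (normal_norm nKG).
have nKY : K <| H <*> K by rewrite normalYr.
rewrite /= normalY //= (series_sol nKY) sK /=.
by rewrite quotientYidr // quotient_sol.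
Qed.

Lemma soluble_radical_max G H :
  H <| G -> solvable H -> H \subset soluble_radical G.
Proof.
move=> nHG sH; rewrite /soluble_radical (bigD1 H) /= ?nHG //.
exact: joing_subl.
Qed.

Section Graph.

Variable G : {group gT}.

Definition solubility_vertex := {x : gT | x \in G :\: soluble_radical G}.

Definition solubility_adj : rel solubility_vertex :=
  fun x y => (x != y) && solvable <<[set val x; val y]>>.

Lemma solubility_adj_sym : symmetric solubility_adj.
Proof. by move=> x y; rewrite /solubility_adj eq_sym setUC. Qed.

Lemma solubility_adj_irrefl : irreflexive solubility_adj.
Proof. by move=> x; rewrite /solubility_adj eqxx. Qed.

Definition solubility_graph : sgraph :=
  SGraph solubility_adj_sym solubility_adj_irrefl.

End Graph.

Definition minimal_simple G : Prop :=
  [/\ simple G, ~~ abelian G &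
      forall H : {group gT}, H \proper G -> solvable H].

End Solubility.

Section LinearGroups.

Variables (n : nat) (F : finFieldType).

(* {'GL_n[F]} consists of matrices of size n.-1.+1, i.e. n only when n > 0. *)
Definition SL : {set {'GL_n[F]}} := [set u | (\det (GLval u) == 1)%R].

Lemma SL_group_set : group_set SL.
Proof.
apply/group_setP; split=> [|u v]; rewrite !inE ?GL_1E ?det1 //.
by move=> /eqP du /eqP dv; rewrite GL_MxE det_mulmx du dv mulr1.
Qed.

Canonical SL_group := Group SL_group_set.

Definition PSL : {group coset_of 'Z(SL)} := (SL / 'Z(SL))%G.

End LinearGroups.

Section Suzuki.

Variable F : finFieldType.

(* Intended for #|F| = 2 ^ (2 * m + 1) with m = Sz_exponent. Then Sz_theta satisfies
   Sz_theta (Sz_theta x) = x ^+ 2, and x |-> x ^+ (2 ^ m) is its inverse. *)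
Definition Sz_exponent : nat := (logn 2 #|F|)./2.
Local Notation m := Sz_exponent.

Local Open Scope ring_scope.

Definition Sz_theta (x : F) : F := x ^+ (2 ^ m.+1).
Local Notation theta := Sz_theta.

Definition matrix4 (s : seq (seq F)) : 'M[F]_4 :=
  \matrix_(i, j) nth 0 (nth [::] s i) j.

(* Suzuki's generators, in the form given in Huppert and Blackburn,
   Finite Groups III, XI.3. *)
Definition Sz_unipotent (a b : F) : 'M[F]_4 := matrix4
  [:: [:: 1;                                     0;               0; 0];
      [:: a;                                     1;               0; 0];
      [:: b;                                     theta a;         1; 0];
      [:: a ^+ 2 * theta a + a * b + theta b;    a * theta a + b; a; 1]].

Definition Sz_diagonal (k : F) : 'M[F]_4 := matrix4
  [:: [:: k ^+ (1 + 2 ^ m); 0;             0;             0];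
      [:: 0;                k ^+ (2 ^ m);  0;             0];
      [:: 0;                0;             k ^- (2 ^ m);  0];
      [:: 0;                0;             0;             k ^- (1 + 2 ^ m)]].

Definition Sz_antidiagonal : 'M[F]_4 := matrix4
  [:: [:: 0; 0; 0; 1];
      [:: 0; 0; 1; 0];
      [:: 0; 1; 0; 0];
      [:: 1; 0; 0; 0]].

Definition Sz : {group {'GL_4[F]}} :=
  <<[set u : {'GL_4[F]} |
      [|| [exists a, exists b, GLval u == Sz_unipotent a b],
          [exists k, (k != 0) && (GLval u == Sz_diagonal k)]
        | GLval u == Sz_antidiagonal]]>>%G.

End Suzuki.

(* Main.v *)
(** An independent set of Delta_S(G) in a coset of a subgroup is a colour class,
    so the upper bounds come from colouring an element by a coset of a suitable
    subgroup.  If x and ux have the same colour, then <x, ux> contains u; when it is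
    soluble, this forces x into a small exceptional set, which is coloured greedily.
    - For q even (SL(2,q) and Sz(q)), u lies in a Sylow 2-subgroup U, any two conjugates
      of which meet trivially.  A soluble group that meets U nontrivially and does not
      normalise U has cyclic Sylow 2-subgroups, with a normal complement inverted by the
      involution in U, and thus x or ux has order dividing 4.
    - For q odd, u = 1 + t E_12 is a transvection.  Looking at the entries below the
      diagonal in the last nonscalar term K of the derived series of a soluble subgroup
      containing u and x excludes q prime to 3.  If q is a power of 3 and -1 is not a
      square, these entries are 1/t or -1/t off the centre of K, and x has trace in F_3.
    - In PSL(3,3), a soluble subgroup containing an element of order 13 normalises the
      subgroup it generates.
    For the lower bounds, the involutions form a clique since two involutions generate
    a dihedral group; in PSL(3,3) the clique is a line stabiliser, soluble by minimality. *)

Require Import Defs.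
From HB Require Import structures.
From mathcomp Require Import all_boot all_order all_algebra.
From mathcomp Require Import all_fingroup all_solvable all_field.
From mathcomp Require Import zify ring.

Set Implicit Arguments.
Unset Strict Implicit.
Unset Printing Implicit Defensive.

Import GroupScope GRing.Theory.
Local Open Scope nat_scope.

(** * Colorings of the solubility graph *)

(** In the even case the count is tight: |B| - 1 singletons, |U|m involutions outside B and |U|m
    cosets make 3|U|m - 1 colours, one more than the bound for SL(2,q) allows. Hence the search for
    an involution and an element of B that generate an insoluble group and can share a colour.
    Suzuki groups leave more room, but they contain of the order of q^4 elements of order 4, too
    many for singletons. These are coloured greedily; the obvious estimate of their degree is about
    5q^3, beyond the 4q^3 available, and two disjoint conjugates of the set of twisted elements
    bring it down to about 3q^3. In characteristic 3 the matrix argument has to fail somewhere,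
    because SL(2,3) is soluble, is generated by transvections and has a quaternion group as its last
    nonscalar derived term. The elements left over have trace 1 or -1: since 1 = -2 there, they are
    unipotent up to sign, hence conjugate to transvections, whose neighbours can be counted. *)

Lemma chromatic_number_colorable (D : sgraph) : colorable D (chromatic_number D).
Proof. by rewrite /chromatic_number; case: ex_minnP. Qed.

Lemma chromatic_number_min (D : sgraph) k :
  colorable D k -> chromatic_number D <= k.
Proof. by rewrite /chromatic_number; case: ex_minnP => m _ + ck; apply. Qed.

Section Colorings.

Variables (T : finType) (e : rel T).
Hypothesis e_sym : symmetric e.

(** Colours are naturals given by a function on the whole type, so that a colouring can be changed
    at one point or composed with a map without dependent types. *)
Definition colorable_on (X : {set T}) (k : nat) : Prop :=
  exists c : T -> nat, (forall x, x \in X -> c x < k) /\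
    (forall x y, x \in X -> y \in X -> x != y -> e x y -> c x != c y).

(** Allows any finite palette, such as cosets together with singletons; a colour becomes its
    position in an enumeration of [D]. *)
Lemma colorable_on_image (C : finType) (c : T -> C) (D : {set C}) (X : {set T}) k :
    (forall x, x \in X -> c x \in D) -> #|D| <= k ->
    (forall x y, x \in X -> y \in X -> x != y -> e x y -> c x != c y) ->
  colorable_on X k.
Proof.
move=> cD Dk cP; exists (fun x => index (c x) (enum D)); split=> [x Xx|x y Xx Xy nxy exy].
  by apply: leq_trans Dk; rewrite cardE index_mem mem_enum cD.
apply: contra (cP x y Xx Xy nxy exy) => /eqP /(congr1 (nth (c x) (enum D))).
by rewrite !nth_index ?mem_enum ?cD // => ->.
Qed.

Lemma colorable_on_clique (A X : {set T}) k :
    A \subset X -> {in A &, forall x y, x != y -> e x y} ->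
  colorable_on X k -> #|A| <= k.
Proof.
move=> sAX cA [c [ck cP]].
have injc : {in A &, injective c}.
  move=> x y Ax Ay cxy; apply/eqP; apply: contraT => nxy.
  by have := cP x y (subsetP sAX x Ax) (subsetP sAX y Ay) nxy (cA x y Ax Ay nxy);
    rewrite cxy eqxx.
case: (posnP k) => [k0|k_gt0].
  rewrite k0 leqn0 cards_eq0; apply/eqP/setP=> x; rewrite inE.
  by apply/negP=> /(subsetP sAX)/ck; rewrite k0.
case: k ck k_gt0 => // k ck _.
have: #|[set (inord (c x) : 'I_k.+1) | x in A]| <= #|'I_k.+1| by apply: max_card.
rewrite card_ord card_in_imset // => x y Ax Ay /(congr1 val) /=.
rewrite !inordK ?ck ?(subsetP sAX) //; exact: injc.
Qed.

Lemma colorable_on_add (X : {set T}) k x :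
    #|[set y in X | (y != x) && e x y]| < k ->
  colorable_on X k -> colorable_on (x |: X) k.
Proof.
move=> degx [c [ck cP]].
pose used := [set (inord (c y) : 'I_k.-1.+1) | y in [set y in X | (y != x) && e x y]].
have k_gt0 : 0 < k by apply: leq_ltn_trans degx.
have [i iP] : exists i : 'I_k.-1.+1, i \notin used.
  apply/existsP; rewrite -negb_forall; apply/negP=> /forallP allu.
  have: k <= #|used|.
    rewrite -[X in X <= _](prednK k_gt0) -[X in X <= _]card_ord.
    by apply/subset_leq_card/subsetP=> i _.
  rewrite leqNgt => /negP; apply; exact: leq_ltn_trans (leq_imset_card _ _) degx.
exists (fun y => if y == x then i : nat else c y); split=> [y|y z].
  case: eqP => [_ _|/eqP nyx]; first by rewrite -[X in _ < X](prednK k_gt0).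
  by rewrite in_setU1 (negPf nyx) => /ck.
have key w : w \in x |: X -> w != x -> e x w -> val i != c w.
  rewrite in_setU1 => Xw nwx exw; move: Xw; rewrite (negPf nwx) /= => Xw; apply: contra iP => /eqP ci.
  apply/imsetP; exists w; first by rewrite inE Xw nwx.
  by apply: val_inj; rewrite /= inordK ?prednK // ?ck // -ci.
move=> Xy Xz nyz eyz; case: (eqVneq y x) => [yx|nyx].
  have nzx : z != x by rewrite -yx eq_sym.
  by rewrite (negPf nzx); apply: key => //; rewrite -yx.
case: (eqVneq z x) => [zx|nzx].
  by rewrite eq_sym; apply: key => //; rewrite -zx e_sym.
by move: Xy Xz; rewrite !in_setU1 (negPf nyx) (negPf nzx) /= => Xy Xz; apply: cP.
Qed.

(** Vertices of [Y :\: X] are added one at a time. The degree is bounded in all of [Y], so the bound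
    serves every intermediate set and the order is immaterial. *)
Lemma colorable_on_greedy (X Y : {set T}) k :
    X \subset Y ->
    (forall x, x \in Y :\: X -> #|[set y in Y | (y != x) && e x y]| < k) ->
  colorable_on X k -> colorable_on Y k.
Proof.
move=> sXY deg cX; have [n] := ubnP #|Y :\: X|.
elim: n => // n IHn in X sXY deg cX *; rewrite ltnS => leYX.
have [/eqP|[x YXx]] := set_0Vmem (Y :\: X).
  by rewrite setD_eq0 => sYX; have -> : Y = X by apply/eqP; rewrite eqEsubset sYX.
have [Yx nXx] := setDP YXx.
have sxXY : x |: X \subset Y by rewrite subUset sub1set Yx.
apply: (IHn (x |: X)) => //.
- move=> y /setDP[Yy]; rewrite in_setU1 negb_or => /andP[_ nXy].
  by apply: deg; rewrite inE nXy.
- apply: colorable_on_add => //; apply: leq_ltn_trans (deg x YXx).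
  apply/subset_leq_card/subsetP=> y; rewrite !inE => /and3P[/(subsetP sXY)-> -> ->] //.
- apply: leq_trans leYX; apply: proper_card; rewrite properE; apply/andP; split.
    by apply: setDS; apply: subsetUr.
  apply/negP=> /subsetP/(_ x YXx); rewrite !inE eqxx //.
Qed.

End Colorings.

(** * The solubility relation on group elements *)

Section SolubilityRelation.
Local Open Scope group_scope.

Variable gT : finGroupType.
Implicit Types (x y : gT) (G H : {group gT}).

(** Reflexive, unlike adjacency: distinctness is left to [colorable_on], so cliques can be checked
    on all pairs. *)
Definition sol : rel gT := [rel x y | solvable <<[set x; y]>>].

Lemma sol_sym : symmetric sol.
Proof. by move=> x y; rewrite /sol /= setUC. Qed.

Lemma sol_sub H x y : solvable H -> x \in H -> y \in H -> sol x y.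
Proof.
move=> sH Hx Hy; apply: solvableS sH; rewrite gen_subG.
by apply/subsetP=> z; rewrite !inE => /orP[]/eqP->.
Qed.

(** Both pairs generate the same subgroup. Two elements [x] and [y * x] of one right coset are
    thereby traded for [x] and the subgroup element [y]. *)
Lemma sol_mull x y : sol x (y * x) = sol x y.
Proof.
rewrite /sol /=; congr (solvable _); apply/eqP; rewrite eqEsubset !gen_subG.
have X (A : {set gT}) z : z \in A -> z \in <<A>> by apply: mem_gen.
apply/andP; split; apply/subsetP=> z /set2P[]->.
- by rewrite X ?inE ?eqxx.
- by rewrite groupM ?X ?inE ?eqxx ?orbT.
- by rewrite X ?inE ?eqxx.
rewrite -[X in X \in _](mulgK x) groupM ?groupV ?X ?inE ?eqxx ?orbT //.
Qed.

Lemma sol_conj x y z : sol (x ^ z) (y ^ z) = sol x y.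
Proof.
rewrite /sol /= -!conjg_set1 -conjUg genJ.
by apply/esym/isog_sol/conj_isog.
Qed.

(** [x] inverts [x * y], so [<[x * y]>] is normal in the group generated, and the quotient is an
    image of [<[x]>]. *)
Lemma sol_involutions x y : x ^+ 2 = 1 -> y ^+ 2 = 1 -> sol x y.
Proof.
move=> x2 y2; have xV : x^-1 = x by apply/eqP; rewrite eq_invg_mul -expg2 x2.
have yV : y^-1 = y by apply/eqP; rewrite eq_invg_mul -expg2 y2.
have nD : <[x]> \subset 'N(<[x * y]>).
  rewrite cycle_subG; apply/normP; rewrite -genJ conjg_set1 /conjg -mulgA mulKg.
  by rewrite -{1}xV -{1}yV -invMg -/(cycle _) cycleV.
apply: (@sol_sub (<[x * y]> <*> <[x]>)%G); last 2 first.
- by rewrite mem_gen // inE cycle_id orbT.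
- rewrite -[y in y \in _](mulKg x) groupM ?groupV //; last by rewrite mem_gen // inE cycle_id.
  by rewrite mem_gen // inE cycle_id orbT.
have nY : <[x * y]> <| <[x * y]> <*> <[x]> by rewrite normalYl.
rewrite (series_sol nY) abelian_sol ?cycle_abelian //=.
by rewrite quotientYidl // quotient_sol // abelian_sol ?cycle_abelian.
Qed.

(** [G^#] stands for the complement of the soluble radical, which is trivial for a minimal simple
    group. *)
Definition solcol G k := colorable_on sol G^# k.

Lemma soluble_radical_simple G : minimal_simple G -> soluble_radical G :=: 1.
Proof.
case=> simG nabG _; have /andP[nR sR] := soluble_radical_sol_normal G.
have /simpleP[_ /(_ _ nR)[//|RG]] := simG; case/negP: nabG.
have solG : solvable G by rewrite -RG.
by rewrite cyclic_abelian // prime_cyclic // simple_sol_prime.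
Qed.

Lemma solubility_graph_colorable G k : minimal_simple G ->
  solcol G k <-> colorable (solubility_graph G) k.
Proof.
move=> mG; have R1 := soluble_radical_simple mG.
have memV z : (z \in G :\: soluble_radical G) = (z \in G^#).
  by rewrite R1 !inE.
split=> [[c [ck cP]]|/existsP[c /forallP cP]].
  apply/existsP; have ckv (x : solubility_graph G) : c (val x) < k.
    by apply: ck; rewrite -memV (valP x).
  exists [ffun x => Ordinal (ckv x)]; apply/forallP=> x; apply/forallP=> y.
  apply/implyP=> /andP[nxy sxy]; rewrite !ffunE -val_eqE /=.
  by apply: cP; rewrite -?memV ?(valP x) ?(valP y).
have dflt x : x \in G^# -> {v : solubility_graph G | val v = x}.
  by rewrite -memV => Gx; exists (Sub x Gx); rewrite SubK.
exists (fun x => if insub x is Some v then c v : nat else 0); split=> [x Gx|x y Gx Gy nxy sxy].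
  by case: (dflt x Gx) => v <-; rewrite valK.
case: (dflt x Gx) (dflt y Gy) nxy sxy => [v <-] [w <-] nvw svw; rewrite !valK.
have := cP v => /forallP/(_ w)/implyP; rewrite -val_eqE; apply.
by rewrite /= /solubility_adj -val_eqE nvw.
Qed.

Lemma chromatic_number_le G k : minimal_simple G -> solcol G k ->
  chromatic_number (solubility_graph G) <= k.
Proof. by move=> mG /solubility_graph_colorable-/(_ mG); apply: chromatic_number_min. Qed.

Lemma chromatic_number_ge G (A : {set gT}) : minimal_simple G ->
    A \subset G^# -> {in A &, forall x y, sol x y} ->
  #|A| <= chromatic_number (solubility_graph G).
Proof.
move=> mG sAG cA; apply: (@colorable_on_clique _ sol A G^#) => //.
  by move=> x y Ax Ay _; apply: cA.
by apply/solubility_graph_colorable; rewrite // chromatic_number_colorable.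
Qed.

Lemma solcol_card G k : #|G| <= k.+1 -> solcol G k.
Proof.
move=> Gk; apply: (@colorable_on_image _ _ _ id G^#) => //.
by rewrite -ltnS; move: Gk; rewrite (cardsD1 1) group1.
Qed.

End SolubilityRelation.

(** * Invariance under isomorphism *)

Section Isomorphism.
Local Open Scope group_scope.

Lemma sol_injm (aT rT : finGroupType) (G : {group aT}) (f : {morphism G >-> rT}) x y :
  'injm f -> x \in G -> y \in G -> sol (f x) (f y) = sol x y.
Proof.
move=> injf Gx Gy; have sxy : [set x; y] \subset G by apply/subsetP=> z /set2P[]->.
have -> : sol (f x) (f y) = solvable (f @* <<[set x; y]>>).
  by rewrite /sol /= morphim_gen // morphimU !morphim_set1.
by rewrite injm_sol // gen_subG.
Qed.

Lemma solcol_isog (aT rT : finGroupType) (G : {group aT}) (H : {group rT}) k :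
  G \isog H -> solcol G k -> solcol H k.
Proof.
rewrite isog_sym => /isogP[f injf fG] [c [ck cP]].
have im x : x \in H^# -> f x \in G^#.
  rewrite !inE => /andP[nx Hx]; rewrite morph_injm_eq1 // nx.
  by rewrite -fG mem_morphim.
exists (c \o f); split=> [x /im/ck //|x y Hx Hy nxy sxy].
have [/setD1P[_ Hx1] /setD1P[_ Hy1]] := (Hx, Hy).
apply: cP; rewrite ?im ?sol_injm //.
by apply: contra nxy => /eqP/(injmP injf) -> //.
Qed.

Lemma minimal_simple_isog (aT rT : finGroupType) (G : {group aT}) (H : {group rT}) :
  G \isog H -> minimal_simple G -> minimal_simple H.
Proof.
move=> isoGH [simG nabG propG]; split.
- by rewrite -(isog_simple isoGH).
- by rewrite -(isog_abelian isoGH).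
move=> K; move: isoGH; rewrite isog_sym => /isogP[f injf fG] pK.
rewrite -(injm_sol injf) ?proper_sub //; apply: propG.
by rewrite -fG injm_proper // proper_sub.
Qed.

Lemma chromatic_number_isog (aT rT : finGroupType) (G : {group aT}) (H : {group rT}) :
    G \isog H -> minimal_simple G ->
  chromatic_number (solubility_graph G) = chromatic_number (solubility_graph H).
Proof.
move=> isoGH mG; have mH := minimal_simple_isog isoGH mG.
apply/eqP; rewrite eqn_leq; apply/andP; split; apply: chromatic_number_le => //.
  apply: solcol_isog (isog_symr isoGH) _.
  by apply/solubility_graph_colorable; rewrite // chromatic_number_colorable.
apply: solcol_isog isoGH _.
by apply/solubility_graph_colorable; rewrite // chromatic_number_colorable.
Qed.

End Isomorphism.

(** * Fitting subgroups and fixed-point-free involutions *)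

Section GroupTheory.
Local Open Scope group_scope.
Variable gT : finGroupType.
Implicit Types (x y z : gT) (G H K : {group gT}).

Lemma nilpotent_central_ext G K :
  K \subset 'Z(G) -> nilpotent (G / K) -> nilpotent G.
Proof.
move=> sKZ nilGK; rewrite -quotient_center_nil.
have nKG : K <| G by apply: sub_center_normal.
rewrite -(isog_nil (third_isog sKZ nKG (center_normal G))).
exact: quotient_nil.
Qed.

(** Let [Z] be the intersection of ['F(G)] with its centraliser [C]. If [C / Z] were nontrivial, so
    would be its Fitting subgroup, whose preimage [N] is normal in [G] and nilpotent, since [Z] is
    central in [N]. Then [N] lies in ['F(G)], hence in [Z], a contradiction. *)
Lemma cent_sub_Fitting G : solvable G -> 'C_G('F(G)) \subset 'F(G).
Proof.
move=> solG; pose C := 'C_G('F(G))%G; pose Z := ('F(G) :&: C)%G.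
have nFG := Fitting_normal G.
have nCG : C <| G.
  by have := subcent_normal G 'F(G); rewrite (setIidPl (normal_norm nFG)).
have nZG : Z <| G by apply: normalI.
have nZC : Z <| C by apply: normalS nZG; rewrite ?subsetIr ?subsetIl.
pose N := (coset Z @*^-1 'F(C / Z))%G.
have NZ : N / Z = 'F(C / Z) by apply: cosetpreK.
have nNG : N <| G.
  by rewrite -(quotientGK nZG) cosetpre_normal gFnormal_trans // quotient_normal.
have sNC : N \subset C by rewrite sub_cosetpre_quo // gFsub.
have nilN : nilpotent N.
  apply: (@nilpotent_central_ext N Z); last by rewrite NZ Fitting_nil.
  rewrite subsetI sub_cosetpre centsC.
  exact: subset_trans (subset_trans sNC (subsetIr _ _)) (centS (subsetIl _ _)).
have sNZ : N \subset Z by rewrite subsetI sNC Fitting_max.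
have: 'F(C / Z) == 1.
  by rewrite -NZ; apply/eqP/trivgP; rewrite -(trivg_quotient Z) quotientS.
rewrite trivg_Fitting ?quotient_sol ?(solvableS (subsetIl _ _)) // => /eqP CZ1.
apply: subset_trans (subsetIl 'F(G) C); change (C \subset Z).
by rewrite -quotient_sub1 ?normal_norm // CZ1.
Qed.

(** The map sending [x] to [[~ x, z]] is injective on [K], as a coincidence yields a fixed point of
    [z]. By finiteness every element of [K] is such a commutator, and [z] inverts these. *)
Lemma fpf_involution_inverts K z :
  z ^+ 2 = 1 -> z \in 'N(K) -> 'C_K[z] = 1 -> {in K, forall k, k ^ z = k^-1}.
Proof.
move=> z2 nKz CK1 k Kk.
have sK : [set [~ x, z] | x in K] \subset K.
  apply/subsetP=> _ /imsetP[x Kx ->].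
  by rewrite /commg groupM ?groupV // memJ_norm.
have injf : {in K &, injective (fun x => [~ x, z])}.
  move=> x y Kx Ky; rewrite /commg => exy.
  have: y * x^-1 \in 'C_K[z].
    rewrite inE groupM ?groupV //=; apply/cent1P; apply/commgP/conjg_fixP.
    rewrite conjMg conjVg -[y ^ z](mulKVg y) -exy.
    by rewrite -mulgA mulgK.
  by rewrite CK1 => /set1P/eqP; rewrite -eq_mulgV1 => /eqP.
have: k \in [set [~ x, z] | x in K].
  have /eqP-> : [set [~ x, z] | x in K] == K :> {set gT} by rewrite eqEcard sK card_in_imset /=.
  by [].
case/imsetP=> x Kx ->; rewrite /commg conjMg -conjgM -expg2 z2 conjg1.
by rewrite conjVg [RHS]invMg invgK.
Qed.

Lemma inverted_abelian K z : {in K, forall k, k ^ z = k^-1} -> abelian K.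
Proof.
move=> invK; apply/centsP=> x Kx y Ky; red.
have := invK _ (groupM Kx Ky); rewrite conjMg (invK x) // (invK y) // invMg.
by move/(congr1 invg); rewrite !invMg !invgK.
Qed.

Lemma odd_2elt1 x : odd #[x] -> 2.-elt x -> x = 1.
Proof.
move=> ox px; apply/eqP; rewrite -order_eq1; have := part_pnat_id px.
rewrite p_part; case: (posnP (logn 2 #[x])) => [-> <-//|l0 e].
by move: ox; rewrite -e oddX /= orbF; case: eqP l0 => // ->.
Qed.

Lemma order2P z : reflect (z != 1 /\ z ^+ 2 = 1) (#[z] == 2).
Proof.
apply: (iffP eqP) => [oz|[nz1 z2]]; first by rewrite -order_eq1 oz -{2}oz expg_order.
by exact: nt_prime_order.
Qed.

End GroupTheory.

(** * Soluble groups with a cyclic Sylow 2-subgroup *)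

Section CyclicSylow2.
Local Open Scope group_scope.
Variable gT : finGroupType.
Implicit Types (H K : {group gT}).

(** The totient is the order of the automorphism group of a cyclic group; elements of odd order
    therefore act trivially on a cyclic 2-group. *)
Lemma totient_pnat2 n : 2.-nat n -> 2.-nat (totient n).
Proof.
move=> pn; have := part_pnat_id pn; rewrite p_part => <-.
by case: (logn 2 n) => // k; rewrite totient_pfactor //= mul1n pnatX pnat_id.
Qed.

(** [K] is the largest normal subgroup of odd order. In [H / K] the Fitting subgroup is a 2-group
    inside the abelian Sylow subgroup, which centralises it, so the two coincide by
    [cent_sub_Fitting]. Elements of odd prime order centralise this cyclic 2-group, so they would
    lie in it; hence [H / K] is a 2-group. *)
Lemma cyclic_Sylow2_complement H s : solvable H -> 2.-Sylow(H) <[s]> ->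
  exists K, [/\ K \subset H, odd #|K|, H \subset 'N(K) &
    forall h, h \in H -> exists i, exists2 k, k \in K & h = s ^+ i * k].
Proof.
move=> solH sylS; pose K := 'O_2^'(H)%G; exists K.
have nKH : H \subset 'N(K) := gFnorm _ _.
have oK : odd #|K| by have := pcore_pgroup 2^' H; rewrite /pgroup p'natE // dvdn2 negbK.
split=> // [|h Hh]; first exact: pcore_sub.
have [sSH pS _] := and3P sylS.
have Hs : s \in H by rewrite -cycle_subG.
have sylSK : 2.-Sylow(H / K) (<[s]> / K) by apply: quotient_pHall; rewrite // (subset_trans sSH).
have F2 : 'F(H / K) = 'O_2(H / K) by apply/Fitting_eq_pcore/trivg_pcore_quotient.
have solHK : solvable (H / K) by apply: quotient_sol.
have cF : 'C_(H / K)('F(H / K)) \subset 'F(H / K) := cent_sub_Fitting solHK.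
have eF : 'F(H / K) = <[s]> / K.
  apply/eqP; rewrite eqEsubset {1}F2 pcore_sub_Hall //.
  apply: subset_trans cF; rewrite subsetI quotientS //.
  rewrite centsC; apply: (@subset_trans _ _ (<[s]> / K)); first by rewrite F2 pcore_sub_Hall.
  exact: quotient_abelian (cycle_abelian s).
have pHK : 2.-group (H / K).
  apply/pgroupP=> r r_pr /(Cauchy r_pr)[x HKx ox].
  have nFx : x \in 'N('F(H / K)) by apply: (subsetP (gFnorm _ _)).
  have pF : 2.-group 'F(H / K) by rewrite F2 pcore_pgroup.
  have [->|nr2] := eqVneq r 2; first by [].
  suff Fx : x \in 'F(H / K) by move: (mem_p_elt pF Fx); rewrite /p_elt ox pnatE.
  apply: (subsetP cF); rewrite inE HKx /= -ker_conj_aut.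
  apply/kerP => //; apply/eqP; rewrite -order_eq1 -dvdn1.
  have cor : coprime r (totient #[coset K s]).
    rewrite prime_coprime //; apply/negP=> r2.
    have: 2.-nat (totient #[coset K s]).
      apply: totient_pnat2; apply: (mem_p_elt pF).
      by rewrite /= eF mem_quotient // cycle_id.
    case/andP=> _ /allP/(_ r); rewrite mem_primes r_pr r2 totient_gt0 order_gt0.
    by rewrite inE (negPf nr2) => /(_ isT).
  suff: #[conj_aut 'F(H / K) x] %| gcdn r (totient #[coset K s]) by rewrite (eqP cor).
  rewrite dvdn_gcd; apply/andP; split; first by rewrite -[X in _ %| X]ox morph_order.
  have -> : totient #[coset K s] = #|Aut 'F(H / K)|.
    rewrite /= eF -card_Aut_cycle quotient_cycle // (subsetP nKH) //.
  apply: order_dvdG; apply: (subsetP (Aut_conj_aut _ (H / K))).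
  by apply: mem_morphim.
have: coset K h \in <[s]> / K.
  have -> : <[s]> / K = H / K.
    by apply/eqP; rewrite eqEcard quotientS //= (card_Hall sylSK) part_pnat_id.
  exact: mem_quotient.
rewrite quotient_cycle ?(subsetP nKH) // => /cycleP[i].
rewrite -morphX ?(subsetP nKH) // => e; exists i.
have nKsi : s ^+ i \in 'N(K) by rewrite groupX // (subsetP nKH).
have/rcosetP[k Kk ->] : h \in K :* s ^+ i.
  by rewrite -val_coset // -e val_coset ?rcoset_refl // (subsetP nKH).
exists (k ^ (s ^+ i)); first by rewrite memJ_norm.
by rewrite conjgE mulKVg.
Qed.

End CyclicSylow2.

(** * Split groups of rank one in characteristic two *)

Section SplitRankOne.
Local Open Scope group_scope.

(** A split BN-pair of rank one: [B] is a Borel subgroup with unipotent radical [U] and torus of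
    order [m], and [w] represents the nontrivial Weyl element. SL(2,q) has |U| = q and Sz(q) has |U|
    = q^2, both with m = q - 1. [sqrU] and [commU] describe elements of order 4 in a Suzuki
    2-group. *)
Variables (gT : finGroupType) (G U B : {group gT}) (w : gT) (m : nat).
Implicit Types (x y z u v b g h k s : gT) (H K A S : {group gT}).
Hypothesis nUB : U <| B.
Hypothesis sBG : B \subset G.
Hypothesis Gw : w \in G.
Hypothesis bruhat : forall g, g \in G -> g \notin B ->
  exists2 b, b \in B & exists2 u, u \in U & g = b * w * u.
Hypothesis TIw : forall u, u \in U -> u ^ w \in B -> u = 1.
Hypothesis pU : 2.-group U.
Hypothesis cardU : (2 < #|U|)%N.
Hypothesis cardB : #|B| = (#|U| * m)%N.
Hypothesis oddm : odd m.
Hypothesis m_gt1 : (1 < m)%N.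
Hypothesis centB : forall z, z \in U -> #[z] = 2 -> 'C_B[z] = U.
Hypothesis card_involU : #|[set z in U | #[z] == 2]| = m.
Hypothesis expU : forall u, u \in U -> u ^+ 4 = 1.
Hypothesis sqrU : forall u v, u \in U -> v \in U -> u ^+ 2 = v ^+ 2 -> u ^+ 2 != 1 ->
  commute u v.
Hypothesis commU : forall u, u \in U -> u ^+ 2 != 1 ->
  exists2 v, v \in U & [/\ [~ u, v] != 1, [~ u, v] != u ^+ 2 & [~ u, v] ^+ 2 = 1].

Let sUB : U \subset B := normal_sub nUB.
Let sUG : U \subset G := subset_trans sUB sBG.
Let nUb b : b \in B -> {in U, forall u, u ^ b \in U}.
Proof. by move=> Bb u Uu; rewrite memJ_norm // (subsetP (normal_norm nUB)). Qed.

(** Trivial intersection in the form used throughout: write [g = b * w * u] and strip off [b] and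
    [u], which preserve [U] and [B], to reach [TIw]. *)
Lemma memJ_B x g : x \in U -> x != 1 -> g \in G -> x ^ g \in B -> g \in B.
Proof.
move=> Ux nx1 Gg Bxg; apply: contraT => nBg.
have [b Bb [u Uu eg]] := bruhat Gg nBg; case/eqP: nx1.
have Bu : u \in B := subsetP sUB u Uu.
move: Bxg; rewrite eg !conjgM memJ_norm ?(subsetP (normG B)) // => /(TIw (nUb Bb Ux)).
by move/eqP; rewrite conjg_eq1 => /eqP.
Qed.

Lemma w_notin_B : w \notin B.
Proof.
have /trivgPn[u Uu nu1] : U :!=: 1 by rewrite -cardG_gt1 ltnW.
by apply: contra nu1 => Bw; apply/eqP/TIw; rewrite // groupJ // (subsetP sUB).
Qed.

(** Uniqueness of the [U]-component in the big cell. Otherwise [w * (u * v^-1) * w^-1] lies in [B]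
    by [memJ_B], and a second use of that lemma puts [w] in [B]. *)
Lemma bruhat_inj x y u v g h : x ^ g = y ^ h -> x \in U -> x != 1 -> y \in B ->
  g = w * u -> h = w * v -> u \in U -> v \in U -> u = v.
Proof.
move=> exy Ux nx1 By eg eh Uu Uv; apply/eqP; rewrite eq_mulgV1.
apply: contraR w_notin_B => nuv; have Uuv : u * v^-1 \in U by rewrite groupM ?groupV.
have: w * (u * v^-1) * w^-1 \in B.
  apply: (@memJ_B x) => //; first by rewrite groupM ?groupV // groupM // (subsetP sUG).
  by rewrite (mulgA w) -eg -(mulgA g) -invMg -eh conjgM exy conjgK.
rewrite -{1}[w]invgK -mulgA -conjgE => Bc.
by rewrite -groupV; apply: memJ_B Bc; rewrite // groupV.
Qed.

Lemma card_compB : #|G :\: B| = (#|B| * #|U|)%N.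
Proof.
have -> : G :\: B = [set p.1 * w * p.2 | p in setX B U].
  apply/setP=> g; apply/setDP/imsetP=> [[Gg nBg]|[[b u] /setXP[/= Bb Uu] ->]].
    by have [b Bb [u Uu ->]] := bruhat Gg nBg; exists (b, u) => //; apply/setXP.
  split; first by rewrite groupM ?groupM // ?(subsetP sUG u Uu) // (subsetP sBG).
  by rewrite (groupMr _ (subsetP sUB u Uu)) (groupMl _ Bb) w_notin_B.
rewrite card_in_imset ?cardsX // => -[b u] [c v] /setXP[/= Bb Uu] /setXP[/= Bc Uv] e.
have /trivgPn[x Ux nx1] : U :!=: 1 by rewrite -cardG_gt1 ltnW.
have euv : u = v.
  apply: (@bruhat_inj x (x ^ (b^-1 * c)) u v (w * u) (w * v)) => //.
    rewrite -conjgM; congr (_ ^ _).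
    by rewrite -(mulgA b^-1) (mulgA c) -e -(mulgA b) mulKg.
  by rewrite memJ_norm ?(subsetP sUB) // groupM ?groupV // (subsetP (normG B)).
by move: e; rewrite euv => /mulIg/mulIg->.
Qed.

Lemma cardG_bruhat : #|G| = (#|B| * #|U|.+1)%N.
Proof. by rewrite -(cardsID B G) (setIidPr sBG) card_compB mulnS. Qed.

(** The order of [G] is [#|U| * m * #|U|.+1], and the last two factors are odd. *)
Lemma U_Sylow : 2.-Sylow(G) U.
Proof.
have m_gt0 : (0 < m)%N by apply: ltnW.
have ev : ~~ odd #|U|.
  have [|_ d2 _] := pgroup_pdiv pU; first by rewrite -cardG_gt1 ltnW.
  by rewrite -dvdn2.
rewrite pHallE sUG cardG_bruhat cardB /= -mulnA partnM ?muln_gt0 ?m_gt0 ?cardG_gt0 //.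
rewrite (part_pnat_id pU) part_p'nat ?muln1 //.
by rewrite p'natE // dvdn2 negbK oddM oddm /= ev.
Qed.

Lemma cent_involU z : z \in U -> #[z] = 2 -> 'C_G[z] = U.
Proof.
move=> Uz oz; apply/eqP; rewrite eqEsubset; apply/andP; split; last first.
  by rewrite -(centB Uz oz) setSI.
apply/subsetP=> g /setIP[Gg cgz]; rewrite -(centB Uz oz) inE cgz andbT.
apply: (@memJ_B z) => //; first by rewrite -order_eq1 oz.
have zg : commute z g by apply/esym/cent1P.
by rewrite conjgE zg mulKg (subsetP sUB).
Qed.

Lemma invol_central z x : z \in U -> z ^+ 2 = 1 -> x \in U -> commute z x.
Proof.
move=> Uz z2 Ux; case: (eqVneq z 1) => [->|nz1]; first exact/commute_sym/commute1.
have oz : #[z] = 2 by apply/eqP/order2P.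
by move: Ux; rewrite -(cent_involU Uz oz) => /setIP[_ /cent1P].
Qed.

Lemma two_elt_conj x : x \in G -> x ^+ 4 = 1 ->
  exists2 g, g \in G & x ^ g \in U.
Proof.
move=> Gx x4; have [||g Gg sXU] := Sylow_Jsub U_Sylow (Q := <[x]>%G).
- by rewrite cycle_subG.
- by rewrite /pgroup -orderE (pnat_dvd (n := 4)) // order_dvdn x4.
by exists g => //; apply: (subsetP sXU); rewrite memJ_conjg cycle_id.
Qed.

Lemma two_elt_B x : x \in B -> x ^+ 4 = 1 -> x \in U.
Proof.
move=> Bx x4; have SU : 2.-Sylow(B) U by apply: pHall_subl U_Sylow.
rewrite (mem_normal_Hall SU) // /p_elt (pnat_dvd (n := 4)) // order_dvdn x4 //.
Qed.

Lemma odd_capU x : x \in U -> odd #[x] -> x = 1.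
Proof. by move=> Ux ox; apply: odd_2elt1 => //; apply: mem_p_elt Ux. Qed.

(** The centraliser in [G] of an involution of [U] is the 2-group [U], so [z] acts on [K] without
    fixed points. *)
Lemma invol_inverts K z : K \subset G -> odd #|K| -> z \in U -> #[z] = 2 ->
  z \in 'N(K) -> {in K, forall k, k ^ z = k^-1}.
Proof.
move=> sKG oK Uz oz nKz; apply: fpf_involution_inverts => //.
  by rewrite -oz expg_order.
apply/trivgP/subsetP=> x /setIP[Kx cx]; rewrite inE; apply/eqP/odd_capU.
  by rewrite -(cent_involU Uz oz) inE cx (subsetP sKG).
by apply: dvdn_odd oK; apply: order_dvdG.
Qed.

(** A minimal normal subgroup [A] of [H] is elementary abelian. Were it a 2-group, some [A :^ g]
    would lie in [U], forcing [H :^ g] into [B]; as [u ^ g] is then in [B], so is [g], and [H] would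
    lie in [B]. *)
Lemma minnormal_odd H u : H \subset G -> solvable H -> u \in H -> u \in U ->
    u != 1 -> ~~ (H \subset B) ->
  exists A, [/\ A != 1 :> {set gT}, A \subset H, H \subset 'N(A) & odd #|A|].
Proof.
move=> sHG solH Hu Uu nu1 nHB.
have nH1 : H :!=: 1.
  by apply: contraNneq nu1 => H1; move: Hu; rewrite H1 => /set1P->.
have [A minA sAH] := minnormal_exists nH1 (normG H).
have [nAH nA1 /is_abelemP[p p_pr /abelem_pgroup pA]] := minnormal_solvable minA sAH solH.
exists A; split=> //; case: (eqVneq p 2) => [p2|np2]; last first.
  have [//|_ _ [n ->]] := pgroup_pdiv pA; rewrite oddX orbC.
  by case: (even_prime p_pr) => [/eqP|->] //; rewrite (negPf np2).
rewrite p2 in pA; case/negP: nHB.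
have [g Gg sAU] := Sylow_Jsub U_Sylow (subset_trans sAH sHG) pA.
have /trivgPn[a Aa na1] := nA1.
have HB h : h \in H -> h ^ g \in B.
  move=> Hh; apply: (@memJ_B (a ^ g)).
  - by apply: (subsetP sAU); rewrite memJ_conjg.
  - by rewrite conjg_eq1.
  - by rewrite groupJ // (subsetP sHG).
  rewrite -conjJg; apply: (subsetP sUB); apply: (subsetP sAU).
  by rewrite memJ_conjg memJ_norm // (subsetP nAH).
have Bg : g \in B by apply: (memJ_B Uu) => //; apply: HB.
by apply/subsetP=> h /HB; rewrite memJ_norm // (subsetP (normG B)).
Qed.

(** Two distinct involutions of the Sylow subgroup would both invert [A], and their product would
    centralise it, although its centraliser is a 2-group. A group with a unique involution is cyclic
    or quaternion, and [sqrU] rules out the latter. *)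
Lemma Sylow2_cyclic H u : H \subset G -> solvable H -> u \in H -> u \in U ->
    u != 1 -> ~~ (H \subset B) ->
  exists2 s, s \in U & 2.-Sylow(H) <[s]> /\ u \in <[s]>.
Proof.
move=> sHG solH Hu Uu nu1 nHB.
have [A [nA1 sAH nAH oA]] := minnormal_odd sHG solH Hu Uu nu1 nHB.
have [||S sylS] := @Sylow_superset 2 _ H <[u]>%G.
- by rewrite cycle_subG.
- exact: mem_p_elt pU Uu.
rewrite cycle_subG => Su; have [sSH pS _] := and3P sylS.
have [g Gg sSU] := Sylow_Jsub U_Sylow (subset_trans sSH sHG) pS.
have Bg : g \in B.
  apply: (memJ_B Uu) => //; apply: (subsetP sUB); apply: (subsetP sSU).
  by rewrite memJ_conjg.
have {g Gg Bg} sSU : S \subset U.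
  apply/subsetP=> x Sx; have: x ^ g \in U by apply: (subsetP sSU); rewrite memJ_conjg.
  by rewrite memJ_norm // (subsetP (normal_norm nUB)).
have uniq_invol y z : y \in S -> z \in S -> y != 1 -> z != 1 -> y ^+ 2 = 1 -> z ^+ 2 = 1 -> y = z.
  move=> Sy Sz ny1 nz1 y2 z2; have [Uy Uz] := (subsetP sSU y Sy, subsetP sSU z Sz).
  have invA x : x \in S -> x != 1 -> x ^+ 2 = 1 -> {in A, forall a, a ^ x = a^-1}.
    move=> Sx nx1 x2; apply: invol_inverts; rewrite ?(subsetP sSU) //.
    - exact: subset_trans sHG.
    - exact/eqP/order2P.
    - by rewrite (subsetP nAH) // (subsetP sSH).
  have cyz : commute y z by apply: invol_central.
  apply/eqP; apply: contraT => nyz; case/negP: nA1; apply/eqP/trivgP.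
  have oyz : #[y * z] = 2.
    apply/eqP/order2P; split; last by rewrite expgMn // y2 z2 mulg1.
    apply: contra nyz => /eqP e; rewrite eq_mulgV1.
    by rewrite -e; apply/eqP; congr (_ * _); apply/eqP; rewrite eq_invg_mul -expg2 z2.
  apply/subsetP=> a Aa; rewrite inE; apply/eqP/odd_capU.
    rewrite -(cent_involU (groupM Uy Uz) oyz) inE (subsetP sHG) ?(subsetP sAH) //=.
    apply/cent1P/commgP/conjg_fixP.
    by rewrite conjgM (invA y) // (invA z) ?groupV // invgK.
  by apply: dvdn_odd oA; apply: order_dvdG.
have [/forall_inP S2|] := boolP [forall x in S, x ^+ 2 == 1].
  exists u => //; split; last exact: cycle_id.
  have -> // : <[u]> = S.
  apply/eqP; rewrite eqEsubset cycle_subG Su; apply/subsetP=> x Sx.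
  have [->|nx1] := eqVneq x 1; first exact: group1.
  by rewrite (uniq_invol x u) ?cycle_id //; apply/eqP/S2.
rewrite negb_forall_in => /exists_inP[s Ss ns2].
have Us := subsetP sSU s Ss; exists s => //.
suff eS : <[s]> = S by rewrite eS.
have s4 : (s ^+ 2) ^+ 2 = 1 by rewrite -expgM expU.
have key x : x \in S -> x ^+ 2 = 1 -> x \in <[s]>.
  move=> Sx x2; have [->|nx1] := eqVneq x 1; first exact: group1.
  by rewrite (uniq_invol x (s ^+ 2)) ?groupX // cycle_id.
apply/eqP; rewrite eqEsubset cycle_subG Ss; apply/subsetP=> x Sx.
have Ux := subsetP sSU x Sx.
have [x2|nx2] := eqVneq (x ^+ 2) 1; first exact: key.
have exs : x ^+ 2 = s ^+ 2.
  by apply: uniq_invol; rewrite ?groupX // -expgM expU.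
rewrite -(mulgKV s x) groupM ?cycle_id // key ?groupM ?groupV //.
have cxs : commute x s by apply: sqrU.
by rewrite expgMn ?expgVn ?exs ?mulgV //; apply: commuteV.
Qed.


Lemma sol_decomposition H u : H \subset G -> solvable H -> u \in H -> u \in U ->
    u != 1 -> ~~ (H \subset B) ->
  exists s K, [/\ s \in U /\ s \in 'N(K), u \in <[s]>, K \subset G, odd #|K| &
    forall h, h \in H -> exists i, exists2 k, k \in K & h = s ^+ i * k].
Proof.
move=> sHG solH Hu Uu nu1 nHB.
have [s Us [sylS us]] := Sylow2_cyclic sHG solH Hu Uu nu1 nHB.
have [K [sKH oK nKH decH]] := cyclic_Sylow2_complement solH sylS.
have Hs : s \in H by rewrite -cycle_subG (pHall_sub sylS).
exists s, K; split=> //; first by rewrite (subsetP nKH).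
exact: subset_trans sHG.
Qed.

(** Squaring moves [v * k] into the coset of [v ^+ 2]. Once the representative is an involution, it
    inverts [K] and the next square is 1. *)
Lemma exp4_coset K v k : K \subset G -> odd #|K| -> v \in U -> v \in 'N(K) ->
  v != 1 -> k \in K -> (v * k) ^+ 4 = 1.
Proof.
move=> sKG oK Uv nKv nv1 Kk.
have sqr y l : (y * l) ^+ 2 = y ^+ 2 * (l ^ y * l).
  by rewrite !expg2 -mulgA (mulgA l) (conjgC l y) -(mulgA y (l ^ y)) (mulgA y y).
have invol y l : y \in U -> y \in 'N(K) -> y != 1 -> y ^+ 2 = 1 -> l \in K -> (y * l) ^+ 2 = 1.
  move=> Uy nKy ny1 y2 Kl; have oy : #[y] = 2 by apply/eqP/order2P.
  by rewrite sqr y2 (invol_inverts sKG oK Uy oy nKy) // mulVg mul1g.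
have [v2|nv2] := eqVneq (v ^+ 2) 1.
  by rewrite (expgM _ 2 2) (invol v k) ?expg1n.
have Kkk : k ^ v * k \in K by apply: groupM; rewrite ?memJ_norm.
rewrite (expgM _ 2 2) (sqr v) (invol (v ^+ 2)) ?groupX //.
by rewrite -expgM expU.
Qed.

(** Write [y = s ^+ i * k]. If [s ^+ i] is nontrivial then [y] has order dividing 4; otherwise
    [u * y] lies in the coset of [u], which is nontrivial. *)
Lemma sol_coset u y : u \in U -> u != 1 -> y \in G -> y \notin B -> sol u y ->
  y ^+ 4 = 1 \/ (u * y) ^+ 4 = 1.
Proof.
move=> Uu nu1 Gy nBy sol_uy; pose H := <<[set u; y]>>%G.
have [Hu Hy] : u \in H /\ y \in H by rewrite !mem_gen ?inE ?eqxx ?orbT.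
have sHG : H \subset G.
  by rewrite gen_subG; apply/subsetP=> x /set2P[]-> //; apply: (subsetP sUG).
have [|s [K [[Us nKs] /cycleP[j uj] sKG oK decH]]] := sol_decomposition sHG sol_uy Hu Uu nu1.
  by apply: contra nBy => /subsetP->.
have [i [k Kk ey]] := decH y Hy.
have [si1|nsi1] := eqVneq (s ^+ i) 1; last by left; rewrite ey (exp4_coset sKG) ?groupX.
by right; rewrite ey si1 mul1g (exp4_coset sKG) // uj groupX.
Qed.

(** A superset of the odd components [k] of the neighbours [u ^+ i * k] of an element [u] of order
    4. It keeps only what follows from [K] being abelian and inverted by [u ^+ 2], so that it can be
    counted without knowing [K]. *)
Definition twisted u := [set k in G | [&& k != 1, odd #[k], k ^ (u ^+ 2) == k^-1 &
  k * k ^ u == k ^ u * k]].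

(** Having order 4, [u] generates the whole Sylow subgroup [<[s]>], so the 2-component of [y] is a
    power of [u]. *)
Lemma sol_twisted u y : u \in U -> u ^+ 2 != 1 -> y \in G -> y \notin B -> sol u y ->
  exists i : 'I_4, y \in (u ^+ i) *: twisted u.
Proof.
move=> Uu nu2 Gy nBy sol_uy; pose H := <<[set u; y]>>%G.
have [Hu Hy] : u \in H /\ y \in H by rewrite !mem_gen ?inE ?eqxx ?orbT.
have nu1 : u != 1 by apply: contraNneq nu2 => ->; rewrite expg1n.
have sHG : H \subset G.
  by rewrite gen_subG; apply/subsetP=> x /set2P[]-> //; apply: (subsetP sUG).
have [|s [K [[Us nKs] /cycleP[j uj] sKG oK decH]]] := sol_decomposition sHG sol_uy Hu Uu nu1.
  by apply: contra nBy => /subsetP->.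
have s4 : s ^+ 4 = 1 := expU Us.
have oddj : odd j.
  apply: contraR nu2 => evj; rewrite uj -expgM.
  have -> : (j * 2 = 4 * j./2)%N.
    by rewrite -[in LHS](odd_double_half j) (negPf evj) add0n -muln2 -mulnA mulnC.
  by rewrite expgM s4 expg1n.
(* [j] is odd, so its square is 1 modulo 4 and [u ^+ j = s ^+ (j * j) = s]. *)
have su : s = u ^+ j.
  rewrite uj -expgM -(expg_mod _ s4) -modnMm.
  have: odd (j %% 4) by rewrite odd_mod.
  have: (j %% 4 < 4)%N by rewrite ltn_mod.
  by case: (j %% 4)%N => [|[|[|[|]]]].
have [i [k Kk ey]] := decH y Hy.
have oz : #[u ^+ 2] = 2 by apply/eqP/order2P; rewrite nu2 -expgM expU.
have nKu : u \in 'N(K) by rewrite uj groupX.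
have invK : {in K, forall k, k ^ (u ^+ 2) = k^-1}.
  by apply: invol_inverts; rewrite ?groupX.
have abK := inverted_abelian invK.
exists (inord ((j * i) %% 4)); rewrite inordK ?ltn_mod //.
have -> : u ^+ ((j * i) %% 4) = s ^+ i.
  by rewrite su -expgM expg_mod // expU.
rewrite ey mem_lcoset mulKg inE (subsetP sKG) // invK // eqxx /=.
rewrite (dvdn_odd (order_dvdG Kk) oK) /=; apply/andP; split.
  apply: contra nBy => /eqP k1; rewrite ey k1 mulg1.
  by rewrite (subsetP sUB) ?groupX.
by apply/eqP/(centsP abK); rewrite // memJ_norm.
Qed.

Definition invol_out := [set t in G :\: U | #[t] == 2].

(** An involution outside [U] is conjugate into [U] by an element outside [B]; the Bruhat form of
    that element leaves only the parameters [z] and [u]. *)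
Lemma invol_outE : invol_out = [set p.1 ^ (w * p.2) | p in setX [set z in U | #[z] == 2] U].
Proof.
apply/setP=> t; rewrite inE; apply/andP/imsetP.
  case=> /setDP[Gt nUt] ot2; have [nt1 t2] := order2P t ot2.
  have [|g Gg Utg] := two_elt_conj Gt; first by rewrite (expgM _ 2 2) t2 expg1n.
  have nBg : g^-1 \notin B.
    apply: contra nUt => Bg; rewrite -(conjgK g t) memJ_norm //.
    by apply: (subsetP (normal_norm nUB)).
  have [|b Bb [u Uu eg]] := bruhat _ nBg; first by rewrite groupV.
  exists ((t ^ g) ^ b, u); last by rewrite /= -(conjgM (t ^ g)) mulgA -eg conjgK.
  by apply/setXP; rewrite inE /= nUb //= !orderJ.
case=> -[z u] /setXP[/=]; rewrite inE => /andP[Uz oz] Uu ->.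
have Gwu : w * u \in G by rewrite groupM // (subsetP sUG).
have nz1 : z != 1 by case/order2P: oz.
split; last by rewrite orderJ.
apply/setDP; split; first by rewrite groupJ // (subsetP sUG).
apply: contra w_notin_B => Uz'.
have := memJ_B Uz nz1 Gwu (subsetP sUB _ Uz').
by rewrite groupMr // (subsetP sUB).
Qed.

Lemma card_invol_out : #|invol_out| = (#|U| * m)%N.
Proof.
rewrite invol_outE card_in_imset; first by rewrite cardsX card_involU mulnC.
move=> [x u] [y v] /setXP[/= Ix Uu] /setXP[/= Iy Uv] e.
move: Ix Iy; rewrite !inE => /andP[Ux /order2P[nx1 _]] /andP[Uy _].
have euv : u = v by apply: (bruhat_inj e) => //; rewrite (subsetP sUB).
by move: e; rewrite euv => /conjg_inj->.
Qed.

Lemma twistedJ u v : v \in G -> twisted u :^ v \subset twisted (u ^ v).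
Proof.
move=> Gv; apply/subsetP=> _ /imsetP[k tk ->].
move: tk; rewrite !inE => /and5P[Gk nk1 ok /eqP kz /eqP cku].
rewrite groupJ // conjg_eq1 nk1 orderJ ok -conjXg -(conjJg k) kz conjVg eqxx /=.
by rewrite -(conjJg k) -(conjMg k) cku (conjMg _ k).
Qed.

(** An involution commuting with [k] is conjugate into [U], and its centraliser is then a
    2-group. *)
Lemma cent1_odd k : k \in G -> odd #[k] -> k != 1 -> odd #|'C_G[k]|.
Proof.
move=> Gk ok nk1; apply: contraT; rewrite -dvdn2 => /(Cauchy (isT : prime 2))[t /setIP[Gt ckt] ot].
have [|g Gg Utg] := two_elt_conj Gt; first by rewrite (expgM _ 2 2) -{1}ot expg_order expg1n.
case/negP: nk1; rewrite -(conjg_eq1 _ g); apply/eqP/odd_capU; last by rewrite orderJ.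
rewrite -(cent_involU Utg) ?orderJ // inE groupJ //=; apply/cent1P; red.
by rewrite -!conjMg (cent1P ckt).
Qed.

(** If [k] lay in both sets, [C = 'C_G[k]] would be abelian of odd order, inverted by [u ^+ 2] and
    normalised by [u] and [u ^ v], hence by the involution [[~ u, v]]. The latter would also invert
    [k], so its product with [u ^+ 2], again an involution of [U], would centralise [k]. *)
Lemma twisted_TI u v k : u \in U -> u ^+ 2 != 1 -> v \in U ->
    [~ u, v] != 1 -> [~ u, v] != u ^+ 2 -> [~ u, v] ^+ 2 = 1 ->
  k \in twisted u -> k \notin twisted (u ^ v).
Proof.
move=> Uu nu2 Uv nc1 ncz c2; pose c := [~ u, v]; pose z := u ^+ 2.
have Uc : c \in U by apply: groupR.
have Uz : z \in U by apply: groupX.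
have cV : c^-1 = c by apply/eqP; rewrite eq_invg_mul -expg2 c2.
have z2 : z ^+ 2 = 1 by rewrite -expgM expU.
have oc : #[c] = 2 by apply/eqP/order2P.
have oz : #[z] = 2 by apply/eqP/order2P.
have euv : u ^ v = u * c by rewrite /c commgEl mulKVg.
rewrite !inE => /and5P[Gk nk1 ok /eqP kz /eqP cku]; apply/negP=> /and5P[_ _ _ _ /eqP ckuv].
pose C := 'C_G[k]%G; have oC : odd #|C| by apply: cent1_odd.
have sCG : C \subset G := subsetIl _ _.
have nC y : y \in U -> C \subset 'C_G[k ^ y] -> y \in 'N(C).
  move=> Uy sC; apply/normP/eqP; rewrite eq_sym eqEcard cardJg leqnn andbT.
  by rewrite conjIg (conjGid (subsetP sUG y Uy)) -cent1J.
have nCz : z \in 'N(C).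
  by apply: nC; rewrite // kz; apply/subsetP=> x; rewrite !in_setI ![x \in 'C[_]]cent1C groupV.
have invC := invol_inverts sCG oC Uz oz nCz.
have abC := inverted_abelian invC.
have nCy y : y \in U -> k * k ^ y = k ^ y * k -> y \in 'N(C).
  move=> Uy cky; have Ckky : k ^ y \in C.
    apply/setIP; split; first by rewrite groupJ // (subsetP sUG).
    exact/cent1P/esym.
  apply: nC => //; rewrite subsetI sCG /=; apply/subsetP=> x Cx.
  by apply/cent1P; apply: (centsP abC).
have nCu : u \in 'N(C) by apply: nCy.
have nCc : c \in 'N(C).
  by rewrite -(mulKg u c) -euv groupM ?groupV // nCy ?groupJ.
have Ck : k \in C by rewrite in_setI Gk cent1id.
have kc := invol_inverts sCG oC Uc oc nCc Ck.
case/negP: nk1; apply/eqP/odd_capU => //.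
have ccz : commute c z by apply: invol_central.
rewrite -(cent_involU (groupM Uc Uz)); last first.
  apply/eqP/order2P; split; last by rewrite expgMn // z2 c2 mulg1.
  by rewrite -eq_invg_mul cV.
rewrite in_setI Gk; apply/cent1P/commgP/conjg_fixP.
by rewrite conjgM kc conjVg kz invgK.
Qed.

(* [twisted u] and its conjugate by v are disjoint, and translation by u ^+ 2 embeds both
   in the set of involutions outside U. *)
Lemma card_twisted u : u \in U -> u ^+ 2 != 1 -> (2 * #|twisted u| <= #|U| * m)%N.
Proof.
move=> Uu nu2; have [v Uv [nc1 ncz c2]] := commU Uu nu2.
have z2 : (u ^+ 2) ^+ 2 = 1 by rewrite -expgM expU.
have euv2 : (u ^ v) ^+ 2 = u ^+ 2.
  have -> : u ^ v = u * [~ u, v] by rewrite commgEl mulKVg.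
  rewrite expgMn ?c2 ?mulg1 //; apply/commute_sym/invol_central => //.
  exact: groupR.
have sJ := twistedJ u (subsetP sUG v Uv).
have -> : (2 * #|twisted u| = #|twisted u :|: twisted u :^ v|)%N.
  rewrite cardsU cardJg addnn -mul2n.
  suff -> : twisted u :&: twisted u :^ v = set0 by rewrite cards0 subn0.
  apply/setP=> k; rewrite in_setI in_set0.
  apply/negP=> /andP[tk /(subsetP sJ)]; apply/negP; exact: twisted_TI tk.
rewrite -card_invol_out -(card_lcoset _ (u ^+ 2)); apply/subset_leq_card/subsetP=> t.
have Uz : u ^+ 2 \in U by apply: groupX.
rewrite mem_lcoset; set k := _ * t => tk.
have {tk} [Gk nk1 ok kz] : [/\ k \in G, k != 1, odd #[k] & k ^ (u ^+ 2) = k^-1].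
  case/setUP: tk => [|/(subsetP sJ)]; rewrite inE ?euv2.
    by case/and5P=> Gk nk1 ok /eqP kz _.
  by case/and5P=> Gk nk1 ok /eqP kz _.
have -> : t = u ^+ 2 * k by rewrite mulKVg.
have nUt : u ^+ 2 * k \notin U.
  by rewrite groupMl //; apply: contra nk1 => Uk; apply/eqP/odd_capU.
rewrite inE; apply/andP; split.
  by apply/setDP; split=> //; apply: groupM; rewrite ?(subsetP sUG _ Uz).
apply/order2P; split.
  by apply: contraNneq nUt => ->; apply: group1.
rewrite expg2 -mulgA (mulgA k) (conjgC k) kz -(mulgA (u ^+ 2)) mulVg mulg1.
by rewrite -expg2.
Qed.

(** [B] contributes everything but 1 and [u]; outside [B] there are four translates of [twisted u],
    each of size at most half of [#|U| * m]. *)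
Lemma degree_order4 u : u \in U -> u ^+ 2 != 1 ->
  (#|[set y in G^# | (y != u) && sol u y]| <= #|B| - 2 + 2 * (#|U| * m))%N.
Proof.
move=> Uu nu2; have nu1 : u != 1 by apply: contraNneq nu2 => ->; rewrite expg1n.
have cB : #|B :\ 1 :\ u| = (#|B| - 2)%N.
  have := cardsD1 1 B; have := cardsD1 u (B :\ 1).
  rewrite group1 in_setD1 nu1 (subsetP sUB) //= => -> ->.
  by rewrite !addnA addKn.
rewrite -cB; apply: leq_trans (leq_add (leqnn _) _).
  apply: (@leq_trans #|(B :\ 1 :\ u) :|: \bigcup_(i < 4) (u ^+ i *: twisted u)|); last first.
    by apply: leq_trans (leq_card_setU _ _) _.
  apply/subset_leq_card/subsetP=> y; rewrite !inE => /and3P[/andP[ny1 Gy] nyu sol_uy].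
  rewrite ny1 nyu /=; case: (boolP (y \in B)) => //= nBy.
  by have [i yi] := sol_twisted Uu nu2 Gy nBy sol_uy; apply/bigcupP; exists i.
apply: leq_trans (_ : \sum_(i < 4) #|u ^+ i *: twisted u| <= _)%N.
  by elim/big_rec2: _ => [|i a A _ le]; rewrite ?cards0 // (leq_trans (leq_card_setU _ _)) // leq_add2l.
under eq_bigr do rewrite card_lcoset; rewrite sum_nat_const card_ord.
by rewrite -[4]/(2 * 2)%N -mulnA leq_mul2l card_twisted.
Qed.

(** The pair that will share a colour. In a soluble group containing both, [b0] would have order
    dividing 4, hence lie in [U], or be inverted by [t0], hence lie in [B :^ t0]. *)
Lemma exists_nonadjacent : exists t0 b0,
  [/\ t0 \in invol_out, b0 \in B, b0 != 1 & ~~ sol t0 b0].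
Proof.
have /card_gt0P[t0 It0] : (0 < #|invol_out|)%N by rewrite card_invol_out muln_gt0 cardG_gt0 ltnW.
exists t0.
have [Gt0 nUt0 nt0 t02] : [/\ t0 \in G, t0 \notin U, t0 != 1 & t0 ^+ 2 = 1].
  by move: It0; rewrite !inE => /andP[/andP[nUt Gt] /order2P[]].
have t04 : t0 ^+ 4 = 1 by rewrite (expgM _ 2 2) t02 expg1n.
have [g Gg Utg] := two_elt_conj Gt0 t04.
have nBg : g \notin B.
  apply: contra nUt0 => Bg; rewrite -(conjgK g t0) memJ_norm //.
  by rewrite groupV (subsetP (normal_norm nUB)).
have TIB h : h \in G -> h \notin B -> (#|B :&: B :^ h| <= m)%N.
  move=> Gh nBh; have : (B :&: B :^ h) :&: U = 1.
    apply/trivgP/subsetP=> x /setIP[/setIP[_ Bhx] Ux]; rewrite inE.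
    apply: contraR nBh => nx1; rewrite -groupV.
    by apply: (memJ_B Ux nx1); rewrite ?groupV // -mem_conjg.
  move/TI_cardMg=> e; rewrite -(leq_pmul2l (cardG_gt0 U)) -cardB mulnC -e.
  by apply/subset_leq_card; rewrite mul_subG // subsetIl.
have nBt0 : t0 \notin B by apply: contra nUt0 => Bt0; apply: two_elt_B.
(* Avoiding [B :^ g^-1] keeps [H :^ g] from lying in [B]; avoiding [B :^ t0] keeps [t0] from
   inverting [b0]. Each intersection has at most [m] elements, and [#|U|] at least 3 makes [B :\: U]
   too large to be covered. *)
pose X := (B :&: B :^ g^-1) :|: (B :&: B :^ t0).
have [b0 /setDP[/setDP[Bb0 nUb0] nXb0]] : exists b0, b0 \in (B :\: U) :\: X.
  apply/set0Pn; rewrite setD_eq0; apply/negP=> sBX.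
  have le1 : (1 + #|B :\: U| <= #|X|)%N.
    have <- : #|1 |: (B :\: U)| = (1 + #|B :\: U|)%N by rewrite cardsU1 !inE group1.
    by apply/subset_leq_card; rewrite subUset sBX andbT sub1set !inE !group1.
  have le2 : (#|X| + 1 <= m + m)%N.
    apply: leq_trans (leq_add (TIB g^-1 _ _) (TIB t0 Gt0 nBt0)); rewrite ?groupV //.
    rewrite -cardsUI leq_add2l; apply/card_gt0P; exists 1.
    by rewrite !inE !group1.
  have cBU : #|B :\: U| = (#|U| * m.-1)%N.
    by rewrite cardsD (setIidPr sUB) cardB -{2}[#|U|]muln1 -mulnBr subn1.
  have m1 : (0 < m.-1)%N by rewrite -ltnS prednK // ltnW.
  have le3 : (3 * m.-1 <= #|U| * m.-1)%N by rewrite leq_mul2r cardU orbT.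
  by move: le1 le2; rewrite cBU; move: le3 m1; clear; lia.
have b04 : b0 ^+ 4 != 1 by apply: contra nUb0 => /eqP; apply: two_elt_B.
have nb01 : b0 != 1 by apply: contraNneq nUb0 => ->; apply: group1.
exists b0; split=> //; apply/negP=> sol_tb; pose H := <<[set t0; b0]>>%G.
have [Ht Hb] : t0 \in H /\ b0 \in H by rewrite !mem_gen ?inE ?eqxx ?orbT.
have sHG : H :^ g \subset G.
  rewrite -(conjGid Gg) conjSg gen_subG; apply/subsetP=> x /set2P[]-> //.
  exact: (subsetP sBG).
have solHg : solvable (H :^ g)%G by rewrite -(isog_sol (conj_isog H g)).
have ntg : t0 ^ g != 1 by rewrite conjg_eq1.
have Htg : t0 ^ g \in (H :^ g)%G by rewrite memJ_conjg.
have [|s [K [[Us nKs] /cycleP[j tj] sKG oK decH]]] := sol_decomposition sHG solHg Htg Utg ntg.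
  apply: contra nXb0 => sHB; rewrite !inE Bb0 /= mem_conjgV.
  by rewrite (subsetP sHB) // memJ_conjg.
have [|i [k Kk ek]] := decH (b0 ^ g); first by rewrite memJ_conjg.
have [si1|nsi1] := eqVneq (s ^+ i) 1; last first.
  by case/eqP: b04; apply/eqP; rewrite -(conjg_eq1 _ g) conjXg ek (exp4_coset sKG) ?groupX.
have otg : #[t0 ^ g] = 2 by rewrite orderJ; apply/eqP/order2P.
have nKt : t0 ^ g \in 'N(K) by rewrite tj groupX.
have := invol_inverts sKG oK Utg otg nKt Kk.
rewrite si1 mul1g in ek; rewrite -ek -conjJg -conjVg => /conjg_inj eb.
case/negP: nXb0; rewrite !inE Bb0 /=; apply/orP; right.
by rewrite mem_conjg -(groupV B (b0 ^ _)) -conjVg -eb conjgK Bb0.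
Qed.

Definition exceptional x := (x \in B) || (x ^+ 2 == 1).

(** There are [#|U| * m - 1] singletons in [B], as many for the involutions outside [U] other than
    [t0], and [#|U| * m] cosets of [U] outside [B]. Elements of order 4 outside [B] come last, with
    degree at most [3 * (#|U| * m) - 2]; they call for one more colour, whence the strict
    inequality. *)
Lemma solcol_split_rank_one (k : nat) : (3 * (#|U| * m) - 2 <= k)%N ->
    (forall u, u \in U -> u ^+ 2 != 1 -> (3 * (#|U| * m) - 2 < k)%N) ->
  solcol G k.
Proof.
move=> le_k lt_k; pose X := [set x in G^# | exceptional x || (x ^+ 4 != 1)].
have Um_gt2 : (2 < #|U| * m)%N by apply: (leq_trans cardU); rewrite leq_pmulr // ltnW.
apply: (@colorable_on_greedy _ _ (@sol_sym gT) X) => [|x|].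
- by apply/subsetP=> x; rewrite inE => /andP[].
- case/setDP=> /setD1P[nx1 Gx].
  rewrite !inE nx1 Gx /= /exceptional !negb_or negbK => /andP[/andP[nBx nx2] /eqP x4].
  have [g Gg Uxg] := two_elt_conj Gx x4.
  have nxg2 : (x ^ g) ^+ 2 != 1 by rewrite -conjXg conjg_eq1.
  apply: leq_ltn_trans (lt_k _ Uxg nxg2); apply: leq_trans (_ : _ <= #|B| - 2 + 2 * (#|U| * m))%N _.
    apply: leq_trans (degree_order4 Uxg nxg2); rewrite -(cardJg _ g).
    apply/subset_leq_card/subsetP=> y; rewrite mem_conjg !inE => /and3P[/andP[ny1 Gy] nyx sxy].
    rewrite -(conjgKV g y) conjg_eq1 ny1 (groupJr _ Gg) Gy (inj_eq (conjg_inj g)) nyx.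
    by rewrite sol_conj sxy.
  by rewrite cardB addnC addnBA ?(ltnW Um_gt2) // -mulSnr.
have [t0 [b0 [It0 Bb0 nb01 nsol]]] := exists_nonadjacent.
have [Gt0 nUt0 nt0 t02] : [/\ t0 \in G, t0 \notin U, t0 != 1 & t0 ^+ 2 = 1].
  by move: It0; rewrite !inE => /andP[/andP[nUt Gt] /order2P[]].
have t04 : t0 ^+ 4 = 1 by rewrite (expgM _ 2 2) t02 expg1n.
have nBt0 : t0 \notin B by apply: contra nUt0 => Bt0; apply: two_elt_B.
(* One colour is saved by giving t0 the colour of a nonadjacent element of B. *)
pose c x : {set gT} := if x == t0 then [set b0] else if exceptional x then [set x] else U :* x.
pose D := [set [set x] | x in B :\ 1] :|: [set [set t] | t in invol_out :\ t0]
  :|: (rcosets U G :\: rcosets U B).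
apply: (@colorable_on_image _ _ _ c D).
- move=> x; rewrite inE => /andP[/setD1P[nx1 Gx] _]; rewrite /c /D.
  have [_|nxt0] := eqVneq x t0.
    by rewrite !in_setU imset_f // !inE nb01.
  case: ifP => [/orP[Bx|/eqP x2]|/norP[nBx _]].
  + by rewrite !in_setU imset_f // !inE nx1.
  + have [Bx|nBx] := boolP (x \in B); first by rewrite !in_setU imset_f // !inE nx1.
    have Ix : x \in invol_out :\ t0.
      rewrite in_setD1 nxt0 inE /=; apply/andP; split; last exact/order2P.
      by apply/setDP; split=> //; apply: contra nBx; apply: (subsetP sUB).
    by rewrite !in_setU (imset_f _ Ix) orbT.
  + by apply/setUP; right; apply/setDP; rewrite !mem_rcosets !mulSGid.
- apply: leq_trans le_k; rewrite /D.
  apply: leq_trans (leq_card_setU _ _) _; apply: (@leq_trans (#|B :\ 1| + #|invol_out :\ t0| + (#|U| * m))).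
    apply: leq_add.
      by apply: leq_trans (leq_card_setU _ _) _; rewrite leq_add ?leq_imset_card.
    rewrite cardsD (setIidPr (imsetS _ sBG)) -[#|rcosets U G|]/(#|G : U|) -[#|rcosets U B|]/(#|B : U|).
    rewrite -!divgS // cardG_bruhat cardB -mulnA !mulKn // mulnS addKn mulnC //.
  have e1 : (#|invol_out :\ t0|.+1 = #|U| * m)%N.
    by rewrite -card_invol_out (cardsD1 t0 invol_out) It0.
  have e2 : #|B :\ 1|.+1 = (#|U| * m)%N by rewrite -cardB (cardsD1 1 B) group1.
  move: e1 e2; move: (#|U| * m)%N #|invol_out :\ t0| #|B :\ 1| => a b d; clear; lia.
move=> x y; rewrite !inE => /andP[/andP[nx1 Gx] Xx] /andP[/andP[ny1 Gy] Xy] nxy sxy.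
(* Cosets of [U] have more than one element, so singleton and coset colours never clash. *)
have coset1 z h : [set h] != U :* z.
  apply: contraTneq cardU => e; rewrite -leqNgt -(card_rcoset U z) -e cards1 //.
rewrite /c; case: (eqVneq x t0) => [xt0|nxt0]; case: (eqVneq y t0) => [yt0|nyt0].
- by case/eqP: nxy; rewrite xt0.
- case: ifP => _; last exact: coset1.
  by apply: contraTneq sxy => /set1_inj<-; rewrite xt0.
- case: ifP => _; last by rewrite eq_sym coset1.
  by apply: contraTneq sxy => /set1_inj->; rewrite yt0 sol_sym.
have [Sx|nSx] := boolP (exceptional x); have [Sy|nSy] := boolP (exceptional y) => //.
- by rewrite (inj_eq set1_inj).
- by rewrite eq_sym.
move: Xx Xy; rewrite (negPf nSx) (negPf nSy) /= => nx4 ny4.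
apply/eqP=> exy; have /rcosetP[u Uu ey] : y \in U :* x by rewrite exy rcoset_refl.
have nu1 : u != 1 by apply: contraNneq nxy => u1; rewrite ey u1 mul1g.
have nBx : x \notin B by case/norP: nSx.
have sux : sol u x by rewrite sol_sym -sol_mull -ey.
case: (sol_coset Uu nu1 Gx nBx sux) => [x4|y4]; first by case/eqP: nx4.
by case/eqP: ny4; rewrite ey.
Qed.

(** There are [m] involutions in [U] and [#|U| * m] outside it: q^2 - 1 in all for SL(2,q), and (q^2
    + 1)(q - 1) for Sz(q). *)
Lemma involutions_split_rank_one :
  exists A : {set gT}, [/\ A \subset G^#, {in A &, forall x y, sol x y} &
    #|A| = (#|U|.+1 * m)%N].
Proof.
exists ([set z in U | #[z] == 2] :|: invol_out); split.
- apply/subsetP=> x; rewrite !inE => /orP[/andP[Ux]|/andP[/andP[_ Gx]]] /order2P[nx1 _].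
    by rewrite nx1 (subsetP sUG).
  by rewrite nx1.
- have sq x : x \in [set z in U | #[z] == 2] :|: invol_out -> x ^+ 2 = 1.
    by rewrite !inE => /orP[]/andP[_ /order2P[]].
  by move=> x y /sq x2 /sq y2; apply: sol_involutions.
rewrite cardsU card_involU card_invol_out mulSn.
suff -> : [set z in U | #[z] == 2] :&: invol_out = set0 by rewrite cards0 subn0.
by apply/setP=> x; rewrite !inE; case: (x \in U); rewrite ?andbF.
Qed.

End SplitRankOne.

(** * SL(2,q) for even q *)

Section SpecialLinear2.
Variable F : finFieldType.
Local Open Scope ring_scope.
Implicit Types a b c d : F.

Definition mx2 a b c d : 'M[F]_2 :=
  \matrix_(i, j) if i == 0 then (if j == 0 then a else b) else (if j == 0 then c else d).

Lemma mx2_eta (A : 'M[F]_2) : A = mx2 (A 0 0) (A 0 1) (A 1 0) (A 1 1).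
Proof.
apply/matrixP=> i j; rewrite mxE.
by case: i => [[|[|]] ?] //; case: j => [[|[|]] ?] //=; congr (A _ _); apply: val_inj.
Qed.

Lemma mx2E a b c d : (mx2 a b c d 0 0 = a) * (mx2 a b c d 0 1 = b) *
  (mx2 a b c d 1 0 = c) * (mx2 a b c d 1 1 = d).
Proof. by rewrite !mxE. Qed.

Lemma mx2_inj a b c d a' b' c' d' : mx2 a b c d = mx2 a' b' c' d' ->
  [/\ a = a', b = b', c = c' & d = d'].
Proof.
move=> e; split.
- by have := congr1 (fun A : 'M_2 => A 0 0) e; rewrite !mx2E.
- by have := congr1 (fun A : 'M_2 => A 0 1) e; rewrite !mx2E.
- by have := congr1 (fun A : 'M_2 => A 1 0) e; rewrite !mx2E.
- by have := congr1 (fun A : 'M_2 => A 1 1) e; rewrite !mx2E.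
Qed.

Lemma det_mx2 a b c d : \det (mx2 a b c d) = a * d - b * c.
Proof.
rewrite (expand_det_row _ 0) !big_ord_recl big_ord0 addr0 /cofactor !det_mx11 !mxE /=.
by rewrite expr0 expr1 mul1r mulN1r mulrN.
Qed.

Lemma mulmx2 a b c d a' b' c' d' : mx2 a b c d *m mx2 a' b' c' d' =
  mx2 (a * a' + b * c') (a * b' + b * d') (c * a' + d * c') (c * b' + d * d').
Proof.
apply/matrixP=> i j; rewrite !mxE !big_ord_recl big_ord0 addr0 !mxE /=.
by case: i => [[|[|]] ?] //; case: j => [[|[|]] ?].
Qed.

Lemma mx2_1 : mx2 1 0 0 1 = 1.
Proof.
apply/matrixP=> i j; rewrite !mxE.
by case: i => [[|[|]] ?] //; case: j => [[|[|]] ?].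
Qed.

Lemma GL_inj n : injective (@GLval n F).
Proof. exact: val_inj. Qed.

(** [insubd] falls back to the identity on singular arguments, hence the determinant equations
    carried by the lemmas below. *)
Definition sl2 a b c d : {'GL_2[F]} := insubd (1%g : {'GL_2[F]}) (mx2 a b c d).

Lemma sl2K a b c d : a * d - b * c = 1 -> GLval (sl2 a b c d) = mx2 a b c d.
Proof.
move=> e; rewrite /sl2; apply: insubdK.
by rewrite -topredE /= unitmxE det_mx2 e unitr1.
Qed.

Lemma sl2_SL a b c d : a * d - b * c = 1 -> sl2 a b c d \in SL 2 F.
Proof. by move=> e; rewrite inE sl2K // det_mx2 e. Qed.

Lemma sl2P x : x \in SL 2 F -> exists a, exists b, exists c, exists d,
  a * d - b * c = 1 /\ x = sl2 a b c d.
Proof.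
rewrite inE (mx2_eta (GLval x)) det_mx2 => /eqP e.
exists (GLval x 0 0), (GLval x 0 1), (GLval x 1 0), (GLval x 1 1); split=> //.
by apply: GL_inj; rewrite sl2K // -mx2_eta.
Qed.

Lemma sl2_inj a b c d a' b' c' d' : a * d - b * c = 1 -> a' * d' - b' * c' = 1 ->
  sl2 a b c d = sl2 a' b' c' d' -> [/\ a = a', b = b', c = c' & d = d'].
Proof. by move=> e e' /(congr1 (@GLval _ _)); rewrite !sl2K //; apply: mx2_inj. Qed.

Lemma sl2M a b c d a' b' c' d' : a * d - b * c = 1 -> a' * d' - b' * c' = 1 ->
  (sl2 a b c d * sl2 a' b' c' d')%g =
  sl2 (a * a' + b * c') (a * b' + b * d') (c * a' + d * c') (c * b' + d * d').
Proof.
move=> e e'; apply: GL_inj; rewrite GL_MxE !sl2K //; first exact: mulmx2.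
by rewrite -[1]mulr1 -{1}e -e'; ring.
Qed.

Lemma sl2_1 : sl2 1 0 0 1 = 1%g.
Proof. by apply: GL_inj; rewrite sl2K ?mx2_1 //; ring. Qed.

Lemma sl2V a b c d : a * d - b * c = 1 -> ((sl2 a b c d)^-1)%g = sl2 d (- b) (- c) a.
Proof.
move=> e; apply/eqP; rewrite eq_invg_mul sl2M //; last by rewrite -e; ring.
rewrite -sl2_1; apply/eqP; congr (sl2 _ _ _ _); rewrite -?e; ring.
Qed.


Definition borel2_set : {set {'GL_2[F]}} := [set x in SL 2 F | GLval x 1 0 == 0].
Definition unip2_set : {set {'GL_2[F]}} := [set x in borel2_set | GLval x 0 0 == 1].

Lemma mem_borel2 a b c d : a * d - b * c = 1 -> (sl2 a b c d \in borel2_set) = (c == 0).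
Proof. by move=> e; rewrite inE sl2_SL //= sl2K // mx2E. Qed.

Lemma mem_unip2 a b c d : a * d - b * c = 1 ->
  (sl2 a b c d \in unip2_set) = (c == 0) && (a == 1).
Proof. by move=> e; rewrite inE mem_borel2 // sl2K // mx2E. Qed.

Lemma det_torus a b : a != 0 -> a * a^-1 - b * 0 = 1.
Proof. by move=> na0; rewrite mulr0 subr0 mulfV. Qed.

Lemma det_unip b : 1 * 1 - b * 0 = 1 :> F.
Proof. by rewrite mulr0 subr0 mulr1. Qed.

Lemma borel2P x : reflect (exists2 a, a != 0 & exists b, x = sl2 a b 0 a^-1) (x \in borel2_set).
Proof.
apply: (iffP idP) => [Bx|[a na0 [b ->]]]; last by rewrite mem_borel2 ?det_torus.
have [Sx _] := setIdP Bx; have [a [b [c [d [e ex]]]]] := sl2P Sx.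
move: Bx; rewrite ex mem_borel2 // => /eqP c0; move: e; rewrite c0 mulr0 subr0 => e.
have na0 : a != 0 by apply: contraTneq (oner_neq0 F) => a0; rewrite -e a0 mul0r eqxx.
by exists a => //; exists b; rewrite -[d](mulKf na0) e mulr1.
Qed.

Definition tv2 b := sl2 1 b 0 1.

Lemma unip2P x : reflect (exists b, x = tv2 b) (x \in unip2_set).
Proof.
apply: (iffP idP) => [|[b ->]]; last by rewrite /tv2 mem_unip2 ?det_unip ?eqxx.
case/setIdP=> /borel2P[a na0 [b ->]]; rewrite sl2K ?det_torus // mx2E => /eqP->.
by exists b; rewrite invr1.
Qed.

Lemma borel2_group_set : group_set borel2_set.
Proof.
apply/group_setP; split=> [|x y /borel2P[a na0 [b ->]] /borel2P[a' na'0 [b' ->]]].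
  by rewrite -sl2_1 mem_borel2 ?det_unip.
rewrite sl2M ?det_torus // mem_borel2; first by rewrite mul0r mulr0 addr0.
by field; rewrite na0 na'0.
Qed.

Canonical borel2 := Group borel2_group_set.

Lemma unip2M b b' : (tv2 b * tv2 b')%g = tv2 (b + b').
Proof. by rewrite /tv2 sl2M ?det_unip //; congr (sl2 _ _ _ _); ring. Qed.

Lemma unip2_group_set : group_set unip2_set.
Proof.
apply/group_setP; split=> [|x y /unip2P[b ->] /unip2P[b' ->]].
  by apply/unip2P; exists 0; rewrite /tv2 sl2_1.
by rewrite unip2M; apply/unip2P; exists (b + b').
Qed.

Canonical unip2 := Group unip2_group_set.

Lemma borel2_sub : borel2 \subset SL_group 2 F.
Proof. by apply/subsetP=> x /setIdP[]. Qed.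

Lemma unip2_normal : (unip2 <| borel2)%g.
Proof.
apply/normalP; split; first by apply/subsetP=> x /setIdP[].
move=> x /borel2P[a na0 [b ->]]; apply/eqP; rewrite eqEcard cardJg leqnn andbT.
apply/subsetP=> _ /imsetP[_ /unip2P[b' ->] ->]; apply/unip2P.
exists (a^-1 * b' * a^-1); rewrite conjgE sl2V ?det_torus //.
rewrite sl2M ?det_torus ?det_unip // sl2M ?det_torus //.
- by congr (sl2 _ _ _ _); field.
- by field.
- by field.
Qed.

Lemma card_unip2 : #|unip2| = #|F|.
Proof.
have -> : unip2 = [set tv2 b | b : F] :> {set _}.
  apply/setP=> x; apply/unip2P/imsetP=> [[b ->]|[b _ ->]]; by exists b.
by rewrite card_imset // => b b' /sl2_inj[]; rewrite ?det_unip.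
Qed.

Lemma card_borel2 : #|borel2| = (#|F| * #|F|.-1)%N.
Proof.
have -> : borel2 = [set sl2 p.2 p.1 0 p.2^-1 | p in setX [set: F] [set~ 0]] :> {set _}.
  apply/setP=> x; apply/borel2P/imsetP=> [[a na0 [b ->]]|[[b a] + ->]].
    by exists (b, a) => //; rewrite !inE.
  by rewrite !inE /= => na0; exists a => //; exists b.
rewrite card_in_imset ?cardsX ?cardsT ?cardsC1 // => -[b a] [b' a'].
rewrite !inE /= => na0 na'0 /sl2_inj[]; rewrite ?det_torus // => -> -> //.
Qed.

Definition weyl2 := sl2 0 1 (-1) 0.

Lemma det_weyl2 : 0 * 0 - 1 * (-1) = 1 :> F. Proof. by ring. Qed.

Lemma bruhat2 g : g \in SL_group 2 F -> g \notin borel2 ->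
  exists2 b, b \in borel2 & exists2 u, u \in unip2 & g = (b * weyl2 * u)%g.
Proof.
case/sl2P=> a [b [c [d [e ->]]]]; rewrite mem_borel2 // => nc0.
have nc0' : - c != 0 by rewrite oppr_eq0.
(* Chosen so that its product with [weyl2] has first column [(a, c)] and lower right entry 0; the
   unipotent factor then supplies [d]. *)
exists (sl2 (- c)^-1 (- a) 0 (- c)).
  by rewrite mem_borel2 // mulr0 subr0 mulVf.
exists (sl2 1 (d / c) 0 1); first by apply/unip2P; exists (d / c).
rewrite sl2M ?det_weyl2 //; last by rewrite mulr0 subr0 mulVf.
rewrite sl2M ?det_unip //; last by field.
have eb : b = (a * d - 1) / c by rewrite -e; field.
by congr (sl2 _ _ _ _); rewrite ?eb; field; rewrite ?oppr_eq0 ?nc0.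
Qed.

Lemma unip2_weyl u : u \in unip2 -> (u ^ weyl2)%g \in borel2 -> u = 1%g.
Proof.
case/unip2P=> b ->; rewrite conjgE sl2V ?det_weyl2 //.
rewrite sl2M ?det_weyl2 ?det_unip // sl2M; [|by ring|by ring].
rewrite mem_borel2; last by ring.
have -> : - (-1) * (1 * 0 + b * -1) + 0 * (0 * 0 + 1 * -1) = - b by ring.
by rewrite oppr_eq0 => /eqP->; rewrite /tv2 sl2_1.
Qed.


Lemma card_pchar0 p n : prime p -> #|F| = (p ^ n)%N -> p%:R = 0 :> F.
Proof. by move=> p_pr /card_finPcharP/(_ p_pr)/pcharf0. Qed.

Section Char2.
Variable n : nat.
Hypothesis n_gt1 : (1 < n)%N.
Hypothesis cardF : #|F| = (2 ^ n)%N.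

Let two0 : 2%:R = 0 :> F := card_pchar0 (isT : prime 2) cardF.

Lemma addrr_even a : a + a = 0.
Proof. by rewrite -mulr2n -mulr_natl two0 mul0r. Qed.

Lemma unip2_exp2 u : u \in unip2 -> (u ^+ 2 = 1)%g.
Proof. by case/unip2P=> b ->; rewrite expgS expg1 unip2M addrr_even /tv2 sl2_1. Qed.

(** Commuting with a nontrivial transvection forces [a + a^-1 = 0], which in characteristic 2 reads
    [(a + 1) ^+ 2 = 0]. *)
Lemma cent_borel2 z : z \in unip2 -> #[z]%g = 2 -> ('C_borel2[z] = unip2)%g.
Proof.
case/unip2P=> t -> ot; have nt0 : t != 0.
  by apply/eqP=> t0; move: ot; rewrite t0 /tv2 sl2_1 order1.
apply/setP=> x; rewrite in_setI; apply/andP/unip2P=> [[/borel2P[a na0 [b ->]] /cent1P]|[b ->]].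
  rewrite /commute /tv2 !sl2M ?det_unip ?det_torus // => /sl2_inj[].
  - by field.
  - by field.
  move=> _ e _ _; have {}e : (a + a^-1) * t = 0.
    have -> : (a + a^-1) * t = (a * t + b * 1) + (1 * b + t * a^-1) - (b + b) by ring.
    by rewrite e !addrr_even subr0.
  exists b; rewrite /tv2; suff -> : a = 1 by rewrite invr1.
  move/eqP: e; rewrite mulf_eq0 (negPf nt0) orbF => /eqP e.
  have: (a + 1) ^+ 2 = 0.
    have -> : (a + 1) ^+ 2 = a * (a + a^-1) + (a + a) by field.
    by rewrite e addrr_even mulr0 addr0.
  move/eqP; rewrite expf_eq0 /= => /eqP e2.
  by rewrite -[a]addr0 -(addrr_even 1) addrA e2 add0r.
split; first by rewrite (subsetP (normal_sub unip2_normal)) //; apply/unip2P; exists b.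
by apply/cent1P; red; rewrite !unip2M addrC.
Qed.

Lemma card_invol_unip2 : #|[set z in unip2 | #[z]%g == 2]| = #|F|.-1.
Proof.
have -> : [set z in unip2 | #[z]%g == 2] = unip2 :\ 1%g.
  apply/setP=> z; apply/setIdP/setD1P=> [[Uz /order2P[]] //|[nz1 Uz]].
  by split=> //; apply/order2P; split=> //; apply: unip2_exp2.
by rewrite -card_unip2 [in RHS](cardsD1 1%g) group1.
Qed.

Lemma chi_SL2_even : let q := #|F| in
  (exists A : {set {'GL_2[F]}}, [/\ A \subset (SL_group 2 F)^#%g,
     {in A &, forall x y, sol x y} & #|A| = (q ^ 2 - 1)%N]) /\
  solcol (SL_group 2 F) (3 * q * (q - 1) - 2).
Proof.
move=> q; have q4 : (3 < q)%N by rewrite /q cardF (@leq_pexp2l 2 2).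
have evq : ~~ odd q by rewrite /q cardF oddX negb_or -lt0n ltnW.
have oddq1 : odd q.-1 by move: q4 evq; clearbody q; case: q => //= k _ /negbNE.
have sqU u v : u \in unip2 -> v \in unip2 -> (u ^+ 2 = v ^+ 2)%g -> (u ^+ 2 != 1)%g -> commute u v.
  by move=> Uu _ _; rewrite unip2_exp2 ?eqxx.
have coU u : u \in unip2 -> (u ^+ 2 != 1)%g -> exists2 v, v \in unip2 &
    [/\ [~ u, v] != 1, [~ u, v] != u ^+ 2 & [~ u, v] ^+ 2 = 1]%g.
  by move=> Uu; rewrite unip2_exp2 ?eqxx.
have Gw : weyl2 \in SL_group 2 F by apply/sl2_SL/det_weyl2.
have pU : 2.-group%g unip2 by rewrite /pgroup card_unip2 cardF pnatX.
have cU : (2 < #|unip2|)%N by rewrite card_unip2 ltnW.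
have cB : #|borel2| = (#|unip2| * q.-1)%N by rewrite card_unip2 card_borel2.
have m1 : (1 < q.-1)%N by move: q4; clearbody q; clear; lia.
have e4 u : u \in unip2 -> (u ^+ 4 = 1)%g.
  by move=> Uu; rewrite (expgM _ 2 2) (unip2_exp2 Uu) expg1n.
split.
  have [A [sA cA kA]] := involutions_split_rank_one unip2_normal borel2_sub Gw bruhat2
    unip2_weyl pU cU cB oddq1 m1 card_invol_unip2.
  exists A; split=> //; rewrite kA card_unip2 -/q; move: q4; clearbody q; clear; nia.
apply: (solcol_split_rank_one unip2_normal borel2_sub Gw bruhat2 unip2_weyl pU cU cB
  oddq1 m1 cent_borel2 card_invol_unip2 e4 sqU coU).
  by rewrite card_unip2 subn1 mulnA.
by move=> u Uu; rewrite unip2_exp2 ?eqxx.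
Qed.

End Char2.

End SpecialLinear2.

(** * PSL(2,q) for odd q *)

Section LastDerived.
Local Open Scope group_scope.
Variable gT : finGroupType.
Implicit Types (G H K Z : {group gT}).

Lemma last_derived_not_sub H Z : solvable H -> ~~ (H \subset Z) ->
  exists K, [/\ K \subset H, H \subset 'N(K), ~~ (K \subset Z) & K^`(1) \subset Z].
Proof.
move=> solH nHZ; have [n Hn1] := derivedP H solH.
have exn : exists n, H^`(n) \subset Z by exists n; rewrite Hn1 sub1G.
case: (ex_minnP exn) => -[|k] Hk mink; first by rewrite derg0 (negPf nHZ) in Hk.
exists (H^`(k))%G; split=> //; first exact: der_sub.
  exact: gFnorm.
by apply/negP=> /mink; rewrite ltnn.
Qed.

(** An abelian kernel does not affect solubility; this moves questions about PSL(2,q) to SL(2,q). *)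
Lemma sol_quotient Z (x y : gT) : abelian Z -> x \in 'N(Z) -> y \in 'N(Z) ->
  sol (coset Z x) (coset Z y) = sol x y.
Proof.
move=> abZ nZx nZy; have sN : [set x; y] \subset 'N(Z) by apply/subsetP=> z /set2P[]->.
have -> : sol (coset Z x) (coset Z y) = solvable (<<[set x; y]>> / Z).
  by rewrite /sol /= quotient_gen // /quotient morphimU !morphim_set1.
have sXN : <<[set x; y]>> \subset 'N(Z) by rewrite gen_subG.
have nI : Z :&: <<[set x; y]>> <| <<[set x; y]>>.
  by rewrite /normal subsetIr normsI ?normG.
rewrite -(isog_sol (second_isog sXN)) [in RHS]/sol /= (series_sol nI).
by rewrite (solvableS (subsetIl _ _) (abelian_sol abZ)).
Qed.

Lemma mem_conjV K (x k : gT) : x \in 'N(K) -> k \in K -> x * k * x^-1 \in K.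
Proof. move=> nKx Kk; have -> : x * k * x^-1 = k ^ x^-1 by rewrite conjgE invgK mulgA.
by rewrite memJ_norm // groupV. Qed.

Lemma mem_normJ K (x k : gT) : x \in 'N(K) -> k \in K -> k ^ x \in K.
Proof. by move=> nKx Kk; rewrite memJ_norm. Qed.

Lemma mem_normJ_not K (x k : gT) : x \in 'N(K) -> k \notin K -> k ^ x \notin K.
Proof. by move=> nKx Kk; rewrite memJ_norm. Qed.

Lemma mem_der1 K (x k : gT) Z : K^`(1) \subset Z -> x \in K -> k \in K -> [~ x, k] \in Z.
Proof. by move=> sKZ Kx Kk; apply: (subsetP sKZ); rewrite derg1; apply: mem_commg. Qed.

Lemma commg_decomp (x y z : gT) : [~ x, y] = z -> x * y = y * x * z.
Proof. by move=> <-; rewrite commgEl conjgE !mulgA mulgK mulgV mul1g. Qed.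

End LastDerived.

(** * Soluble subgroups of SL(2,q), q odd, containing a transvection *)

Section OddSpecialLinear2.
Variable F : finFieldType.
Local Open Scope ring_scope.
Implicit Types a b c d t : F.

Lemma center_SL2P (z : {'GL_2[F]}) :
  reflect (exists2 a, a ^+ 2 = 1 & z = sl2 a 0 0 a) (z \in 'Z(SL 2 F)%g).
Proof.
apply: (iffP (centerP _ _)) => [[Sz cz]|[a a2 ->]]; last first.
  have e : a * a - 0 * 0 = 1 by rewrite mulr0 subr0 -expr2.
  split=> [|x /sl2P[a' [b' [c' [d' [e' ->]]]]]]; first exact: sl2_SL.
  by rewrite /commute !sl2M //; congr (sl2 _ _ _ _); ring.
have [a [b [c [d [e ez]]]]] := sl2P Sz; rewrite ez in cz *.
have := cz _ (sl2_SL (det_unip 1)); rewrite /commute !sl2M ?det_unip // => /sl2_inj[].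
- by rewrite -[RHS]e; ring.
- by rewrite -[RHS]e; ring.
move=> e1 e2 _ _.
have c0 : c = 0.
  have -> : c = (1 * a + 1 * c) - a by ring.
  by rewrite -e1; ring.
have da : d = a.
  have -> : d = (1 * b + 1 * d) - b by ring.
  by rewrite -e2; ring.
have := cz _ (sl2_SL (det_weyl2 F)); rewrite /commute /weyl2 !sl2M ?det_weyl2 // => /sl2_inj[].
- by rewrite -[RHS]e; ring.
- by rewrite -[RHS]e; ring.
move=> e3 _ _ _; have b0 : b = 0.
  have -> : b = - (a * 0 + b * -1) by ring.
  by rewrite e3 c0; ring.
by exists a; rewrite ?c0 ?da ?b0 // expr2 -e c0 da b0; ring.
Qed.

Hypothesis two_neq0 : 2%:R != 0 :> F.

Section LastDerivedStep.
Variable K : {group {'GL_2[F]}}.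
Hypothesis dK : (K^`(1) \subset 'Z(SL 2 F))%g.

(** Commutators of [K] are scalars of square 1, so elements of [K] commute up to sign; the equations
    are the entries of this relation. *)
Lemma comm_sign a b c d a' b' c' d' : a * d - b * c = 1 -> a' * d' - b' * c' = 1 ->
    sl2 a b c d \in K -> sl2 a' b' c' d' \in K ->
  exists e, [/\ e = 1 \/ e = -1,
    a * a' + b * c' = e * (a' * a + b' * c), a * b' + b * d' = e * (a' * b + b' * d),
    c * a' + d * c' = e * (c' * a + d' * c) & c * b' + d * d' = e * (c' * b + d' * d)].
Proof.
move=> e1 e2 K1 K2; have/center_SL2P[e ee /commg_decomp E] := mem_der1 dK K1 K2.
exists e.
have de : e * e - 0 * 0 = 1 by rewrite mulr0 subr0 -expr2.
have d3 : (a' * a + b' * c) * (c' * b + d' * d) - (a' * b + b' * d) * (c' * a + d' * c) = 1.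
  by rewrite -[1]mulr1 -{1}e1 -e2; ring.
move: E; rewrite !sl2M // => /sl2_inj[].
- by rewrite -[1]mulr1 -{1}e1 -e2; ring.
- by rewrite -[1]mulr1 -{1}d3 -de; ring.
move=> E1 E2 E3 E4; split; rewrite ?E1 ?E2 ?E3 ?E4; try ring.
have/eqP : (e - 1) * (e + 1) = 0 by rewrite -subr_sqr ee expr1n subrr.
by rewrite mulf_eq0 subr_eq0 addr_eq0 => /orP[]/eqP; [left|right].
Qed.

Lemma tv2J t a b c d : a * d - b * c = 1 ->
  (tv2 t * sl2 a b c d * (tv2 t)^-1)%g =
  sl2 (a + t * c) (b + t * (d - a) - t ^+ 2 * c) c (d - t * c).
Proof.
move=> e; rewrite /tv2 sl2V ?det_unip // sl2M ?det_unip // sl2M.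
- by congr (sl2 _ _ _ _); ring.
- by rewrite -[RHS]e; ring.
- by ring.
Qed.

Lemma det_tv2J t a b c d : a * d - b * c = 1 ->
  (a + t * c) * (d - t * c) - (b + t * (d - a) - t ^+ 2 * c) * c = 1.
Proof. by move=> e; rewrite -[RHS]e; ring. Qed.

(** [comm_sign] is applied to an element and its conjugate under [tv2 t], which has the same lower
    left entry. Commuting would give [2%:R * t * c ^+ 2 = 0], so the two anticommute, as in a
    quaternion group, and the entries yield zero trace and the value of [(t * c) ^+ 2]. *)
Lemma quaternion_step t a b c d : a * d - b * c = 1 -> sl2 a b c d \in K ->
    (tv2 t \in 'N(K))%g -> t != 0 -> c != 0 ->
  d = - a /\ (t * c) ^+ 2 = -2%:R.
Proof.
move=> e K1 nKu nt nc; have K2 := mem_conjV nKu K1; rewrite tv2J // in K2.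
have [s [s1 E1 E2 E3 E4]] := comm_sign e (det_tv2J t e) K1 K2.
have n2tc : 2%:R * t * c ^+ 2 != 0 by rewrite !mulf_neq0 // expf_neq0.
case: s1 => s1; rewrite s1 in E1 E2 E3 E4.
  case/eqP: n2tc; have -> : 2%:R * t * c ^+ 2 =
    (c * (a + t * c) + d * c) - (c * a + (d - t * c) * c) by ring.
  by rewrite E3; ring.
have da : d = - a.
  apply: (mulfI nc); apply: (mulfI two_neq0); apply/eqP; rewrite -subr_eq0; apply/eqP.
  have -> : 2%:R * (c * d) - 2%:R * (c * - a) =
    (c * (a + t * c) + d * c) - (-1) * (c * a + (d - t * c) * c) by ring.
  by rewrite E3 subrr.
have two_det : 2%:R = 2%:R * (a * d - b * c) by rewrite e mulr1.
split=> //; apply/eqP; rewrite -subr_eq0; apply/eqP.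
have -> : (t * c) ^+ 2 - -2%:R = - (c * (b + t * (d - a) - t ^+ 2 * c) + d * (d - t * c)
   - (-1) * (c * b + (d - t * c) * d)) by rewrite opprK two_det da; ring.
by rewrite E4 subrr oppr0.
Qed.

End LastDerivedStep.


Lemma sl2J a b c d a' b' c' d' : a * d - b * c = 1 -> a' * d' - b' * c' = 1 ->
  (sl2 a b c d ^ sl2 a' b' c' d')%g =
  sl2 (d' * (a * a' + b * c') - b' * (c * a' + d * c')) (d' * (a * b' + b * d') - b' * (c * b' + d * d'))
    (a' * (c * a' + d * c') - c' * (a * a' + b * c')) (a' * (c * b' + d * d') - c' * (a * b' + b * d')).
Proof.
move=> e e'; rewrite conjgE sl2V // sl2M // sl2M.
- by congr (sl2 _ _ _ _); ring.
- by rewrite -[RHS]e'; ring.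
- by rewrite -[RHS]mulr1 -{2}e -e'; ring.
Qed.

Lemma det_sl2J a b c d a' b' c' d' : a * d - b * c = 1 -> a' * d' - b' * c' = 1 ->
  (d' * (a * a' + b * c') - b' * (c * a' + d * c')) * (a' * (c * b' + d * d') - c' * (a * b' + b * d'))
  - (d' * (a * b' + b * d') - b' * (c * b' + d * d')) * (a' * (c * a' + d * c') - c' * (a * a' + b * c'))
  = 1.
Proof.
move=> e e'; transitivity ((a * d - b * c) * (a' * d' - b' * c') ^+ 2); first by ring.
by rewrite e e' expr1n mulr1.
Qed.

Section Transvection.
Variables (t a b c d : F).
Hypothesis det_y : a * d - b * c = 1.
Hypothesis nt0 : t != 0.
Hypothesis nc0 : c != 0.

(** For a noncentral [k], at least one of three elements is not upper triangular: [k], its conjugate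
    by [sl2 a b c d], and the same conjugate of the [tv2 t]-conjugate of [k]. If all three lower
    left entries vanished, [k] would be scalar. *)
Lemma normalised_not_triangular (K : {group {'GL_2[F]}}) :
    K \subset SL 2 F -> (tv2 t \in 'N(K))%g -> (sl2 a b c d \in 'N(K))%g ->
    ~~ (K \subset 'Z(SL 2 F))%g ->
  exists a1 b1 c1 d1, [/\ a1 * d1 - b1 * c1 = 1, c1 != 0 & sl2 a1 b1 c1 d1 \in K].
Proof.
move=> sKS nKu nKy /subsetPn[k Kk nZk].
have [a1 [b1 [c1 [d1 [e1 ek]]]]] := sl2P (subsetP sKS k Kk); rewrite ek in Kk nZk.
have [c10|nc1] := eqVneq c1 0; last by exists a1, b1, c1, d1.
have e2 := det_tv2J t e1.
have Kk2 := mem_conjV nKu Kk; rewrite tv2J // in Kk2.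
have Kk3 := mem_normJ nKy Kk; rewrite sl2J // in Kk3.
have Kk4 := mem_normJ nKy Kk2; rewrite sl2J // in Kk4.
move: Kk3 Kk4; set g3 := (X in sl2 _ _ X _) => Kk3; set g4 := (X in sl2 _ _ X _) => Kk4.
have [g30|ng3] := eqVneq g3 0; last by do 4 eexists; split; [apply: det_sl2J | exact: ng3 | exact: Kk3].
have [g40|ng4] := eqVneq g4 0; last by do 4 eexists; split; [apply: det_sl2J | exact: ng4 | exact: Kk4].
have da : d1 = a1.
  apply/eqP; rewrite -subr_eq0; have: c ^+ 2 * t * (d1 - a1) == 0.
    by rewrite -(subr0 0) -{1}g30 -g40 /g3 /g4 c10; apply/eqP; ring.
  by rewrite !mulf_eq0 (negPf nc0) (negPf nt0).
have b10 : b1 = 0.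
  have: c ^+ 2 * b1 == 0.
    by rewrite -oppr_eq0 -g30 /g3 c10 da; apply/eqP; ring.
  by rewrite !mulf_eq0 (negPf nc0) => /eqP.
case/negP: nZk; apply/center_SL2P; exists a1; last by rewrite c10 da b10.
by rewrite -e1 c10 da b10; ring.
Qed.

Lemma sol_transvection : sol (tv2 t) (sl2 a b c d) ->
  exists K : {group {'GL_2[F]}}, [/\ K \subset SL 2 F, (K^`(1) \subset 'Z(SL 2 F))%g,
    (tv2 t \in 'N(K))%g, (sl2 a b c d \in 'N(K))%g &
    exists a1 b1 c1 d1, [/\ a1 * d1 - b1 * c1 = 1, c1 != 0 & sl2 a1 b1 c1 d1 \in K]].
Proof.
move=> solH; pose H := <<[set tv2 t; sl2 a b c d]>>%G.
have [Hu Hy] : tv2 t \in H /\ sl2 a b c d \in H by rewrite !mem_gen ?inE ?eqxx ?orbT.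
have sHS : H \subset SL 2 F.
  by rewrite gen_subG; apply/subsetP=> z /set2P[]->; apply: sl2_SL; rewrite ?det_unip.
have nHZ : ~~ (H \subset 'Z(SL 2 F)%G).
  apply/subsetPn; exists (tv2 t) => //; apply/center_SL2P=> -[x xx].
  by case/sl2_inj; rewrite ?det_unip ?mulr0 ?subr0 -?expr2 // => _ t0 _ _; move: nt0; rewrite t0 eqxx.
have [K [sKH nKH nKZ dK]] := last_derived_not_sub solH nHZ.
have sKS := subset_trans sKH sHS.
exists K; split=> //; try exact: (subsetP nKH).
by apply: normalised_not_triangular; rewrite ?(subsetP nKH).
Qed.

(** [K] is normalised by [tv2 t] and by its square [tv2 (t + t)], so [quaternion_step] gives the
    value -2 to both [(t * c1) ^+ 2] and four times it, that is 6 = 0. *)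
Lemma not_sol_transvection : 3%:R != 0 :> F -> ~~ sol (tv2 t) (sl2 a b c d).
Proof.
move=> three; apply/negP=> /sol_transvection[K [sKS dK nKu nKy [a1 [b1 [c1 [d1 [e1 nc1 Kk]]]]]]].
have nKu2 := groupM nKu nKu; rewrite unip2M in nKu2.
have ntt : t + t != 0 by rewrite -mulr2n -mulr_natl mulf_neq0.
have [_ t1] := quaternion_step dK e1 Kk nKu nt0 nc1.
have [_ t2] := quaternion_step dK e1 Kk nKu2 ntt nc1.
case/eqP: (mulf_neq0 two_neq0 three).
have -> : 2%:R * 3%:R = - (2%:R * 2%:R * - 2%:R) - 2%:R :> F by ring.
by rewrite -{1}t1 -[X in _ - X]opprK -t2; ring.
Qed.

End Transvection.

(** * Characteristic 3, with -1 not a square *)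

Section Char3.
Hypothesis three0 : 3%:R = 0 :> F.
Hypothesis nsq : forall x : F, x ^+ 2 != -1.

(** [ring] does not know the characteristic; the multiple of 3 by which two sides differ is supplied
    as [z]. *)
Lemma char3_eq x y z : x = y + 3%:R * z -> x = y :> F.
Proof. by rewrite three0 mul0r addr0. Qed.

Lemma sqr_sqr1 x : (x ^+ 2) ^+ 2 = 1 -> x ^+ 2 = 1 :> F.
Proof.
move=> x4; have: (x ^+ 2 - 1) * (x ^+ 2 + 1) == 0 by rewrite -subr_sqr x4 expr1n subrr.
by rewrite mulf_eq0 subr_eq0 addr_eq0 (negPf (nsq x)) orbF => /eqP.
Qed.

(** Modulo 3, the difference of the last two hypotheses is a nonzero multiple of
    [A * (A ^+ 2 - C ^+ 2)]. Either factor vanishing turns the first hypothesis into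
    [(C ^+ 2) ^+ 2 = 1], and -1 is not a square. *)
Lemma three_conics A C e : C != 0 -> e ^+ 2 = 1 -> (A ^+ 2 + C ^+ 2) ^+ 2 = 1 ->
    ((A - e * C) ^+ 2 + C ^+ 2) ^+ 2 = 1 -> ((A + e * C) ^+ 2 + C ^+ 2) ^+ 2 = 1 ->
  C ^+ 2 = 1 /\ A ^+ 3 = A :> F.
Proof.
move=> nC e2 N0 N1 N2; have ne : e != 0.
  by apply: contra_eq_neq e2 => ->; rewrite expr0n eq_sym oner_neq0.
have eP : (A + e * C) ^+ 2 + C ^+ 2 = A ^+ 2 + 2%:R * C ^+ 2 + 2%:R * (e * C * A).
  transitivity (A ^+ 2 + e ^+ 2 * C ^+ 2 + C ^+ 2 + 2%:R * (e * C * A)); first by ring.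
  by rewrite e2; ring.
have eM : (A - e * C) ^+ 2 + C ^+ 2 = A ^+ 2 + 2%:R * C ^+ 2 - 2%:R * (e * C * A).
  transitivity (A ^+ 2 + e ^+ 2 * C ^+ 2 + C ^+ 2 - 2%:R * (e * C * A)); first by ring.
  by rewrite e2; ring.
rewrite eP in N2; rewrite eM in N1.
have: 2%:R * 2%:R * (e * C) * A * (2%:R * (A ^+ 2 - C ^+ 2)) == 0.
  apply/eqP; transitivity ((A ^+ 2 + 2%:R * C ^+ 2 + 2%:R * (e * C * A)) ^+ 2 -
    (A ^+ 2 + 2%:R * C ^+ 2 - 2%:R * (e * C * A)) ^+ 2); last by rewrite N1 N2 subrr.
  by apply/esym; apply: (@char3_eq _ _ (8%:R * (e * C) * A * C ^+ 2)); ring.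
rewrite !mulf_eq0 (negPf two_neq0) (negPf nC) (negPf ne) /= subr_eq0 => /orP[/eqP A0|/eqP AC].
  by split; [apply: sqr_sqr1; rewrite -N0 A0 expr0n add0r | rewrite A0 expr0n].
have C2 : C ^+ 2 = 1.
  apply: sqr_sqr1; rewrite -N0 AC; apply/esym.
  by apply: (@char3_eq _ _ ((C ^+ 2) ^+ 2)); ring.
by split; rewrite // exprS AC C2 mulr1.
Qed.

(** Here -2 = 1. A noncentral element of [K] with [c = 0] would anticommute with the one having
    [c1 != 0], giving [d = - a] and [a ^+ 2 = -1]. *)
Lemma quaternion_entry (K : {group {'GL_2[F]}}) t a1 b1 c1 d1 a b c d :
    (K^`(1) \subset 'Z(SL 2 F))%g -> (tv2 t \in 'N(K))%g -> t != 0 ->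
    a1 * d1 - b1 * c1 = 1 -> c1 != 0 -> sl2 a1 b1 c1 d1 \in K ->
    a * d - b * c = 1 -> sl2 a b c d \in K -> sl2 a b c d \notin 'Z(SL 2 F)%g ->
  (t * c) ^+ 2 = 1.
Proof.
move=> dK nKu nt e1 nc1 K1 e K2 nZ.
have two1 : - 2%:R = 1 :> F by apply: (@char3_eq _ _ (-1)); ring.
have [c0|nc] := eqVneq c 0; last first.
  by have [_ ->] := quaternion_step dK e K2 nKu nt nc.
have [da1 _] := quaternion_step dK e1 K1 nKu nt nc1.
have [s [s1 E1 E2 E3 E4]] := comm_sign dK e e1 K2 K1.
rewrite c0 da1 in E1 E3; rewrite c0 mulr0 subr0 in e.
case: s1 => s1; rewrite s1 in E1 E3.
  have da : d = a by apply: (mulIf nc1); rewrite -[LHS]add0r -(mul0r a1) E3; ring.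
  have b0 : b = 0.
    apply: (mulIf nc1); rewrite mul0r; have -> : b * c1 = (a * a1 + b * c1) - a * a1 by ring.
    by rewrite E1; ring.
  case/negP: nZ; apply/center_SL2P; exists a; first by rewrite expr2 -{2}da.
  by rewrite c0 b0 da.
have da : d = - a.
  apply: (mulIf nc1); rewrite -[LHS]add0r -(mul0r a1) E3; ring.
by case/eqP: (nsq a); rewrite -e da; ring.
Qed.

(** Conjugating the element of [K] by [tv2 r] and then by [sl2 a b c d] gives a lower left entry
    quadratic in [a] and [c], whose square is known from [quaternion_entry]. For r equal to 0, t and
    -t this is the system of [three_conics] with [C = c / c1]. *)
Lemma conj_conics (K : {group {'GL_2[F]}}) t a1 b1 c1 d1 a b c d :
    (K^`(1) \subset 'Z(SL 2 F))%g -> (tv2 t \in 'N(K))%g -> t != 0 ->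
    a1 * d1 - b1 * c1 = 1 -> c1 != 0 -> sl2 a1 b1 c1 d1 \in K ->
    a * d - b * c = 1 -> c != 0 -> (sl2 a b c d \in 'N(K))%g ->
  (c / c1) ^+ 2 = 1 /\ ((a * c1 - c * a1) / c1) ^+ 3 = (a * c1 - c * a1) / c1.
Proof.
move=> dK nKu nt e1 nc1 K1 e nc nKy.
have two1 : - 2%:R = 1 :> F by apply: (@char3_eq _ _ (-1)); ring.
have [da1 tc2] := quaternion_step dK e1 K1 nKu nt nc1.
rewrite two1 in tc2.
have key r : (tv2 r \in 'N(K))%g ->
    (((a * c1 - c * a1) / c1 - (r * c1) * (c / c1)) ^+ 2 + (c / c1) ^+ 2) ^+ 2 = 1.
  move=> nKr; have Kr := mem_conjV nKr K1; rewrite tv2J // in Kr.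
  have er := det_tv2J r e1.
  have nZr : sl2 (a1 + r * c1) (b1 + r * (d1 - a1) - r ^+ 2 * c1) c1 (d1 - r * c1) \notin 'Z(SL 2 F)%g.
    apply/center_SL2P=> -[x xx] /sl2_inj[] //; first by rewrite mulr0 subr0 -expr2.
    by move=> _ _ c10; rewrite c10 eqxx in nc1.
  have Kry := mem_normJ nKy Kr.
  have nZry := mem_normJ_not (subsetP (normal_norm (center_normal (SL_group 2 F))) _ (sl2_SL e)) nZr.
  rewrite sl2J // in Kry; rewrite sl2J // in nZry.
  have := quaternion_entry dK nKu nt e1 nc1 K1 (det_sl2J er e) Kry nZry.
  set g := (X in t * X) => tg.
  have gE : g * c1 = (a * c1 - c * (a1 + r * c1)) ^+ 2 + c ^+ 2.
    have -> : c ^+ 2 = c ^+ 2 * (a1 * d1 - b1 * c1) by rewrite e1 mulr1.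
    by rewrite /g da1; ring.
  have -> : ((a * c1 - c * a1) / c1 - r * c1 * (c / c1)) ^+ 2 + (c / c1) ^+ 2 = g * c1 / c1 ^+ 2.
    by rewrite gE; field.
  have nt2 : t ^+ 2 != 0 by rewrite expf_neq0.
  have gc : g ^+ 2 = c1 ^+ 2 by apply: (mulfI nt2); rewrite -!exprMn tg tc2.
  have -> : (g * c1 / c1 ^+ 2) ^+ 2 = g ^+ 2 / c1 ^+ 2 by field.
  by rewrite gc mulfV // expf_neq0.
have nC : c / c1 != 0 by rewrite mulf_neq0 ?invr_eq0.
apply: (@three_conics _ _ (t * c1)) => //.
- by have := key 0; rewrite !mul0r subr0; apply; rewrite /tv2 sl2_1 group1.
- exact: key.
have := key (- t); rewrite !mulNr opprK; apply.
have -> : tv2 (- t) = ((tv2 t)^-1)%g.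
  by apply/eqP; rewrite eq_sym eq_invg_mul unip2M subrr /tv2 sl2_1.
by rewrite groupV.
Qed.

(** [conj_conics], used for the matrix and for its inverse, gives two scalars equal to their cubes
    whose sum is the trace; cubing is additive in characteristic 3. *)
Lemma sol_transvection3 t a b c d : a * d - b * c = 1 -> t != 0 -> c != 0 ->
  sol (tv2 t) (sl2 a b c d) -> (t * c) ^+ 2 = 1 /\ (a + d) ^+ 3 = a + d.
Proof.
move=> e nt nc /(sol_transvection e nt nc)[K [sKS dK nKu nKy [a1 [b1 [c1 [d1 [e1 nc1 K1]]]]]]].
have two1 : - 2%:R = 1 :> F by apply: (@char3_eq _ _ (-1)); ring.
have [da1 tc2] := quaternion_step dK e1 K1 nKu nt nc1.
have [C2 A3] := conj_conics dK nKu nt e1 nc1 K1 e nc nKy.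
have eV : d * a - (- b) * (- c) = 1 by rewrite -[RHS]e; ring.
have nKyV := groupVr nKy; rewrite sl2V // in nKyV.
have ncV : - c != 0 by rewrite oppr_eq0.
have [_ D3] := conj_conics dK nKu nt e1 nc1 K1 eV ncV nKyV.
split.
  have -> : (t * c) ^+ 2 = (t * c1) ^+ 2 * (c / c1) ^+ 2 by field.
  by rewrite tc2 C2 two1 mulr1.
have -> : a + d = (a * c1 - c * a1) / c1 + (d * c1 - (- c) * a1) / c1 by field.
move: A3 D3; move: (_ / c1) (_ / c1) => A D A3 D3; rewrite -[in RHS]A3 -[in RHS]D3.
by apply: (@char3_eq _ _ (A ^+ 2 * D + A * D ^+ 2)); ring.
Qed.

End Char3.

End OddSpecialLinear2.

(** * Colourings and involutions of PSL(2,q), q odd *)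

Section OddPSL2.
Variable F : finFieldType.
Local Open Scope ring_scope.
Implicit Types a b c d t : F.
Hypothesis two_neq0 : 2%:R != 0 :> F.

Lemma opp_neq a : a != 0 -> - a != a.
Proof.
move=> na; rewrite eq_sym -subr_eq0 opprK -mulr2n -mulr_natl.
by rewrite mulf_neq0.
Qed.

(* Representatives of the units modulo sign. *)
Definition half_units : {set F} := [set a | (a != 0) && (enum_rank a < enum_rank (- a))%N].

Lemma half_neq0 a : a \in half_units -> a != 0.
Proof. by rewrite inE => /andP[]. Qed.

Lemma half_opp a : a != 0 -> (- a \in half_units) = (a \notin half_units).
Proof.
move=> na; rewrite !inE oppr_eq0 na opprK /= -leqNgt ltn_neqAle.
by rewrite (inj_eq val_inj) (inj_eq enum_rank_inj) opp_neq.
Qed.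

Lemma card_half : (2 * #|half_units| = #|F|.-1)%N.
Proof.
have eN : #|[set - a | a in half_units]| = #|half_units| by rewrite card_imset //; apply: oppr_inj.
rewrite mul2n -addnn -{2}eN -cardsUI.
have -> : half_units :&: [set - a | a in half_units] = set0.
  apply/setP=> a; rewrite in_setI in_set0; apply/andP=> -[ha /imsetP[b hb eb]].
  by move: ha; rewrite eb half_opp ?half_neq0 // hb.
have -> : half_units :|: [set - a | a in half_units] = [set~ 0].
  apply/setP=> a; rewrite in_setU in_setC1; apply/orP/idP=> [[/half_neq0 //|/imsetP[b /half_neq0 nb ->]]|na].
    by rewrite oppr_eq0.
  have [ha|nha] := boolP (a \in half_units); [by left|right].
  by apply/imsetP; exists (- a); rewrite ?opprK // half_opp.
by rewrite cards0 addn0 cardsC1.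
Qed.

Local Notation SLF := (SL_group 2 F).
Local Notation Z := ('Z(SL 2 F))%G.

Lemma SL_normZ x : x \in SLF -> (x \in 'N(Z))%g.
Proof. exact: (subsetP (normal_norm (center_normal SLF))). Qed.

Lemma sol_PSL x y : x \in SLF -> y \in SLF -> sol (coset Z x) (coset Z y) = sol x y.
Proof. by move=> Sx Sy; apply: sol_quotient; rewrite ?center_abelian ?SL_normZ. Qed.

Lemma coset_opp a b c d : a * d - b * c = 1 ->
  coset Z (sl2 (- a) (- b) (- c) (- d)) = coset Z (sl2 a b c d).
Proof.
move=> e; have eN : - a * - d - - b * - c = 1 by rewrite -[RHS]e; ring.
have e1 : -1 * -1 - 0 * 0 = 1 :> F by ring.
have -> : sl2 (- a) (- b) (- c) (- d) = (sl2 (-1) 0 0 (-1) * sl2 a b c d)%g.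
  by rewrite sl2M //; congr (sl2 _ _ _ _); ring.
by rewrite coset_kerl //; apply/center_SL2P; exists (-1); rewrite // sqrrN expr1n.
Qed.

Lemma coset_sl2_eq a b c d a' b' c' d' : a * d - b * c = 1 -> a' * d' - b' * c' = 1 ->
    coset Z (sl2 a b c d) = coset Z (sl2 a' b' c' d') ->
  exists2 s, s = 1 \/ s = -1 & [/\ a = s * a', b = s * b', c = s * c' & d = s * d'].
Proof.
move=> e e' /kercoset_rcoset[]; rewrite ?SL_normZ ?sl2_SL // => z /center_SL2P[s s2 ->].
rewrite sl2M //; last by rewrite mulr0 subr0 -expr2.
case/sl2_inj=> //.
  transitivity (s ^+ 2 * (a' * d' - b' * c')); first by ring.
  by rewrite s2 e' mulr1.
move=> -> -> -> ->; exists s; last by split; ring.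
have/eqP : (s - 1) * (s + 1) = 0 by rewrite -subr_sqr s2 expr1n subrr.
by rewrite mulf_eq0 subr_eq0 addr_eq0 => /orP[]/eqP; [left|right].
Qed.

(** Selects one of the two lifts of an element of PSL(2,q): [half_units] fixes the sign of the lower
    left entry or, when that vanishes, of the upper left one. *)
Definition normalised_lift (x : {'GL_2[F]}) :=
  if GLval x 1 0 != 0 then GLval x 1 0 \in half_units else GLval x 0 0 \in half_units.

Lemma normalised_sl2 a b c d : a * d - b * c = 1 ->
  normalised_lift (sl2 a b c d) = if c != 0 then c \in half_units else a \in half_units.
Proof. by move=> e; rewrite /normalised_lift sl2K // !mx2E. Qed.

Definition lift2 (X : coset_of Z) : {'GL_2[F]} :=
  odflt 1%g [pick x in SLF | normalised_lift x && (coset Z x == X)].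

Lemma lift2P X : X \in PSL 2 F -> exists a b c d, [/\ a * d - b * c = 1,
  lift2 X = sl2 a b c d, X = coset Z (sl2 a b c d)
    & if c != 0 then c \in half_units else a \in half_units].
Proof.
case/morphimP=> x _ Sx ->; rewrite /lift2; case: pickP => [y|none] /=.
  case/andP=> Sy /andP[ny /eqP <-]; have [a [b [c [d [e ey]]]]] := sl2P Sy.
  exists a, b, c, d; split; rewrite ?ey //.
  by rewrite -(normalised_sl2 e) -ey.
have [a [b [c [d [e ex]]]]] := sl2P Sx.
have eN : - a * - d - - b * - c = 1 by rewrite -[RHS]e; ring.
have na0 : c = 0 -> a != 0.
  by move=> c0; apply: contra_eq_neq e => ->; rewrite c0 mul0r mulr0 subrr eq_sym oner_neq0.
case: (boolP (normalised_lift x)) => [nx|].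
  by have := none x; rewrite Sx nx eqxx.
rewrite ex normalised_sl2 //; have := none (sl2 (- a) (- b) (- c) (- d)).
rewrite sl2_SL // normalised_sl2 // coset_opp // -ex eqxx oppr_eq0 andbT /=.
case: (eqVneq c 0) => [/na0 na|nc] /=; first by rewrite (half_opp na) => ->.
by rewrite (half_opp nc) => ->.
Qed.

(* For c != 0, the bottom row (c, d) of a lift determines it up to left multiplication by
   a transvection. *)
Definition color2 (X : coset_of Z) : bool * F * F :=
  let x := lift2 X in
  if GLval x 1 0 != 0 then (true, GLval x 1 0, GLval x 1 1) else (false, GLval x 0 0, GLval x 0 1).

(** The flag separates upper triangular elements, determined by their first row, from the others;
    each kind uses q(q - 1)/2 colours. *)
Definition palette2 : {set bool * F * F} := setX (setX setT half_units) setT.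

Lemma card_palette2 : #|palette2| = (#|F|.-1 * #|F|)%N.
Proof. by rewrite /palette2 !cardsX !cardsT card_bool card_half. Qed.

Lemma color2_palette X : X \in PSL 2 F -> color2 X \in palette2.
Proof.
case/lift2P=> a [b [c [d [e eX _ h]]]]; rewrite /color2 eX sl2K // !mx2E.
by case: (eqVneq c 0) h => _ /= h; rewrite /palette2 !in_setX h !in_setT.
Qed.

(** Upper triangular elements are determined by their colour, so a clash has [c != 0]; two matrices
    of determinant 1 with the same bottom row differ by a transvection on the left. *)
Lemma color2_eq X Y : X \in PSL 2 F -> Y \in PSL 2 F -> X != Y -> color2 X = color2 Y ->
  exists a b c d t, [/\ a * d - b * c = 1 /\ lift2 X = sl2 a b c d,
    lift2 Y = sl2 (a + t * c) (b + t * d) c d, c != 0, t != 0 &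
    sol X Y = sol (tv2 t) (sl2 a b c d)].
Proof.
case/lift2P=> a [b [c [d [e eX cX _]]]]; case/lift2P=> a' [b' [c' [d' [e' eY cY _]]]] nXY.
rewrite /color2 eX eY !sl2K // !mx2E.
case: (eqVneq c 0) => [c0|nc]; case: (eqVneq c' 0) => [c0'|nc'] //= [].
  move=> eaa ebb; case/eqP: nXY; rewrite cX cY eaa ebb c0 c0'; congr (coset Z (sl2 _ _ _ _)).
  move: e e'; rewrite c0 c0' !mulr0 !subr0 eaa => e e'.
  have na : a' != 0 by apply: contra_eq_neq e' => ->; rewrite mul0r eq_sym oner_neq0.
  by apply: (mulfI na); rewrite e e'.
move=> ecc edd; rewrite -ecc -edd in e' eY cY *.
pose t := (a' - a) / c.
have ea : a' = a + t * c by rewrite /t; field.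
have eb : b' = b + t * d.
  apply: (mulIf nc); have -> : b' * c = a' * d - 1 by rewrite -e'; ring.
  by rewrite ea -e; ring.
exists a, b, c, d, t; split.
- by split.
- by rewrite -ea -eb.
- by [].
- by apply: contra nXY => /eqP t0; rewrite cX cY ea eb t0 !mul0r !addr0.
rewrite {1}cX {1}cY sol_PSL ?sl2_SL //.
have -> : sl2 a' b' c d = (tv2 t * sl2 a b c d)%g.
  by rewrite /tv2 sl2M ?det_unip // ea eb; congr (sl2 _ _ _ _); ring.
by rewrite sol_mull sol_sym.
Qed.

Lemma solcol_PSL2_large : 3%:R != 0 :> F -> solcol (PSL 2 F) (#|F|.-1 * #|F|).
Proof.
move=> three; apply: (@colorable_on_image _ _ _ color2 palette2).
- by move=> X /setD1P[_]; apply: color2_palette.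
- by rewrite card_palette2.
move=> X Y /setD1P[_ GX] /setD1P[_ GY] nXY solXY; apply/eqP=> eXY.
have [a [b [c [d [t [[e _] _ nc nt es]]]]]] := color2_eq GX GY nXY eXY.
by move: (not_sol_transvection two_neq0 e nt nc three); rewrite -es solXY.
Qed.

Lemma involutions_PSL2 : exists A : {set coset_of Z}, [/\ A \subset (PSL 2 F)^#%g,
  {in A &, forall X Y, sol X Y} & #|A| = ((#|F| * (#|F| - 1)) %/ 2)%N].
Proof.
(* The involutions of PSL(2,F) are the images of the matrices of trace zero. *)
pose f (p : F * F) := sl2 p.1 p.2 (- (1 + p.1 ^+ 2) / p.2) (- p.1).
have df p : p.2 \in half_units -> p.1 * (- p.1) - p.2 * (- (1 + p.1 ^+ 2) / p.2) = 1.
  by move/half_neq0 => n; field.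
(* Only lifts with nonzero upper right entry are taken, and [half_units] picks one of each pair of
   opposite lifts. If -1 is a square there are further involutions, with zero entry, which the bound
   leaves out. *)
exists [set coset Z (f p) | p in setX setT half_units]; split.
- apply/subsetP=> _ /imsetP[[a b] /setXP[/= _ hb] ->]; have e := df (a, b) hb.
  apply/setD1P; split; last by rewrite mem_quotient // sl2_SL.
  apply/eqP=> /coset_idr; rewrite SL_normZ ?sl2_SL // => /(_ isT)/center_SL2P[x xx].
  case/sl2_inj=> //; first by rewrite mulr0 subr0 -expr2.
  by move=> _ /= b0; move: (half_neq0 hb); rewrite /= b0 eqxx.
- have sq p : p.2 \in half_units -> (coset Z (f p) ^+ 2 = 1)%g.
    move=> hp; have e := df p hp; have np := half_neq0 hp.
    rewrite -morphX ?SL_normZ ?sl2_SL //; apply: coset_id; apply/center_SL2P; exists (-1).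
      by rewrite sqrrN expr1n.
    by rewrite expgS expg1 sl2M //; congr (sl2 _ _ _ _); field.
  move=> _ _ /imsetP[[a b] /setXP[_ hp] ->] /imsetP[[a' b'] /setXP[_ hr] ->].
  by apply: sol_involutions; apply: sq.
rewrite card_in_imset.
  rewrite cardsX cardsT subn1 -card_half mulnCA mulKn //.
move=> [a b] [a' b'] /setXP[_ /= hb] /setXP[_ /= hb'].
case/(coset_sl2_eq (df (a, b) hb) (df (a', b') hb')) => s [] -> [/= -> eb _ _].
  by rewrite eb !mul1r.
by move: hb; rewrite eb mulN1r half_opp ?half_neq0 // hb'.
Qed.

Section Char3.
Hypothesis three0 : 3%:R = 0 :> F.
Hypothesis nsq : forall x : F, x ^+ 2 != -1.
Hypothesis card_gt4 : (4 < #|F|)%N.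

(** Upper triangular elements give the first summand. Elsewhere [sol_transvection3] leaves one [c]
    up to sign and three traces, while [d] is free. *)
Lemma degree_transvection t : t != 0 ->
  (#|[set Y in PSL 2 F | sol (coset Z (tv2 t)) Y]| <= #|half_units| * #|F| + 3 * #|F|)%N.
Proof.
move=> nt; pose g1 (p : F * F) := coset Z (sl2 p.1 p.2 0 p.1^-1).
pose P' := [set c in half_units | (t * c) ^+ 2 == 1].
(* [s] runs over -1, 0, 1, the possible traces; [a] and [b] are recovered from the trace and the
   determinant. *)
pose g2 (p : 'I_3 * F * F) := let s := (val p.1.1)%:R - 1 in let c := p.1.2 in let d := p.2 in
  coset Z (sl2 (s - d) (((s - d) * d - 1) / c) c d).
have cP' : (#|P'| <= 1)%N.
  apply/card_le1P=> c /setIdP[hc /eqP tc] c'; rewrite [in RHS]inE.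
  apply/setIdP/eqP=> [[hc' /eqP tc']|->]; last by rewrite tc.
  have /eqP : (t * c' - t * c) * (t * c' + t * c) = 0 by rewrite -subr_sqr tc tc' subrr.
  rewrite -mulrBr -mulrDr !mulf_eq0 (negPf nt) /= subr_eq0 addr_eq0 => /orP[/eqP //|/eqP ec].
  by have := half_opp (half_neq0 hc); rewrite -ec hc hc'.
apply: (@leq_trans (#|g1 @: setX half_units setT| + #|g2 @: setX (setX setT P') setT|)).
  apply: leq_trans (leq_card_setU _ _); apply/subset_leq_card/subsetP=> Y.
  rewrite inE => /andP[GY solY].
  have [a [b [c [d [e _ eY h]]]]] := lift2P GY.
  have sol_tY : sol (tv2 t) (sl2 a b c d).
    by rewrite -sol_PSL ?sl2_SL ?det_unip // -eY.
  apply/setUP; case: (eqVneq c 0) h => [c0|nc] /= h; [left|right].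
    apply/imsetP; exists (a, b); first by rewrite in_setX h in_setT.
    rewrite eY /g1 /= c0; congr (coset Z (sl2 _ _ _ _)).
    by move: e; rewrite c0 mulr0 subr0 => e; apply: (mulfI (half_neq0 h)); rewrite e mulfV ?half_neq0.
  have [tc tr3] := sol_transvection3 two_neq0 three0 nsq e nt nc sol_tY.
  have [i ei] : exists i : 'I_3, (val i)%:R - 1 = a + d.
    move: tr3; move: (a + d) => v v3; have /eqP : v * ((v - 1) * (v + 1)) = 0.
      have -> : v * ((v - 1) * (v + 1)) = v ^+ 3 - v by ring.
      by rewrite v3 subrr.
    rewrite !mulf_eq0 subr_eq0 addr_eq0 => /or3P[]/eqP->.
    - by exists (Ordinal (isT : (1 < 3)%N)); rewrite subrr.
    - by exists (Ordinal (isT : (2 < 3)%N)) => /=; ring.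
    - by exists (Ordinal (isT : (0 < 3)%N)) => /=; ring.
  apply/imsetP; exists (i, c, d).
    by rewrite !in_setX !in_setT inE tc eqxx andbT /= andbT.
  rewrite /g2 /= ei eY; congr (coset Z (sl2 _ _ _ _)); first by ring.
  apply: (mulIf nc); rewrite divfK // -[in RHS]e; ring.
apply: leq_add; apply: leq_trans (leq_imset_card _ _) _; rewrite !cardsX !cardsT //.
by rewrite card_ord leq_mul2r; apply/orP; right; move: cP'; move: #|P'| => x; clear; lia.
Qed.

(** In characteristic 3, trace 1 or -1 is trace -2 or 2, so the matrix is unipotent up to sign. *)
Lemma conj_transvection a b c d : a * d - b * c = 1 -> c != 0 -> (a + d) ^+ 2 = 1 ->
  exists2 X, X \in PSL 2 F & exists2 t, t != 0 &
    (coset Z (sl2 a b c d) ^ X)%g = coset Z (tv2 t).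
Proof.
have main a1 b1 c1 d1 : a1 * d1 - b1 * c1 = 1 -> c1 != 0 -> a1 + d1 = 2%:R ->
    exists2 X, X \in PSL 2 F & exists2 t, t != 0 &
      (coset Z (sl2 a1 b1 c1 d1) ^ X)%g = coset Z (tv2 t).
  move=> e nc tr; have ed : d1 = 2%:R - a1 by rewrite -tr; ring.
  have eb : b1 = (a1 * d1 - 1) / c1 by rewrite -e; field.
  have eg : (a1 - 1) * 0 - (- c1^-1) * c1 = 1 by field.
  (* With N the matrix minus 1, so that N^2 = 0, the columns are the fixed vector N e1 and e1 scaled
     to give determinant 1. *)
  exists (coset Z (sl2 (a1 - 1) (- c1^-1) c1 0)); first by rewrite mem_quotient // sl2_SL.
  exists (- c1^-1); first by rewrite oppr_eq0 invr_eq0.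
  rewrite -morphJ ?SL_normZ ?sl2_SL //; congr (coset Z _); rewrite sl2J //.
  by rewrite /tv2; congr (sl2 _ _ _ _); rewrite eb ed; field.
move=> e nc tr2; have/eqP : (a + d - 1) * (a + d + 1) = 0 by rewrite -subr_sqr tr2 expr1n subrr.
have two1 : 2%:R = -1 :> F by apply: (@char3_eq _ three0 _ _ 1); ring.
rewrite mulf_eq0 subr_eq0 addr_eq0 => /orP[]/eqP tr; last by apply: main; rewrite ?tr.
have eN : - a * - d - - b * - c = 1 by rewrite -[RHS]e; ring.
by rewrite -coset_opp //; apply: main; rewrite ?oppr_eq0 // two1 -tr; ring.
Qed.

(** In a clash inside [B] both traces lie in F_3 and differ from 1 and -1, so both vanish; yet they
    differ by [t * c], which is nonzero. The other elements are conjugate to transvections, of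
    degree at most q(q - 1)/2 + 3q, which is below q(q + 1) - 2 exactly when q > 4. *)
Lemma solcol_PSL2_char3 : solcol (PSL 2 F) (#|F| * #|F|.+1 - 2).
Proof.
have hF := card_half.
pose B := [set X in (PSL 2 F)^#%g |
  (GLval (lift2 X) 1 0 == 0) || ((GLval (lift2 X) 0 0 + GLval (lift2 X) 1 1) ^+ 2 != 1)].
apply: (@colorable_on_greedy _ _ (@sol_sym _) B) => [|X|].
- by apply/subsetP=> X /setIdP[].
- rewrite inE => /andP[nBX GX]; have [nX1 PX] := setD1P GX.
  have [a [b [c [d [e eX cX _]]]]] := lift2P PX.
  move: nBX; rewrite inE GX /= eX sl2K // !mx2E negb_or negbK => /andP[nc /eqP tr].
  have [Y PY [t nt eXY]] := conj_transvection e nc tr.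
  rewrite -cX in eXY; apply: (@leq_ltn_trans (#|half_units| * #|F| + 3 * #|F|)).
    apply: leq_trans (degree_transvection nt); rewrite -(cardJg _ Y).
    apply/subset_leq_card/subsetP=> _ /imsetP[W + ->]; rewrite !inE => /and3P[/andP[_ PW] _ sXW].
    by rewrite groupJ //= -eXY sol_conj.
  move: hF card_gt4; move: #|F| #|half_units| => q h; clear; nia.
apply: (@colorable_on_image _ _ _ color2 palette2).
- by move=> X /setIdP[/setD1P[_ PX] _]; apply: color2_palette.
- rewrite card_palette2; move: card_gt4; move: #|F| => q; clear; nia.
move=> X Y /setIdP[/setD1P[_ PX] BX] /setIdP[/setD1P[_ PY] BY] nXY solXY; apply/eqP=> eXY.
have [a [b [c [d [t [[e eX] eY nc nt es]]]]]] := color2_eq PX PY nXY eXY.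
rewrite es in solXY; have [tc tr3] := sol_transvection3 two_neq0 three0 nsq e nt nc solXY.
have e' : (a + t * c) * d - (b + t * d) * c = 1 by rewrite -[RHS]e; ring.
have F3 (v : F) : v ^+ 3 = v -> v ^+ 2 != 1 -> v = 0.
  move=> v3 nv2; have /eqP : v * (v ^+ 2 - 1) = 0.
    have -> : v * (v ^+ 2 - 1) = v ^+ 3 - v by ring.
    by rewrite v3 subrr.
  by rewrite mulf_eq0 subr_eq0 (negPf nv2) orbF => /eqP.
move: BX BY; rewrite eX eY !sl2K // !mx2E (negPf nc) /= => /(F3 _ tr3) tr0 trY.
have/F3/(_ trY) : (a + t * c + d) ^+ 3 = a + t * c + d.
  have -> : a + t * c + d = t * c by rewrite addrAC tr0 add0r.
  by rewrite exprS tc mulr1.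
move/eqP; rewrite addrAC tr0 add0r => /eqP tc0.
by move: tc; rewrite tc0 expr0n /= => /eqP; rewrite eq_sym oner_eq0.
Qed.

End Char3.

End OddPSL2.

(** * Suzuki groups *)

Section Suzuki.
Variables (F : finFieldType) (p : nat).
Hypothesis oddp : odd p.
Hypothesis p_gt1 : 1 < p.
Hypothesis cardF : #|F| = 2 ^ p.
Local Open Scope ring_scope.
Implicit Types a b c d k l x y : F.
Local Notation theta := (@Sz_theta F).

Let two0 : 2%:R = 0 :> F := card_pchar0 (isT : prime 2) cardF.

Lemma char2_eq x y z : x = y + z *+ 2 -> x = y.
Proof. by rewrite -mulr_natl two0 mul0r addr0. Qed.

Lemma char2_opp x : - x = x.
Proof. by apply: (@char2_eq _ _ (- x)); ring. Qed.

Lemma char2_addr x : x + x = 0.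
Proof. by apply: (@char2_eq _ _ x); ring. Qed.

Lemma char2_add_eq x y : x + y = 0 -> x = y.
Proof. by move/eqP; rewrite addr_eq0 char2_opp => /eqP. Qed.

Lemma Sz_exponentE : p = (Sz_exponent F).*2.+1.
Proof.
by rewrite /Sz_exponent cardF pfactorK // -[LHS]odd_double_half oddp.
Qed.

Lemma thetaD x y : theta (x + y) = theta x + theta y.
Proof.
by rewrite /Sz_theta exprDn_pchar // pnatX pnatE // (card_finPcharP cardF).
Qed.

Lemma thetaM x y : theta (x * y) = theta x * theta y.
Proof. exact: exprMn. Qed.

Lemma theta1 : theta 1 = 1. Proof. exact: expr1n. Qed.
Lemma theta0 : theta 0 = 0. Proof. by rewrite /Sz_theta expr0n expn_eq0. Qed.

Lemma thetaV x : theta x^-1 = (theta x)^-1.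
Proof. by rewrite /Sz_theta exprVn. Qed.

Lemma theta_eq0 x : (theta x == 0) = (x == 0).
Proof. by rewrite expf_eq0 expn_gt0. Qed.

Lemma thetaK x : theta (theta x) = x ^+ 2.
Proof.
rewrite /Sz_theta -exprM -expnD addnS addSn addnn -Sz_exponentE expnSr exprM.
by rewrite -cardF expf_card.
Qed.

Lemma theta_root x : theta (x ^+ (2 ^ Sz_exponent F)) = x.
Proof.
by rewrite /Sz_theta -exprM -expnD addnS addnn -Sz_exponentE -cardF expf_card.
Qed.

Lemma theta_fixed x : theta x = x -> x = 0 \/ x = 1.
Proof.
move=> tx; have := thetaK x; rewrite !tx => e.
have: x * (x - 1) == 0 by rewrite mulrBr mulr1 -expr2 -e subrr.
by rewrite mulf_eq0 subr_eq0 => /orP[]/eqP->; [left|right].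
Qed.

(** Applying [theta] gives [theta x * x ^+ 2 = theta y * y ^+ 2]; dividing by the hypothesis leaves
    [x = y]. *)
Lemma mul_theta_inj x y : x * theta x = y * theta y -> x = y.
Proof.
move=> e; have := congr1 theta e; rewrite !thetaM !thetaK => e2.
have [y0|ny0] := eqVneq y 0.
  by move/eqP: e; rewrite y0 mul0r mulf_eq0 theta_eq0 orbb => /eqP.
have nty : y * theta y != 0 by rewrite mulf_neq0 // theta_eq0.
apply: (mulfI nty); rewrite -{1}e.
have -> : x * theta x * x = theta x * x ^+ 2 by ring.
by rewrite e2; ring.
Qed.

(** Any [x] outside the prime field works: the value 0 means [theta x = x], the value 1 gives
    [theta (theta x) = x], and either makes [x ^+ 2 = x]. *)
Lemma exists_theta_shift : exists x, theta x + x != 0 /\ theta x + x != 1.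
Proof.
have [x] : exists x : F, x \notin [set (0 : F); 1].
  apply/existsP; rewrite -negb_forall; apply/negP=> /forallP all01.
  have: (#|F| <= #|[set (0%R : F); 1%R]|)%N by apply/subset_leq_card/subsetP=> x _.
  have: (2 ^ 2 <= 2 ^ p)%N by rewrite leq_exp2l.
  by rewrite cards2 cardF; case: (_ != _); lia.
rewrite !inE negb_or => /andP[nx0 nx1].
exists x; split; apply/eqP=> e.
  by case: (theta_fixed (char2_add_eq e)) => x01; move: nx0 nx1; rewrite x01 eqxx.
have tx : theta x = x + 1 by apply: char2_add_eq; rewrite addrA e char2_addr.
have := thetaK x; rewrite tx thetaD theta1 tx -addrA char2_addr addr0 => e2.
have: x * (x - 1) == 0 by rewrite mulrBr mulr1 -expr2 -e2 subrr.
by rewrite mulf_eq0 subr_eq0 (negPf nx0) (negPf nx1).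
Qed.

(** The corner entry of [Sz_unipotent a b], which is the function defining the Suzuki-Tits ovoid. *)
Definition quad a b := a ^+ 2 * theta a + a * b + theta b.

Lemma theta_quad a b : theta (quad a b) = theta a ^+ 2 * a ^+ 2 + theta a * theta b + b ^+ 2.
Proof. by rewrite /quad !thetaD !thetaM !thetaK; ring. Qed.

(** Modulo 2, [theta (quad a b) + theta a * quad a b] is [b * (theta a * a + b)]; whichever factor
    vanishes, [quad a b] reduces to [a ^+ 2 * theta a]. This makes the big cell formula available
    for every nontrivial unipotent. *)
Lemma quad_eq0 a b : quad a b = 0 -> a = 0 /\ b = 0.
Proof.
move=> f0; have := theta_quad a b; rewrite f0 theta0 => g0.
have ta x : theta x = 0 -> x = 0 by move/eqP; rewrite theta_eq0 => /eqP.
have e : b * (theta a * a + b) = 0.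
  pose z := theta a ^+ 2 * a ^+ 2 + theta a * theta b.
  have -> : b * (theta a * a + b) = (z + b ^+ 2) + theta a * quad a b + (- z) *+ 2.
    by rewrite /quad /z; ring.
  by rewrite -g0 f0 mulr0 !add0r -mulr_natr two0 mulr0.
case: (eqVneq a 0) => [a0|na0].
  by split=> //; move: f0; rewrite /quad a0 expr0n !mul0r !add0r; apply: ta.
have [ta0|nta0] := eqVneq (theta a) 0; first by rewrite (ta _ ta0) eqxx in na0.
case/eqP: (mulf_neq0 (expf_neq0 2 na0) nta0); rewrite -f0.
move/eqP: e; rewrite mulf_eq0 addrC => /orP[/eqP b0|/eqP/char2_add_eq b0].
  by rewrite /quad b0 theta0 mulr0 !addr0.
by apply: (@char2_eq _ _ (- (a ^+ 2 * theta a))); rewrite /quad b0 thetaM thetaK; ring.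
Qed.

Local Notation m4 := (@matrix4 F).

Ltac m4_cases := apply/matrixP; case=> [[|[|[|[|]]]] ?] //; case=> [[|[|[|[|]]]] ?] //;
  rewrite !mxE ?big_ord_recl ?big_ord0 ?mxE /= ?mxE /=.

Lemma Sz_unipotentM a b c d :
  Sz_unipotent a b *m Sz_unipotent c d = Sz_unipotent (a + c) (b + d + theta a * c).
Proof.
m4_cases.
all: try ring.
- by rewrite thetaD; ring.
- apply: (@char2_eq _ _ (- (theta a * a * c + theta c * a ^+ 2 + theta c * a * c + theta a * c ^+ 2))).
  by rewrite !thetaD thetaM thetaK; ring.
- by apply: (@char2_eq _ _ (- (theta a * c))); rewrite thetaD; ring.
Qed.

Lemma Sz_unipotent0 : Sz_unipotent 0 0 = 1 :> 'M[F]_4.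
Proof. m4_cases; rewrite ?theta0; ring. Qed.

(** [Sz_diagonal k] in the parameter [l] with [theta l = k], which removes the exponents depending
    on the field. *)
Definition Sz_diag l : 'M[F]_4 := matrix4
  [:: [:: l * theta l; 0; 0; 0]; [:: 0; l; 0; 0]; [:: 0; 0; l^-1; 0]; [:: 0; 0; 0; (l * theta l)^-1]].

Lemma Sz_diagonalE k : Sz_diagonal k = Sz_diag (k ^+ (2 ^ Sz_exponent F)).
Proof.
rewrite /Sz_diag theta_root mulrC -exprS; m4_cases => //; rewrite ?invrM //.
Qed.

Lemma Sz_diagM k l : k != 0 -> l != 0 -> Sz_diag k *m Sz_diag l = Sz_diag (k * l).
Proof.
move=> nk0 nl0; have [ntk ntl] : theta k != 0 /\ theta l != 0 by rewrite !theta_eq0.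
m4_cases; rewrite ?thetaM.
all: try by field; rewrite ?nk0 ?nl0 ?ntk ?ntl.
Qed.

Lemma Sz_diag1 : Sz_diag 1 = 1.
Proof. m4_cases; rewrite ?theta1 ?mulr1 ?invr1 //. Qed.

Lemma Sz_unipotent_diag a b l : l != 0 -> Sz_unipotent a b *m Sz_diag l =
  Sz_diag l *m Sz_unipotent (theta l * a) (l ^+ 2 * theta l * b).
Proof.
move=> nl0; have ntl : theta l != 0 by rewrite theta_eq0.
m4_cases; rewrite ?thetaM ?thetaK.
all: by field; rewrite ?nl0 ?ntl.
Qed.

Lemma Sz_antidiagonal2 : Sz_antidiagonal F *m Sz_antidiagonal F = 1.
Proof. m4_cases; ring. Qed.

Lemma Sz_antidiagonal_diag l : l != 0 ->
  Sz_antidiagonal F *m Sz_diag l = Sz_diag l^-1 *m Sz_antidiagonal F.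
Proof.
move=> nl0; have ntl : theta l != 0 by rewrite theta_eq0.
m4_cases; rewrite ?thetaV ?invf_div ?invrK.
all: by field; rewrite ?nl0 ?ntl.
Qed.


Lemma antidiagonal_conj a b :
  Sz_antidiagonal F *m Sz_unipotent a b *m Sz_antidiagonal F = matrix4
  [:: [:: 1; a; a * theta a + b; quad a b]; [:: 0; 1; theta a; b]; [:: 0; 0; 1; a]; [:: 0; 0; 0; 1]].
Proof.
have -> : Sz_antidiagonal F *m Sz_unipotent a b = matrix4
  [:: [:: quad a b; a * theta a + b; a; 1]; [:: b; theta a; 1; 0]; [:: a; 1; 0; 0]; [:: 1; 0; 0; 0]].
  by rewrite /quad; m4_cases; ring.
by m4_cases; ring.
Qed.

(** The torus parameter [l = g / f] is the one with [l * theta l = f], the corner entry; the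
    unipotent parameters are entries of the left side divided by [f] or [g]. *)
Lemma Sz_bruhat_mx a b : quad a b != 0 ->
  let f := quad a b in let g := theta f in let c := a * theta a + b in
  Sz_antidiagonal F *m Sz_unipotent a b *m Sz_antidiagonal F =
  (Sz_unipotent (b / f) (a / f) *m Sz_diag (g / f)) *m
    (Sz_antidiagonal F *m Sz_unipotent (c / f) (b / g)).
Proof.
move=> nf0 f g c; have ng0 : g != 0 by rewrite theta_eq0.
set A := theta a; set B := theta b; set C := A * a ^+ 2 + B.
have fE : f = C + a * b by rewrite /f /quad /C -/A -/B; ring.
have fE2 : a * c + B = f by rewrite /f /c /quad -/A -/B; ring.
have gE : g = A ^+ 2 * a ^+ 2 + A * B + b ^+ 2 by rewrite /g theta_quad.
have tc : theta c = C by rewrite /c thetaD thetaM thetaK.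
have tg : theta g = f ^+ 2 by rewrite thetaK.
(* The identities up to [I7] are the numerators left after clearing denominators; the witness given
   to [char2_eq] is half of the even discrepancy. *)
have I1 : a * g + c * C = b * f.
  by apply: (@char2_eq _ _ (A ^+ 2 * a ^+ 3 + A * B * a)); rewrite gE fE /c /C -/A; ring.
have I2 : c ^+ 2 * C + c * b * f + B * g = f * g.
  apply: (@char2_eq _ _ (A ^+ 2 * a ^+ 3 * b + A * B * a * b + A * a ^+ 2 * b ^+ 2 + B * b ^+ 2)).
  by rewrite gE fE /c /C -/A; ring.
have I4 : b * c + g = A * f.
  by apply: (@char2_eq _ _ (b ^+ 2)); rewrite gE fE /c /C -/A; ring.
have I5 : a * g + B * b = c * f.
  by apply: (@char2_eq _ _ (- (A * a ^+ 2 * b))); rewrite gE fE /c /C -/A; ring.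
have I6 : a ^+ 2 * g + B * C = f ^+ 2.
  by apply: (@char2_eq _ _ (- (A * a ^+ 3 * b + B * a * b))); rewrite gE fE /C; ring.
have I7 : b ^+ 2 * B + a * b * g + A * f ^+ 2 = f * g.
  by apply: (@char2_eq _ _ (A ^+ 2 * a ^+ 3 * b + A * B * a * b)); rewrite gE fE /C; ring.
rewrite antidiagonal_conj -/c -/f -/A.
have -> : Sz_antidiagonal F *m Sz_unipotent (c / f) (b / g) = matrix4
  [:: [:: f^-1; a / f; c / f; 1]; [:: b / g; C / g; 1; 0]; [:: c / f; 1; 0; 0]; [:: 1; 0; 0; 0]].
{ have e2 : (c / f) * (C / g) + b / g = a / f.
    have -> : (c / f) * (C / g) + b / g = ((a * g + c * C) + b * f) / (f * g) - a / f.
      by field; rewrite nf0 ng0.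
    by rewrite I1 char2_addr mul0r add0r char2_opp.
  have e1 : (c / f) ^+ 2 * (C / g) + (c / f) * (b / g) + B / f ^+ 2 = f^-1.
    have -> : (c / f) ^+ 2 * (C / g) + (c / f) * (b / g) + B / f ^+ 2 =
      (c ^+ 2 * C + c * b * f + B * g) / (f ^+ 2 * g) by field; rewrite nf0 ng0.
    by rewrite I2; field; rewrite nf0 ng0.
  have t1 : theta (c / f) = C / g by rewrite thetaM thetaV tc.
  have t2 : theta (b / g) = B / f ^+ 2 by rewrite thetaM thetaV tg.
  m4_cases; rewrite ?t1 ?t2.
  all: try by field; rewrite ?nf0 ?ng0.
  - by rewrite -[RHS]e1; ring.
  - by rewrite -[RHS]e2; ring. }
have -> : Sz_unipotent (b / f) (a / f) *m Sz_diag (g / f) = matrix4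
  [:: [:: f; 0; 0; 0]; [:: b; g / f; 0; 0]; [:: a; B / f; f / g; 0]; [:: 1; c / f; b / g; f^-1]].
{ have e1 : (b / f) ^+ 2 * (B / g) + (b / f) * (a / f) + A / g = f^-1.
    have -> : (b / f) ^+ 2 * (B / g) + (b / f) * (a / f) + A / g =
      (b ^+ 2 * B + a * b * g + A * f ^+ 2) / (f ^+ 2 * g) by field; rewrite nf0 ng0.
    by rewrite I7; field; rewrite nf0 ng0.
  have e2 : (b / f) * (B / g) + a / f = c / g.
    have -> : (b / f) * (B / g) + a / f = (a * g + B * b) / (f * g) by field; rewrite nf0 ng0.
    by rewrite I5; field; rewrite nf0 ng0.
  have t1 : theta (b / f) = B / g by rewrite thetaM thetaV.
  have t2 : theta (a / f) = A / g by rewrite thetaM thetaV.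
  have t3 : theta (g / f) = f ^+ 2 / g by rewrite thetaM thetaV tg.
  m4_cases; rewrite ?t1 ?t2 ?t3 ?e1 ?e2.
  all: by field; rewrite ?nf0 ?ng0. }
m4_cases.
all: try by field; rewrite ?nf0 ?ng0.
- by apply: (@char2_eq _ _ (- (b / f))); field; rewrite ?nf0 ?ng0.
- by transitivity ((C + a * b) / f); [rewrite -fE mulfV | field; rewrite ?nf0 ?ng0].
- by transitivity ((b * c + g) / f); [rewrite I4 mulfK | field; rewrite ?nf0 ?ng0].
- transitivity ((a * g + B * b + c * f) / (f * g)); first by rewrite I5 char2_addr mul0r.
  by field; rewrite ?nf0 ?ng0.
- transitivity ((a ^+ 2 * g + B * C + f ^+ 2) / (f * g)); first by rewrite I6 char2_addr mul0r.
  by field; rewrite ?nf0 ?ng0.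
- by transitivity ((a * c + B) / f); [rewrite fE2 mulfV | field; rewrite ?nf0 ?ng0].
- by apply: (@char2_eq _ _ (- (1 / f + (c / f) * (b / g)))); field; rewrite ?nf0 ?ng0.
- transitivity ((a * g + c * C + b * f) / (f * g)); first by rewrite I1 char2_addr mul0r.
  by field; rewrite ?nf0 ?ng0.
- by apply: (@char2_eq _ _ (- (c / f))); field; rewrite ?nf0 ?ng0.
Qed.

(** * Borel subgroup and Bruhat decomposition of Sz(q) *)

Definition gl4 (M : 'M[F]_4) : {'GL_4[F]} := insubd (1%g : {'GL_4[F]}) M.

Lemma gl4K (M N : 'M[F]_4) : M *m N = 1 -> GLval (gl4 M) = M.
Proof. by case/mulmx1_unit=> uM _; apply: insubdK. Qed.

Definition szu a b := gl4 (Sz_unipotent a b).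
Definition szd l := gl4 (Sz_diag l).
Definition szw := gl4 (Sz_antidiagonal F).

Lemma szuK a b : GLval (szu a b) = Sz_unipotent a b.
Proof.
apply: (@gl4K _ (Sz_unipotent a (b + theta a * a))).
by rewrite Sz_unipotentM char2_addr addrA char2_addr add0r char2_addr Sz_unipotent0.
Qed.

Lemma szdK l : l != 0 -> GLval (szd l) = Sz_diag l.
Proof.
move=> nl0; apply: (@gl4K _ (Sz_diag l^-1)).
by rewrite Sz_diagM ?invr_eq0 // mulfV // Sz_diag1.
Qed.

Lemma szwK : GLval szw = Sz_antidiagonal F.
Proof. by rewrite /szw (gl4K Sz_antidiagonal2). Qed.

Lemma szuM a b c d : (szu a b * szu c d)%g = szu (a + c) (b + d + theta a * c).
Proof. by apply: GL_inj; rewrite GL_MxE !szuK Sz_unipotentM. Qed.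

Lemma szu0 : szu 0 0 = 1%g.
Proof. by apply: GL_inj; rewrite szuK Sz_unipotent0. Qed.

Lemma szu_inj a b c d : szu a b = szu c d -> a = c /\ b = d.
Proof.
move/(congr1 (@GLval _ _)); rewrite !szuK => e; split.
  by move: (congr1 (fun M : 'M_4 => M (inord 1) (inord 0)) e); rewrite !mxE !inordK.
by move: (congr1 (fun M : 'M_4 => M (inord 2) (inord 0)) e); rewrite !mxE !inordK.
Qed.

Lemma szdM k l : k != 0 -> l != 0 -> (szd k * szd l)%g = szd (k * l).
Proof. by move=> nk nl; apply: GL_inj; rewrite GL_MxE !szdK ?mulf_neq0 // Sz_diagM. Qed.

Lemma szd1 : szd 1 = 1%g.
Proof. by apply: GL_inj; rewrite szdK ?oner_neq0 // Sz_diag1. Qed.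

Lemma szud a b l : l != 0 ->
  (szu a b * szd l)%g = (szd l * szu (theta l * a)%R (l ^+ 2 * theta l * b)%R)%g.
Proof. by move=> nl; apply: GL_inj; rewrite !GL_MxE !szuK szdK // Sz_unipotent_diag. Qed.

Lemma szw2 : (szw * szw)%g = 1%g.
Proof. by apply: GL_inj; rewrite GL_MxE szwK Sz_antidiagonal2. Qed.

Lemma szwd l : l != 0 -> (szw * szd l)%g = (szd l^-1%R * szw)%g.
Proof.
by move=> nl; apply: GL_inj; rewrite !GL_MxE szwK !szdK ?invr_eq0 // Sz_antidiagonal_diag.
Qed.

Lemma szwuw a b : quad a b != 0 -> exists k a1 b1 a2 b2, k != 0 /\
  (szw * szu a b * szw)%g = (szu a1 b1 * szd k * szw * szu a2 b2)%g.
Proof.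
move=> nf0; have nk : theta (quad a b) / quad a b != 0.
  by rewrite mulf_neq0 ?invr_eq0 // theta_eq0.
pose f := quad a b; exists (theta f / f), (b / f), (a / f), ((a * theta a + b) / f), (b / theta f).
split=> //; apply: GL_inj; rewrite -!mulgA (mulgA (szu _ _)) !GL_MxE !szuK szdK // !szwK.
by rewrite mulmxA (Sz_bruhat_mx nf0).
Qed.


Lemma szdu a b l : l != 0 ->
  (szd l * szu a b)%g = (szu (a / theta l)%R (b / (l ^+ 2 * theta l))%R * szd l)%g.
Proof.
move=> nl; have ntl : theta l != 0 by rewrite theta_eq0.
by rewrite szud //; congr (_ * szu _ _)%g; field; rewrite ?nl ?ntl.
Qed.

Definition szU_set : {set {'GL_4[F]}} := [set szu x.1 x.2 | x in setX [set: F] [set: F]].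
Definition szB_set : {set {'GL_4[F]}} :=
  [set (szu x.1.1 x.1.2 * szd x.2)%g | x in setX (setX [set: F] [set: F]) [set~ 0]].

Lemma szUP (x : {'GL_4[F]}) : reflect (exists a, exists b, x = szu a b) (x \in szU_set).
Proof.
apply: (iffP imsetP) => [[[a b] _ ->]|[a [b ->]]]; first by exists a, b.
by exists (a, b); rewrite // !inE.
Qed.

Lemma szBP (x : {'GL_4[F]}) : reflect (exists a, exists b, exists2 k, k != 0 & x = (szu a b * szd k)%g)
  (x \in szB_set).
Proof.
apply: (iffP imsetP) => [[[[a b] k]]|[a [b [k nk ->]]]].
  by rewrite !inE /= => nk ->; exists a, b, k.
by exists (a, b, k); rewrite // !inE.
Qed.

Lemma szU_group_set : group_set szU_set.
Proof.
apply/group_setP; split=> [|x y /szUP[a [b ->]] /szUP[c [d ->]]].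
  by apply/szUP; exists 0, 0; rewrite szu0.
by apply/szUP; rewrite szuM; eexists; eexists.
Qed.
Canonical szU := Group szU_group_set.

Lemma szB_group_set : group_set szB_set.
Proof.
apply/group_setP; split=> [|x y /szBP[a [b [k nk ->]]] /szBP[c [d [l nl ->]]]].
  by apply/szBP; exists 0, 0, 1; rewrite ?oner_neq0 // szu0 szd1 mulg1.
apply/szBP; rewrite -mulgA (mulgA (szd k)) szdu // -(mulgA _ (szd k)) szdM //.
rewrite mulgA szuM; do 2 eexists; exists (k * l) => //; exact: mulf_neq0.
Qed.
Canonical szB := Group szB_group_set.

Lemma szu_U a b : szu a b \in szU. Proof. by apply/szUP; exists a, b. Qed.

Lemma szu_B a b : szu a b \in szB.
Proof. by apply/szBP; exists a, b, 1; rewrite ?oner_neq0 // szd1 mulg1. Qed.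

Lemma szd_B k : k != 0 -> szd k \in szB.
Proof. by move=> nk; apply/szBP; exists 0, 0, k; rewrite // szu0 mul1g. Qed.

Lemma szU_normal : (szU <| szB)%g.
Proof.
apply/andP; split; first by apply/subsetP=> x /szUP[a [b ->]]; apply: szu_B.
apply/subsetP=> x /szBP[a [b [k nk ->]]]; rewrite groupM //.
  by rewrite (subsetP (normG szU)) ?szu_U.
rewrite inE; apply/subsetP=> _ /imsetP[_ /szUP[c [d ->]] ->].
by rewrite conjgE szud // mulKg szu_U.
Qed.

Lemma card_szU : #|szU| = (#|F| ^ 2)%N.
Proof.
rewrite card_in_imset ?cardsX ?cardsT ?mulnn // => -[a b] [c d] _ _ /szu_inj[] /= -> ->.
by [].
Qed.

Lemma szB_entry a b k : k != 0 -> GLval (szu a b * szd k) (inord 1) (inord 1) = k.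
Proof.
move=> nk; rewrite GL_MxE szuK szdK // mxE !big_ord_recl big_ord0 !mxE !inordK //=.
by ring.
Qed.

Lemma card_szB : #|szB| = (#|szU| * #|F|.-1)%N.
Proof.
rewrite card_szU card_in_imset ?cardsX ?cardsT ?cardsC1 ?mulnn // => -[[a b] k] [[c d] l].
rewrite !inE /= => nk nl e.
have ekl : k = l by rewrite -(szB_entry a b nk) e szB_entry.
by move: e; rewrite ekl => /mulIg/szu_inj[-> ->].
Qed.

(** Conjugation by [szw] makes [u] upper triangular while [szB] is lower triangular, so the entries
    [a] and [b] above the diagonal vanish. *)
Lemma szw_upper u : u \in szU -> (u ^ szw)%g \in szB -> u = 1%g.
Proof.
case/szUP=> a [b ->] /szBP[c [d [k nk]]]; have wV : (szw^-1 = szw)%g.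
  by apply/eqP; rewrite eq_invg_mul szw2.
rewrite conjgE wV mulgA => /(congr1 (@GLval _ _)).
rewrite !GL_MxE !szuK szdK // szwK antidiagonal_conj => e.
have ea : a = 0.
  have := congr1 (fun M : 'M_4 => M (inord 0) (inord 1)) e.
  by rewrite !mxE !big_ord_recl big_ord0 !mxE !inordK //= => ->; ring.
have eb : b = 0.
  have := congr1 (fun M : 'M_4 => M (inord 1) (inord 3)) e.
  by rewrite !mxE !big_ord_recl big_ord0 !mxE !inordK //= => ->; ring.
by rewrite ea eb szu0.
Qed.

Lemma Sz_mem (x : {'GL_4[F]}) : (exists a, exists b, GLval x = Sz_unipotent a b) \/
  (exists2 k, k != 0 & GLval x = Sz_diagonal k) \/ GLval x = Sz_antidiagonal F -> x \in Sz F.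
Proof.
move=> h; apply: mem_gen; rewrite inE; apply/or3P; case: h => [[a [b ->]]|[[k nk ->]|->]].
- by apply: Or31; apply/existsP; exists a; apply/existsP; exists b.
- by apply: Or32; apply/existsP; exists k; rewrite nk eqxx.
- by apply: Or33.
Qed.

Lemma szw_Sz : szw \in Sz F.
Proof. by apply: Sz_mem; right; right; apply: szwK. Qed.

Lemma szB_Sz : szB \subset Sz F.
Proof.
apply/subsetP=> x /szBP[a [b [k nk ->]]]; apply: groupM; apply: Sz_mem.
  by left; exists a, b; apply: szuK.
right; left; exists (theta k); first by rewrite theta_eq0.
rewrite szdK // Sz_diagonalE; congr Sz_diag.
by rewrite /Sz_theta exprAC -/(Sz_theta _) theta_root.
Qed.

Lemma gen_closed (gT : finGroupType) (A X : {set gT}) : 1%g \in X ->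
  (forall x a : gT, x \in X -> a \in A -> (x * a)%g \in X) -> <<A>>%g \subset X.
Proof.
move=> X1 XA; apply/subsetP=> _ /gen_prodgP[n [c Ac ->]].
elim: n c Ac => [|n IHn] c Ac; first by rewrite big_ord0.
by rewrite big_ord_recr; apply: XA => //; apply: IHn => i; apply: Ac.
Qed.

(** [szB] and the big cell together are closed under right multiplication by the generators. The
    delicate generator is [szw]: unless the unipotent factor is 1, [quad_eq0] permits the use of
    [szwuw]. *)
Lemma Sz_bruhat g : g \in Sz F -> g \notin szB ->
  exists2 b, b \in szB & exists2 u, u \in szU & g = (b * szw * u)%g.
Proof.
pose X := [set x : {'GL_4[F]} | (x \in szB) || [exists b in szB, exists u in szU, x == (b * szw * u)%g]].
have XP (x : {'GL_4[F]}) : reflect (x \in szB \/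
    exists2 b, b \in szB & exists2 u, u \in szU & x = (b * szw * u)%g) (x \in X).
  rewrite inE; apply: (iffP orP) => [[Bx|/exists_inP[b Bb /exists_inP[u Uu /eqP->]]]|[Bx|[b Bb [u Uu ->]]]].
  - by left.
  - by right; exists b => //; exists u.
  - by left.
  - by right; apply/exists_inP; exists b => //; apply/exists_inP; exists u.
have sGX : Sz F \subset X.
  apply: gen_closed => [|x y /XP Xx]; first by rewrite inE group1.
  have UB := subsetP (normal_sub szU_normal).
  rewrite inE => /or3P[/existsP[c /existsP[d /eqP ey]]|/existsP[k /andP[nk /eqP ey]]|/eqP ey]; apply/XP.
  - have -> : y = szu c d by apply: GL_inj; rewrite szuK.
    case: Xx => [Bx|[b Bb [u Uu ->]]]; first by left; rewrite groupM ?szu_B.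
    by right; exists b => //; exists (u * szu c d)%g; rewrite ?groupM ?szu_U // !mulgA.
  - pose l := k ^+ (2 ^ Sz_exponent F); have nl : l != 0 by rewrite expf_neq0.
    have -> : y = szd l by apply: GL_inj; rewrite szdK // ey Sz_diagonalE.
    case: Xx => [Bx|[b Bb [u Uu ->]]]; first by left; rewrite groupM ?szd_B.
    right; exists (b * szd l^-1%R)%g; first by rewrite groupM ?szd_B ?invr_eq0.
    exists (u ^ szd l)%g; first by rewrite memJ_norm // (subsetP (normal_norm szU_normal)) ?szd_B.
    by rewrite -!mulgA; congr (_ * _)%g; rewrite (mulgA (szd _)) -szwd // conjgE -!mulgA mulKVg.
  - have -> : y = szw by apply: GL_inj; rewrite szwK.
    case: Xx => [Bx|[b Bb [u Uu ->]]].
      by right; exists x => //; exists 1%g; rewrite ?group1 // mulg1.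
    case/szUP: Uu => c [d ->]; have [f0|nf0] := eqVneq (quad c d) 0.
      have [-> ->] := quad_eq0 f0.
      by left; rewrite szu0 mulg1 -mulgA szw2 mulg1.
    have [k [a1 [b1 [a2 [b2 [nk e]]]]]] := szwuw nf0.
    right; exists (b * (szu a1 b1 * szd k))%g; first by rewrite !groupM ?szu_B ?szd_B.
    exists (szu a2 b2); rewrite ?szu_U // -!mulgA; congr (_ * _)%g.
    by rewrite (mulgA szw) e !mulgA.
by move=> /(subsetP sGX)/XP[->|].
Qed.


Lemma theta_inj x y : theta x = theta y -> x = y.
Proof.
move=> e; apply: char2_add_eq; apply/eqP.
by rewrite -theta_eq0 thetaD e char2_addr.
Qed.

Lemma szu_sqr a b : (szu a b ^+ 2)%g = szu 0 (theta a * a).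
Proof. by rewrite expgS expg1 szuM !char2_addr add0r. Qed.

Lemma szu_sqr_eq1 a b : ((szu a b ^+ 2)%g == 1%g) = (a == 0).
Proof.
rewrite szu_sqr; apply/eqP/eqP=> [|->]; last by rewrite mulr0 szu0.
rewrite -szu0 => /szu_inj[_] /eqP; rewrite mulf_eq0 theta_eq0 orbb => /eqP //.
Qed.

Lemma szu0_commute a b d : commute (szu a b) (szu 0 d).
Proof. by rewrite /commute !szuM theta0 mulr0 mul0r !addr0 add0r addrC. Qed.

(** A torus element [k] multiplies the parameter [b] by [k ^+ 2 * theta k = theta (k * theta k)];
    fixing [b != 0] gives [k * theta k = 1], so [k = 1] by [mul_theta_inj]. *)
Lemma szU_cent z : z \in szU -> #[z]%g = 2 -> ('C_szB[z] = szU)%g.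
Proof.
case/szUP=> a [b ->] /eqP/order2P[nz1 /eqP]; rewrite szu_sqr_eq1 => /eqP a0.
rewrite a0 in nz1 *; have nb0 : b != 0.
  by apply: contraNneq nz1 => ->; rewrite szu0.
apply/setP=> x; rewrite in_setI; apply/andP/szUP=> [[/szBP[c [d [k nk ->]]] /cent1P cx]|[c [d ->]]].
  have: (szd k * szu 0 b = szd k * szu (theta k * 0)%R (k ^+ 2 * theta k * b)%R)%g.
    rewrite -szud //; apply: (mulgI (szu c d)).
    by rewrite !mulgA [LHS]cx (szu0_commute c d b) mulgA.
  move/mulgI/szu_inj=> [_ eb].
  have: theta (k * theta k) = theta 1.
    rewrite thetaM thetaK theta1; apply: (mulIf nb0); rewrite mul1r [RHS]eb; ring.
  move/theta_inj=> ek; have k1 : k = 1 by apply: mul_theta_inj; rewrite ek theta1 mulr1.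
  by exists c, d; rewrite k1 szd1 mulg1.
by split; [apply: szu_B | apply/cent1P/szu0_commute].
Qed.

Lemma card_invol_szU : #|[set z in szU | #[z]%g == 2]| = #|F|.-1.
Proof.
have -> : [set z in szU | #[z]%g == 2] = [set szu 0 b | b in [set~ 0]].
  apply/setP=> z; apply/setIdP/imsetP=> [[/szUP[a [b ->]] /order2P[nz1 /eqP]]|[b]].
    rewrite szu_sqr_eq1 => /eqP a0; rewrite a0 in nz1 *; exists b => //.
    by rewrite !inE; apply: contraNneq nz1 => ->; rewrite szu0.
  rewrite !inE => nb0 ->; split; first exact: szu_U.
  apply/order2P; split; last by apply/eqP; rewrite szu_sqr_eq1.
  by apply: contraNneq nb0 => e; move: e; rewrite -szu0 => /szu_inj[_ ->].
by rewrite card_imset ?cardsC1 // => b d /szu_inj[].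
Qed.

Lemma szU_exp4 u : u \in szU -> (u ^+ 4 = 1)%g.
Proof.
case/szUP=> a [b ->]; rewrite (expgM _ 2 2) (szu_sqr a b).
by apply/eqP; rewrite szu_sqr_eq1.
Qed.

Lemma szU_sqr u v : u \in szU -> v \in szU -> (u ^+ 2 = v ^+ 2)%g -> (u ^+ 2 != 1)%g ->
  commute u v.
Proof.
case/szUP=> a [b ->] /szUP[c [d ->]]; rewrite !szu_sqr => /szu_inj[_ e] _.
have -> : a = c by apply: mul_theta_inj; rewrite mulrC e mulrC.
by rewrite /commute !szuM addrC (addrC b).
Qed.

(** The commutator with [szu (a * t) 0] has parameter [theta a * a * (theta t + t)], the square of
    [u] has [theta a * a], and [exists_theta_shift] keeps the factor away from 0 and 1. *)
Lemma szU_comm u : u \in szU -> (u ^+ 2 != 1)%g -> exists2 v, v \in szU &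
  [/\ [~ u, v] != 1, [~ u, v] != u ^+ 2 & [~ u, v] ^+ 2 = 1]%g.
Proof.
case/szUP=> a [b ->]; rewrite szu_sqr_eq1 => na0.
have [t [nt0 nt1]] := exists_theta_shift.
have com c : [~ szu a b, szu c 0]%g = szu 0 (theta a * c + theta c * a).
  rewrite commgEl conjgE mulgA -invMg; apply: (mulgI (szu c 0 * szu a b)%g).
  rewrite mulKVg !szuM; congr (szu _ _); first by rewrite addr0 addrC.
  by apply: (@char2_eq _ _ (- (theta c * a))); rewrite thetaD; ring.
exists (szu (a * t) 0); first exact: szu_U.
have na : theta a * a != 0 by rewrite mulf_neq0 // theta_eq0.
have e : theta a * (a * t) + theta (a * t) * a = theta a * a * (theta t + t).
  by rewrite thetaM; ring.
rewrite com e; split.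
- by apply/eqP; rewrite -szu0 => /szu_inj[_] /eqP; rewrite mulf_eq0 (negPf na) (negPf nt0).
- rewrite szu_sqr; apply/eqP=> /szu_inj[_] /eqP; rewrite -subr_eq0 -{2}[theta a * a]mulr1 -mulrBr.
  by rewrite mulf_eq0 (negPf na) subr_eq0 (negPf nt1).
- by apply/eqP; rewrite szu_sqr_eq1.
Qed.

(** The general bound 3q^2(q - 1) - 2 is q^3 below the required one, which leaves the extra colour
    for elements of order 4. *)
Lemma chi_Sz : let q := #|F| in
  (exists A : {set {'GL_4[F]}}, [/\ A \subset (Sz F)^#%g,
     {in A &, forall g h, sol g h} & #|A| = ((q ^ 2 + 1) * (q - 1))%N]) /\
  solcol (Sz F) (q ^ 2 * (4 * q - 3) - 2).
Proof.
move=> q; have q8 : (8 <= q)%N.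
  rewrite /q cardF (@leq_pexp2l 2 3) //.
  by case: p oddp p_gt1 => [|[|[|]]].
have evq : ~~ odd q by rewrite /q cardF oddX negb_or -lt0n ltnW.
have oddq1 : odd q.-1 by move: q8 evq; clearbody q; case: q => //= k _ /negbNE.
have pU : 2.-group%g szU by rewrite /pgroup card_szU cardF -expnM pnatX.
have cU : (2 < #|szU|)%N by rewrite card_szU -/q; move: q8; clearbody q; clear; nia.
have m1 : (1 < q.-1)%N by move: q8; clearbody q; clear; lia.
split.
  have [A [sA cA kA]] := involutions_split_rank_one szU_normal szB_Sz szw_Sz Sz_bruhat
    szw_upper pU cU card_szB oddq1 m1 card_invol_szU.
  exists A; split=> //; rewrite kA card_szU -/q; move: q8; clearbody q; clear; nia.
have le : (3 * (#|szU| * q.-1) - 2 < q ^ 2 * (4 * q - 3) - 2)%N.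
  by rewrite card_szU -/q; move: q8; clearbody q; clear; nia.
apply: (solcol_split_rank_one szU_normal szB_Sz szw_Sz Sz_bruhat szw_upper pU cU
  card_szB oddq1 m1 szU_cent card_invol_szU szU_exp4 szU_sqr szU_comm) => //.
exact: ltnW.
Qed.

End Suzuki.

(** * PSL(3,3) *)

Section SpecialLinear3.
Variable F : finFieldType.
Local Open Scope group_scope.
Hypothesis cardF : #|F| = 3.
Local Notation G := (SL_group 3 F).
Local Notation V := 'rV[F]_3.
Implicit Types (g h x : {'GL_3[F]}) (A H : {group {'GL_3[F]}}) (v : V).

Lemma F3_three0 : (3%:R = 0 :> F)%R.
Proof. exact: (card_pchar0 (n := 1)). Qed.

Lemma F3_cases (a : F) : [\/ a = 0, a = 1 | a = -1]%R.
Proof.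
have : (a * ((a - 1) * (a + 1)) == 0)%R.
  have -> : (a * ((a - 1) * (a + 1)) = a ^+ 3 - a)%R by ring.
  by rewrite -{1}cardF expf_card subrr.
rewrite !mulf_eq0 subr_eq0 addr_eq0.
by case/or3P=> /eqP ->; [constructor 1|constructor 2|constructor 3].
Qed.

Lemma F3_1N : (-1 : F)%R != 1%R.
Proof.
apply/eqP=> e; have /eqP := F3_three0.
have -> : (3%:R = 1 + 1 + 1 :> F)%R by ring.
by rewrite -{1}e addNr add0r oner_eq0.
Qed.

Definition gl3_act v g : V := (v *m GLval g)%R.

Fact gl3_act1 : gl3_act^~ 1 =1 id.
Proof. by move=> v; rewrite /gl3_act GL_1E mulmx1. Qed.

Fact gl3_actM v : act_morph gl3_act v.
Proof. by move=> g h; rewrite /gl3_act GL_MxE mulmxA. Qed.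

Canonical gl3_action := TotalAction gl3_act1 gl3_actM.
Local Notation to := gl3_action.

Lemma gl3_faithful g : 'Fix_to[g] = setT -> g = 1.
Proof.
move=> fg; apply: GL_inj; rewrite GL_1E; apply/row_matrixP=> i.
by rewrite !rowE mulmx1; apply: (afix1P (a := g) (to := to)); rewrite fg inE.
Qed.

Lemma card_fix3 (A : {set {'GL_3[F]}}) : #|'Fix_to(A)| %| 27.
Proof.
have gF : group_set ('Fix_to(A) : {set V}).
  apply/group_setP; split=> [|u v /afixP Au /afixP Av].
    by apply/afixP=> g _; exact: mul0mx.
  by apply/afixP=> g Ag; rewrite -{2}(Au g Ag) -{2}(Av g Ag); exact: mulmxDl.
have := cardSg (subsetT (Group gF)).
by rewrite cardsT card_mx cardF.
Qed.

Lemma order13_fix_set x (W : {set V}) : #[x] = 13 -> [acts <[x]>, on W | to] ->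
  #|W| = #|'Fix_(W | to)[x]| %[mod 13].
Proof.
move=> x13 aW; rewrite -afix_cycle; apply: (pgroup_fix_mod _ aW).
by rewrite /pgroup -orderE x13.
Qed.

Lemma dvd27_mod13 m : m %| 27 -> m = 1%N %[mod 13] -> m = 1%N \/ m = 27.
Proof.
move=> d27; have m27 := dvdn_leq (isT : 0 < 27) d27.
by case: m m27 d27; do 28?[case=> //]; auto.
Qed.

Lemma dvd16_mod13 m : m %| 16 -> 1 < m -> m <> 1%N %[mod 13].
Proof.
move=> d16; have m16 := dvdn_leq (isT : 0 < 16) d16.
by case: m m16 d16; do 17?[case=> //].
Qed.

Lemma order13_fix x : #[x] = 13 -> 'Fix_to[x] = [set 0%R].
Proof.
move=> x13; have /= := order13_fix_set x13 (W := setT) _.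
rewrite setTI cardsT card_mx cardF => /(_ _)/esym e27.
have [|f1|f27] := dvd27_mod13 (card_fix3 [set x]).
- apply: e27; apply/actsP=> g _ v; by rewrite !inE.
- apply/eqP; rewrite eq_sym eqEcard f1 cards1 andbT sub1set.
  by apply/afix1P; exact: mul0mx.
suff x1 : x = 1 by move: x13; rewrite x1 order1.
apply: gl3_faithful; apply/eqP; rewrite eqEcard subsetT.
by rewrite cardsT card_mx cardF f27.
Qed.

(** [x] acts on the fixed space of [A] and fixes only 0 there, so the size of that space is 1 modulo
    13 and divides 27. It is 1 or 27, and 27 makes [A] trivial by faithfulness. *)
Lemma order13_afix x (A : {set {'GL_3[F]}}) : #[x] = 13 -> x \in 'N(A) ->
  #|'Fix_to(A)| != 1%N -> A \subset [1].
Proof.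
move=> x13 nAx f1; have aF : [acts <[x]>, on 'Fix_to(A) | to].
  by apply: acts_fix_norm; rewrite cycle_subG.
have := order13_fix_set x13 aF.
rewrite order13_fix //; have -> : 'Fix_to(A) :&: [set 0%R] = [set (0%R : V)].
  apply/setIidPr; rewrite sub1set; apply/afixP=> g _; exact: mul0mx.
rewrite cards1 => /(dvd27_mod13 (card_fix3 A)) [|f27]; first by move/eqP; rewrite (negPf f1).
apply/subsetP=> g Ag; rewrite inE; apply/eqP/gl3_faithful/eqP; rewrite eqEsubset subsetT /=.
apply: subset_trans (_ : 'Fix_to(A) \subset _); last by apply: afixS; rewrite sub1set.
have /eqP -> : 'Fix_to(A) == setT; last by [].
by rewrite eqEcard subsetT cardsT card_mx cardF f27.
Qed.

Lemma pgroup3_fix A : 3.-group A -> #|'Fix_to(A)| != 1%N.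
Proof.
move=> A3; have aA : [acts A, on setT | to] by apply/actsP=> g _ v; rewrite !inE.
have := pgroup_fix_mod A3 aA; rewrite setTI cardsT card_mx cardF => e.
by apply/eqP=> f1; rewrite f1 in e.
Qed.

(** By [order13_afix], [g] fixes only 0; each [v + to v g] is fixed, so [g] is the scalar -1, whose
    determinant in dimension 3 is -1. *)
Lemma order13_involution x g : #[x] = 13 -> g \in G -> #[g] = 2 -> ~ commute x g.
Proof.
move=> x13 Gg g2 cxg.
have fg : #|'Fix_to[g]| = 1%N.
  have xC : x \in 'C[g] by apply/cent1P.
  apply/eqP; apply: contraT => /(order13_afix x13 xC); rewrite sub1set inE => /eqP g1.
  by move: g2; rewrite g1 order1.
have gN v : to v g = (- v)%R.
  have : (v + to v g)%R \in 'Fix_to[g].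
    have vgg : to (to v g) g = v.
      have gg : g * g = 1 by have h := expg_order g; rewrite g2 expgS expg1 in h.
      by rewrite -actM gg act1.
    have toD u w : to (u + w)%R g = (to u g + to w g)%R by exact: mulmxDl.
    by apply/afix1P; rewrite toD vgg addrC.
  have : 0%R \in 'Fix_to[g] by apply/afix1P; exact: mul0mx.
  have /cards1P[w ->] : #|'Fix_to[g]| == 1%N by rewrite fg.
  by rewrite !inE => /eqP <-; rewrite addrC addr_eq0 => /eqP.
have eg : GLval g = (-1)%:M%R.
  apply/row_matrixP=> i; rewrite !rowE; have /= := gN (delta_mx 0%R i).
  by rewrite /gl3_act => ->; rewrite mul_mx_scalar scaleN1r.
move: Gg; rewrite inE eg det_scalar -signr_odd /= expr1 => h.
by move: F3_1N; rewrite h.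
Qed.

Lemma order13_order3 x g : #[x] = 13 -> #[g] = 3 -> ~ commute x g.
Proof.
move=> x13 g3 cxg.
have nx : x \in 'N(<[g]>).
  by apply: (subsetP (cent_sub _)); rewrite cent_cycle; apply/cent1P.
have := order13_afix x13 nx (pgroup3_fix _).
rewrite /pgroup -orderE g3 => /(_ isT).
by rewrite cycle_subG inE -order_eq1 g3.
Qed.

(** The scalar -1 has determinant -1, so it exchanges the two determinant classes and SL(3,3) has
    index 2 in GL(3,3). *)
Lemma card_SL3 : #|G| = (2 ^ 4 * 3 ^ 3 * 13)%N.
Proof.
have detN : (\det ((-1)%:M : 'M[F]_3) = -1)%R.
  by rewrite det_scalar -signr_odd expr1.
pose n : {'GL_3[F]} := insubd (1 : {'GL_3[F]}) ((-1)%:M : 'M[F]_3)%R.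
have en : GLval n = ((-1)%:M)%R.
  by apply: insubdK; rewrite -topredE /= unitmxE detN unitrN1.
have eC : ~: SL 3 F = n *: SL 3 F.
  apply/setP=> g; rewrite mem_lcoset !inE GL_MxE GL_VxE det_mulmx det_inv en detN invrN1 mulN1r.
  have nd : (\det (GLval g) != 0)%R by have := GL_unitmx g; rewrite unitmxE unitfE.
  have N1 := F3_1N; move: nd; case: (F3_cases (\det (GLval g))%R) => ->; rewrite ?eqxx //.
    by rewrite (negPf N1).
  by rewrite opprK eqxx N1.
have := cardsC (SL 3 F); rewrite eC card_lcoset -cardsT => e.
have := card_GL F (isT : 0 < 3); rewrite -e cardF.
rewrite big_nat_recl // big_nat_recl // big_nat_recl // big_geq //.
rewrite (_ : 'C(3, 2) = 3) //; clear; move: #|SL 3 F| => c; lia.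
Qed.

Lemma prime_dvd_SL3 r : prime r -> r %| #|G| -> [\/ r = 2, r = 3 | r = 13].
Proof.
move=> r_pr; rewrite card_SL3 !Euclid_dvdM // !dvdn_prime2 // !orbb -orbA.
by case/or3P=> /eqP ->; [constructor 1|constructor 2|constructor 3].
Qed.

Lemma part_card_SL3 : (#|G|`_2 = 16)%N /\ (#|G|`_13 = 13)%N.
Proof.
rewrite card_SL3 !partnM //.
by split; rewrite !p_part.
Qed.

(** A central element of order 2 or 3 would commute with one of order 13, and a central element of
    order 13 with one of order 3. *)
Lemma center_SL3 : 'Z(G) = 1.
Proof.
apply/eqP; apply: contraT => nZ1.
have Z_gt1 : 1 < #|'Z(G)| by rewrite cardG_gt1.
have [z Zz oz] := Cauchy (pdiv_prime Z_gt1) (pdiv_dvd _).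
have [Gz /centP cGz] := setIP Zz.
have [x Gx x13] : {x | x \in G & #[x] = 13} by apply: Cauchy; rewrite // card_SL3 dvdn_mull.
have [t Gt t3] : {x | x \in G & #[x] = 3} by apply: Cauchy; rewrite // card_SL3.
have := @prime_dvd_SL3 #[z] _ (order_dvdG Gz); rewrite oz pdiv_prime // => /(_ isT).
rewrite -oz => -[] ez.
- by case: (order13_involution x13 Gz ez); apply/commute_sym/cGz.
- by case: (order13_order3 x13 ez); apply/commute_sym/cGz.
by case: (order13_order3 ez t3); apply/cGz.
Qed.

Lemma order13_Hall x H : #[x] = 13 -> x \in H -> H \subset G -> 13.-Sylow(H) <[x]>.
Proof.
move=> x13 Hx sHG; apply: (pHall_subl _ sHG); first by rewrite cycle_subG.
by rewrite pHallE cycle_subG (subsetP sHG x Hx) -orderE x13; have [_ ->] := part_card_SL3.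
Qed.

(** Take an elementary abelian normal r-subgroup [A] of [H]. For r = 2 its order divides 16, and
    counting modulo 13 gives an involution commuting with [x]. For r = 3 it fixes a nonzero vector,
    so [order13_afix] makes it trivial. Only r = 13 is left, where [A] is [<[x]>]. *)
Lemma order13_normal x H : #[x] = 13 -> x \in H -> H \subset G -> solvable H ->
  H \subset 'N(<[x]>).
Proof.
move=> x13 Hx sHG solH; have H1 : H :!=: 1.
  by apply/eqP=> H1; move: Hx x13; rewrite H1 inE => /eqP ->; rewrite order1.
have [A [sAH nAH nA1 /is_abelemP[r r_pr abA]]] := solvable_norm_abelem solH (normal_refl H) H1.
have nxA : x \in 'N(A) := subsetP (normal_norm nAH) x Hx.
have rA := abelem_pgroup abA.
have [_ rdA _] := pgroup_pdiv rA nA1.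
have [r2|r3|r13] := prime_dvd_SL3 r_pr (dvdn_trans rdA (cardSg (subset_trans sAH sHG))).
- subst r; have [a Aa [na1 cxa]] : exists2 a, a \in A & a != 1 /\ commute x a.
    have aA : [acts <[x]>, on A | 'J] by rewrite astabsJ cycle_subG.
    have := pgroup_fix_mod _ aA; rewrite /pgroup -orderE x13 => /(_ 13 isT).
    rewrite afixJ; have: (#|A| %| 16)%N.
      have [<- _] := part_card_SL3.
      rewrite -(part_pnat_id rA); apply: partn_dvd; rewrite ?cardG_gt0 //.
      by apply: cardSg; apply: subset_trans sHG.
    move=> A16; have A_gt1 : 1 < #|A| by rewrite cardG_gt1.
    have [C1 e|/trivgPn[a /setIP[Aa /centP cxa] na1] _] := eqVneq 'C_A(<[x]>) 1.
      by case: (dvd16_mod13 A16 A_gt1); rewrite e C1 cards1.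
    by exists a => //; split=> //; apply/commute_sym/cxa/cycle_id.
  by case: (order13_involution x13 (subsetP sHG a (subsetP sAH a Aa)) (abelem_order_p abA Aa na1)).
- subst r; case/negP: nA1; apply/eqP/trivgP.
  exact: order13_afix x13 nxA (pgroup3_fix rA).
subst r; have sylx := order13_Hall x13 Hx sHG.
have sAx : A \subset <[x]>.
  by apply: subset_trans (pcore_sub_Hall sylx); apply: pcore_max.
have -> : <[x]> = A.
  apply/esym/eqP; rewrite eqEcard sAx -orderE x13.
  by apply: dvdn_leq; rewrite ?cardG_gt0.
exact: normal_norm.
Qed.

End SpecialLinear3.

(** * Cosets of a subgroup of order 13 and the stabiliser of a line *)

Section LineStabiliser3.
Variable F : finFieldType.
Local Open Scope group_scope.
Hypothesis cardF : #|F| = 3.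
Local Notation G := (SL_group 3 F).
Local Notation V := 'rV[F]_3.
Implicit Types (g h x : {'GL_3[F]}) (A H : {group {'GL_3[F]}}) (v : V).
Local Notation to := (gl3_action F).

Lemma exists_order13 : exists2 x, x \in G & #[x] = 13.
Proof.
have /Cauchy[//|x Gx x13] : 13 %| #|G| by rewrite card_SL3 // dvdn_mull.
by exists x.
Qed.

(** Two distinct elements of one coset of [<[x]>] have a quotient generating [<[x]>], so if they
    generate a soluble group they normalise it and lie in [N]. Singletons in [N] and 432 cosets are
    enough. *)
Lemma solcol_SL3 : minimal_simple G -> solcol G 2830.
Proof.
case=> /simpleP[_ simG] nabG _; have [x Gx x13] := exists_order13.
have sylx := order13_Hall cardF x13 Gx (subxx _).
have sxG : <[x]> \subset G by rewrite cycle_subG.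
pose N := 'N_G(<[x]>).
(* The index of [N] is 1 modulo 13 and not 1, hence at least 14, and 5616 / 14 rounds down to
   401. *)
have cN : #|N| <= 401.
  have := card_Syl_mod G (isT : prime 13); rewrite (card_Syl sylx).
  have := Lagrange (subsetIl G 'N(<[x]>)); rewrite card_SL3 // -/N.
  have : #|G : N| != 1%N.
    apply/eqP=> /(index1g (subsetIl _ _))/eqP; rewrite eqEsubset => /andP[_ sGN].
    have /simG[] : <[x]> <| G by rewrite /normal sxG (subset_trans sGN) ?subsetIr.
    - by move=> x1; move: x13; rewrite orderE x1 cards1.
    by move=> ex; case/negP: nabG; rewrite -ex cycle_abelian.
  by move: #|N| #|G : N| => m k; clear; lia.
pose c y := if y \in N then [set y] else <[x]> :* y.
apply: (@colorable_on_image _ _ _ c ([set [set y] | y in N] :|: rcosets <[x]> G)).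
- move=> y /setD1P[_ Gy]; rewrite /c inE; case: ifP => Ny; first by rewrite imset_f.
  by rewrite mem_rcosets mulSGid // Gy orbT.
- apply: leq_trans (leq_card_setU _ _) _.
  apply: leq_trans (leq_add (leq_imset_card _ _) (leqnn _)) _.
  rewrite -[#|rcosets _ _|]/#|G : <[x]>|; have := Lagrange sxG; rewrite -orderE x13 card_SL3 //=.
  by move: cN; move: #|N| #|_ : _|=> m k; clear; lia.
move=> y z /setD1P[_ Gy] /setD1P[_ Gz] nyz solyz; apply/eqP=> eyz; case/eqP: nyz.
move: eyz; rewrite /c; case: ifP => Ny; case: ifP => Nz.
- by move/set1_inj.
- by move=> e; apply/esym/set1P; rewrite e rcoset_refl.
- by move=> e; apply/set1P; rewrite -e rcoset_refl.
move=> e; apply/eqP; apply: contraFT Ny => nyz.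
have Hy : y \in <<[set y; z]>> by rewrite mem_gen // !inE eqxx.
have Hz : z \in <<[set y; z]>> by rewrite mem_gen // !inE eqxx orbT.
have xyz : y * z^-1 \in <[x]> by rewrite -mem_rcoset -e rcoset_refl.
have ex : <[y * z^-1]> = <[x]>.
  apply/eqP; rewrite eqEcard cycle_subG xyz -!orderE x13.
  have : #[y * z^-1] %| 13 by rewrite -x13 order_dvdG.
  have /primeP[_ p13] : prime 13 by [].
  by case/p13/orP=> [|/eqP -> //]; rewrite order_eq1 -eq_mulgV1 (negPf nyz).
have Hx : x \in <<[set y; z]>>.
  have := cycle_id x; rewrite -ex; apply/subsetP.
  by rewrite cycle_subG groupM ?groupV.
rewrite inE Gy (subsetP (order13_normal cardF x13 Hx _ solyz)) //.
by rewrite gen_subG; apply/subsetP=> w /set2P[] ->.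
Qed.

Definition line3 : V := delta_mx 0%R 0%R.
Definition stab_line := [set g in G | (to line3 g == line3) || (to line3 g == - line3)%R].

Lemma stab_line_group : group_set stab_line.
Proof.
have toN v g : to (- v)%R g = (- to v g)%R by exact: mulNmx.
apply/group_setP; split=> [|g h]; first by rewrite inE group1 act1 eqxx.
move=> /setIdP[Gg eg] /setIdP[Gh eh]; apply/setIdP; split; first exact: groupM.
rewrite actM.
case/orP: eg => /eqP -> //; rewrite toN.
by case/orP: eh => /eqP ->; rewrite ?opprK eqxx ?orbT.
Qed.
Canonical stab_line_Group := Group stab_line_group.

(** The orbit of [line3] has at most 26 vectors, so the vector stabiliser has order at least 5616 /
    26 = 216; [g0], which negates [line3], doubles it. *)
Lemma card_stab_line : 432 <= #|stab_line|.
Proof.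
pose C := 'C_G[line3 | to].
have sCS : C \subset stab_line.
  by apply/subsetP=> g /setIP[Gg /astab1P e]; rewrite inE Gg e eqxx.
have l0 : line3 != 0%R.
  by apply/eqP=> /rowP/(_ 0%R)/eqP; rewrite !mxE eqxx oner_eq0.
have C216 : 216 <= #|C|.
  have := card_orbit_stab to G line3; rewrite card_SL3 // -/C.
  suff : #|orbit to G line3| <= 26 by move: #|C| #|orbit _ _ _|; clear=> m k; nia.
  have <- : #|[set~ (0%R : V)]| = 26 by rewrite cardsC1 card_mx cardF.
  apply/subset_leq_card/subsetP=> _ /orbitP[g _ <-]; rewrite !inE.
  apply: contra l0 => /eqP e; apply/eqP/(act_inj to g); rewrite e; apply/esym; exact: mul0mx.
pose d : V := (\row_i (if i == 2%:R then 1 else -1))%R.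
have dd : (\det (diag_mx d) = 1)%R.
  by rewrite det_diag !big_ord_recl big_ord0 !mxE /= !mulr1 mulrNN mulr1.
pose g0 : {'GL_3[F]} := insubd (1 : {'GL_3[F]}) (diag_mx d).
have eg : GLval g0 = diag_mx d.
  by apply: insubdK; rewrite -topredE /= unitmxE dd unitr1.
have g0l : to line3 g0 = (- line3)%R.
  rewrite /= /gl3_act eg; apply/rowP=> i; rewrite -rowE !mxE.
  by rewrite mulrb eq_sym; case: eqP => // _; rewrite oppr0.
have Sg0 : g0 \in stab_line by rewrite inE inE eg dd eqxx g0l eqxx orbT.
have nCg0 : g0 \notin C.
  rewrite inE negb_and; apply/orP; right; apply/negP=> /astab1P; rewrite g0l.
  by move/rowP/(_ 0%R)/eqP; rewrite !mxE eqxx /= (negPf (F3_1N cardF)).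
have := Lagrange sCS; rewrite -/C => <-.
have : 1 < #|stab_line : C| by rewrite indexg_gt1; apply: contra nCg0 => /subsetP ->.
move: C216; move: #|C| #|_ : _| => m k; clear; nia.
Qed.

(** Squares in the stabiliser fix [line3], but the square of an element of order 13 has order 13 and
    fixes only 0. *)
Lemma stab_line_proper : stab_line \proper G.
Proof.
rewrite properE; apply/andP; split; first by apply/subsetP=> g /setIdP[].
have [x Gx x13] := exists_order13; apply/negP=> /subsetP/(_ x Gx)/setIdP[_ ex].
have toN v g : to (- v)%R g = (- to v g)%R by exact: mulNmx.
have : line3 \in 'Fix_to[x ^+ 2].
  apply/afix1P; rewrite expgS expg1 actM.
  by case/orP: ex => /eqP ex; rewrite !ex // toN ex opprK.
rewrite order13_fix //; last by rewrite orderXgcd x13.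
by rewrite inE => /eqP/rowP/(_ 0%R)/eqP; rewrite !mxE eqxx oner_eq0.
Qed.

Lemma chi_SL3 : minimal_simple G ->
  431 <= chromatic_number (solubility_graph G) <= 2830.
Proof.
move=> minG; apply/andP; split; last exact: chromatic_number_le (solcol_SL3 minG).
have [_ _ solP] := minG; have solS := solP _ stab_line_proper.
apply: leq_trans (_ : #|stab_line^#| <= _).
  by have := card_stab_line; rewrite (cardsD1 1) group1.
apply: chromatic_number_ge => // [|g h /setD1P[_ Sg] /setD1P[_ Sh]].
  by rewrite setSD // proper_sub ?stab_line_proper.
apply: (solvableS _ solS); rewrite gen_subG.
by apply/subsetP=> w /set2P[] ->.
Qed.
End LineStabiliser3.

(** * The bounds *)

Lemma isog_center1 (gT : finGroupType) (H : {group gT}) :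
  ('Z(H) = 1 -> H \isog H / 'Z(H))%g.
Proof. by move=> ->; exact: quotient1_isog. Qed.

Lemma chi_bounds (gT rT : finGroupType) (G : {group gT}) (H : {group rT}) (A : {set rT}) l k :
    minimal_simple G -> G \isog H -> A \subset H^#%g -> {in A &, forall x y, sol x y} ->
    #|A| = l -> solcol H k ->
  l <= chromatic_number (solubility_graph G) <= k.
Proof.
move=> minG isoGH sAH cA <- colH; have minH := minimal_simple_isog isoGH minG.
by rewrite (chromatic_number_isog isoGH) // chromatic_number_ge ?chromatic_number_le.
Qed.

Lemma two_neq0_odd (F : finFieldType) p n : prime p -> odd p -> #|F| = p ^ n ->
  (2%:R != 0 :> F)%R.
Proof.
move=> p_pr odd_p cF; have p0 : (p%:R = 0 :> F)%R := card_pchar0 p_pr cF.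
apply/eqP=> two0; move: p0; rewrite -[p]odd_double_half odd_p natrD -mul2n natrM two0.
by rewrite mul0r addr0 => /eqP; rewrite oner_eq0.
Qed.

(** For odd p, 3^p is 3 modulo 4, so [x ^+ 2 = -1] would give [x ^+ (3 ^ p) = x ^+ 3 = - x], whereas
    it equals [x]. *)
Lemma nonsquareN1 (F : finFieldType) p : odd p -> #|F| = 3 ^ p ->
  forall x : F, (x ^+ 2 != -1)%R.
Proof.
move=> odd_p cF x; have two0 : (2%:R != 0 :> F)%R := two_neq0_odd (isT : prime 3) isT cF.
have [k ek] : exists k, 3 ^ p = k.*2.*2 + 3.
  rewrite -[p]odd_double_half odd_p expnD -mul2n expnM expn1 -[3 ^ 2]/9.
  elim: (p./2) => [|m [k IH]]; first by exists 0.
  by exists (9 * k + 6); move: IH; rewrite expnS -!muln2; move: (9 ^ m) => t; clear; lia.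
apply/eqP=> x2; have := expf_card x; rewrite cF ek exprD -mul2n exprM -mul2n exprM x2 sqrrN.
rewrite !expr1n mul1r exprSr x2 mulN1r => /eqP.
rewrite eq_sym -subr_eq0 opprK -mulr2n -mulr_natl mulf_eq0 (negPf two0) => /eqP x0.
by move/eqP: x2; rewrite x0 expr0n /= eq_sym oppr_eq0 oner_eq0.
Qed.

Lemma card_PSL23 (F : finFieldType) : #|F| = 3 -> #|PSL 2 F| <= 12.
Proof.
move=> cF; have two0 : (2%:R != 0 :> F)%R := @two_neq0_odd _ 3 1 isT isT cF.
have N1 : (-1 != 1 :> F)%R by rewrite eq_sym -subr_eq0 opprK.
have cGL : #|'GL_2[F]%g| = 48 by rewrite card_GL // cF big_nat_recl // big_nat1.
have SL24 : #|SL_group 2 F| <= 24.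
  have sSG : SL_group 2 F \subset 'GL_2[F]%g by apply: subsetT.
  have := Lagrange sSG; rewrite cGL.
  have : 1 < #|'GL_2[F] : SL_group 2 F|%g.
    rewrite indexg_gt1; apply/negP=> sGS.
    have du : (\det (mx2 (1 : F) 0 0 (-1)) = -1)%R by rewrite det_mx2; ring.
    pose g : {'GL_2[F]} := insubd (1%g : {'GL_2[F]}) (mx2 (1 : F) 0 0 (-1))%R.
    have eg : GLval g = (mx2 (1 : F) 0 0 (-1))%R.
      by apply: insubdK; rewrite -topredE /= unitmxE du unitrN1.
    have := subsetP sGS g (in_setT g); rewrite inE eg du; exact/negP.
  by move: #|SL_group 2 F| #|_ : _|%g => m k; clear; nia.
have Z2 : 2 <= #|'Z(SL 2 F)%g|.
  have Zz : sl2 (-1 : F)%R 0%R 0%R (-1)%R \in 'Z(SL 2 F)%g.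
    by apply/center_SL2P; exists (-1)%R; rewrite // sqrrN expr1n.
  rewrite cardG_gt1; apply/trivgPn; exists (sl2 (-1 : F) 0 0 (-1))%R => //.
  apply/eqP; rewrite -sl2_1 => /sl2_inj[||e _ _ _]; try ring.
  by rewrite e eqxx in N1.
have nZ : 'Z(SL_group 2 F)%g <| SL_group 2 F by apply: center_normal.
have := Lagrange (normal_sub nZ); rewrite -card_quotient ?normal_norm //.
rewrite -[#|PSL 2 F|]/#|(SL_group 2 F / 'Z(SL_group 2 F))%g|.
move: SL24 Z2; move: #|SL_group 2 F| #|_|%g #|_|%g => m k l; clear; nia.
Qed.

(** In characteristic 2, [a ^+ 2 = 1] means [(a - 1) ^+ 2 = 0], so the centre is trivial and
    PSL(2,q) is SL(2,q). *)
Lemma chi_PSL2_even (gT : finGroupType) (G : {group gT}) p (F : finFieldType) :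
    minimal_simple G -> 1 < p -> #|F| = 2 ^ p -> G \isog PSL 2 F ->
  2 ^ (2 * p) - 1 <= chromatic_number (solubility_graph G) <= 3 * 2 ^ p * (2 ^ p - 1) - 2.
Proof.
move=> minG p_gt1 cF isoG; have two0 : (2%:R = 0 :> F)%R := card_pchar0 (isT : prime 2) cF.
have Z1 : 'Z(SL 2 F)%g = 1%g.
  apply/trivgP/subsetP=> z /center_SL2P[a a2 ->]; rewrite inE; apply/eqP.
  suff -> : a = 1%R by rewrite sl2_1.
  apply/eqP; rewrite -subr_eq0 -sqrf_eq0; apply/eqP.
  have -> : ((a - 1) ^+ 2 = a ^+ 2 - 1 + (2%:R - 2%:R * a) :> F)%R by ring.
  by rewrite a2 two0 mul0r !subrr addr0.
have iso := isog_trans isoG (isog_symr (isog_center1 Z1)).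
have [[A [sA cA eA]] col] := chi_SL2_even p_gt1 cF.
rewrite (mulnC 2 p) expnM -cF; exact: chi_bounds minG iso sA cA eA col.
Qed.

Lemma chi_PSL2_pow3 (gT : finGroupType) (G : {group gT}) p (F : finFieldType) :
    minimal_simple G -> 1 < p -> odd p -> #|F| = 3 ^ p -> G \isog PSL 2 F ->
  (3 ^ p * (3 ^ p - 1)) %/ 2 <= chromatic_number (solubility_graph G)
    <= 3 ^ p * (3 ^ p + 1) - 2.
Proof.
move=> minG p_gt1 odd_p cF isoG.
have two0 : (2%:R != 0 :> F)%R := two_neq0_odd (isT : prime 3) isT cF.
have three0 : (3%:R = 0 :> F)%R := card_pchar0 (isT : prime 3) cF.
have [A [sA cA eA]] := involutions_PSL2 two0.
rewrite addn1 -cF; apply: (chi_bounds minG isoG sA cA eA).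
apply: solcol_PSL2_char3 => //; first exact: nonsquareN1 odd_p cF.
by rewrite cF; apply: leq_trans (_ : 3 ^ 2 <= _); rewrite // leq_exp2l.
Qed.

(** For p > 3 the coset colouring takes p(p - 1) colours, within the bound. For p = 2 and p = 3 the
    order is so small that every vertex can have its own colour. *)
Lemma chi_PSL2_prime (gT : finGroupType) (G : {group gT}) p (F : finFieldType) :
    minimal_simple G -> prime p -> #|F| = p -> G \isog PSL 2 F ->
  (p * (p - 1)) %/ 2 <= chromatic_number (solubility_graph G)
    <= (p - 1) * (2 * p + 3) - 2.
Proof.
move=> minG p_pr cF isoG; have [odd_p|] := boolP (odd p); last first.
  move=> even_p; have p2 : p = 2 by case: (even_prime p_pr) => // odd_p; rewrite odd_p in even_p.
  (* For p = 2 the bounds are 1 and 5: one vertex suffices below, and a group of order at most 6 has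
     at most 5 vertices. *)
  have cG : #|G| <= 6.
    rewrite (card_isog isoG); apply: leq_trans (leq_quotient _ _) _.
    apply: leq_trans (subset_leq_card (subsetT _)) _.
    by rewrite card_GL // cF p2 big_nat_recl // big_nat1.
  have [nG1 _] := simpleP _ (let: And3 h _ _ := minG in h).
  have [x Gx nx1] := trivgPn _ nG1.
  rewrite p2; apply: (@chi_bounds _ _ G G [set x] _ _ minG (isog_refl G)) => //.
  - by rewrite sub1set !inE nx1.
  - move=> _ _ /set1P -> /set1P ->; rewrite /sol /= setUid.
    exact/abelian_sol/cycle_abelian.
  - by rewrite cards1.
  exact: solcol_card.
have cF1 : #|F| = p ^ 1 by rewrite expn1.
have two0 : (2%:R != 0 :> F)%R := two_neq0_odd p_pr odd_p cF1.
have [A [sA cA eA]] := involutions_PSL2 two0.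
rewrite cF in eA; apply: (chi_bounds minG isoG sA cA eA).
have [p3|p_neq3] := eqVneq p 3.
  rewrite p3 in cF *; apply: solcol_card.
  exact: leq_trans (card_PSL23 cF) _.
have three0 : (3%:R != 0 :> F)%R.
  apply/eqP=> three0; have p_gt0 := prime_gt0 p_pr.
  have cop : coprime 3 p by rewrite prime_coprime // dvdn_prime2 // eq_sym (negPf p_neq3).
  have p0 : (p%:R = 0 :> F)%R := card_pchar0 p_pr cF1.
  have [u v e _] := egcdnP p (isT : 0 < 3).
  move/(congr1 (fun n => n%:R : F)%R): e.
  rewrite (eqP cop) natrD !natrM three0 p0 !mulr0 add0r => /eqP.
  by rewrite eq_sym oner_eq0.
have [c [cP cE]] := solcol_PSL2_large two0 three0; exists c; split=> // x Hx.
apply: leq_trans (cP x Hx) _; rewrite cF.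
by have := prime_gt1 p_pr; clear; nia.
Qed.

Lemma chi_Sz_isog (gT : finGroupType) (G : {group gT}) p (F : finFieldType) :
    minimal_simple G -> 1 < p -> odd p -> #|F| = 2 ^ p -> G \isog Sz F ->
  (2 ^ (2 * p) + 1) * (2 ^ p - 1) <= chromatic_number (solubility_graph G)
    <= 2 ^ (2 * p) * (4 * 2 ^ p - 3) - 2.
Proof.
move=> minG p_gt1 odd_p cF iso; have [[A [sA cA eA]] col] := chi_Sz odd_p p_gt1 cF.
rewrite (mulnC 2 p) expnM -cF; exact: chi_bounds minG iso sA cA eA col.
Qed.

Lemma chi_PSL3 (gT : finGroupType) (G : {group gT}) (F : finFieldType) :
    minimal_simple G -> #|F| = 3 -> G \isog PSL 3 F ->
  431 <= chromatic_number (solubility_graph G) <= 2830.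
Proof.
move=> minG cF isoG; have iso := isog_trans isoG (isog_symr (isog_center1 (center_SL3 cF))).
rewrite (chromatic_number_isog iso) //; exact: chi_SL3 cF (minimal_simple_isog iso minG).
Qed.

Theorem corollary5p9 (gT : finGroupType) (G : {group gT})
    (hG : minimal_simple G) :
  let chi := chromatic_number (solubility_graph G) in
  [/\ forall (p : nat) (F : finFieldType),
        prime p -> #|F| = 2 ^ p -> G \isog PSL 2 F ->
        2 ^ (2 * p) - 1 <= chi <= 3 * 2 ^ p * (2 ^ p - 1) - 2,
      forall (p : nat) (F : finFieldType),
        prime p -> odd p -> #|F| = 3 ^ p -> G \isog PSL 2 F ->
        (3 ^ p * (3 ^ p - 1)) %/ 2 <= chi <= 3 ^ p * (3 ^ p + 1) - 2,
      forall (p : nat) (F : finFieldType),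
        prime p -> p = 2 %[mod 5] \/ p = 3 %[mod 5] ->
        #|F| = p -> G \isog PSL 2 F ->
        (p * (p - 1)) %/ 2 <= chi <= (p - 1) * (2 * p + 3) - 2,
      forall (p : nat) (F : finFieldType),
        prime p -> odd p -> #|F| = 2 ^ p -> G \isog Sz F ->
        (2 ^ (2 * p) + 1) * (2 ^ p - 1) <= chi
          <= 2 ^ (2 * p) * (4 * 2 ^ p - 3) - 2
    & forall F : finFieldType,
        #|F| = 3 -> G \isog PSL 3 F -> 431 <= chi <= 2830].
Proof.
split=> [p F p_pr|p F p_pr odd_p|p F p_pr _|p F p_pr odd_p|F].
- exact: chi_PSL2_even (prime_gt1 p_pr).
- exact: chi_PSL2_pow3 (prime_gt1 p_pr) _.
- exact: chi_PSL2_prime.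
- exact: chi_Sz_isog (prime_gt1 p_pr) _.
exact: chi_PSL3.
Qed.
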